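(* Let $X_4$ be the blow-up of $\mathbb{P}^3$ along four lines $l_1,\dots,l_4$ in general position. Then the effective cone of $X_4$ is the closed rational polyhedral cone in $\mathrm{N}^1(X_4)_{\mathbb{R}}$, with coordinates $(d,m_1,\dots,m_4)$, given by the following inequalities: $$0\le d,$$ $$m_i\le d \quad \text{for all } i\in\{1,\dots,4\},$$ $$m_i+m_j\le d \quad \text{for all } i,j\in\{1,\dots,4\},\ i\ne j,$$ $$(m_1+\cdots+m_4)+m_i\le 2d \quad \text{for all } i\in\{1,\dots,4\},$$ $$2(m_1+\cdots+m_4)\le 3d.$$
   Context: We work over the complex numbers. ''In general position'' means that $(l_1,\dots,l_4)$ is a general point of the fourfold product of the Grassmannian of lines in $\mathbb{P}^3$, i.e. the assertion holds for all tuples in some nonempty Zariski open subset. Let $H$ be the class on $X_4$ of the pull-back of a general plane of $\mathbb{P}^3$ and let $E_1,\dots,E_4$ be the exceptional divisors over $l_1,\dots,l_4$. The classes $H,E_1,\dots,E_4$ form a basis of the Néron–Severi space $\mathrm{N}^1(X_4)_{\mathbb{R}}\cong\mathbb{R}^{5}$, and $(d,m_1,\dots,m_4)$ denotes the coordinates of the class $D=dH-\sum_{i=1}^4 m_iE_i$. The effective cone of $X_4$ is the convex cone in $\mathrm{N}^1(X_4)_{\mathbb{R}}$ generated by the classes of effective divisors. *)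

(* Defs.v *)
From HB Require Import structures.
From mathcomp Require Import all_boot all_order all_algebra.
From mathcomp Require Import mpoly.
From mathcomp Require Import mathcomp_extra boolp classical_sets functions.
From mathcomp Require Import cardinality fsbigop reals.
From mathcomp Require Import complex.

Set Implicit Arguments.
Unset Strict Implicit.
Unset Printing Implicit Defensive.

Import GRing.Theory Num.Theory.

Local Open Scope classical_set_scope.
Local Open Scope ring_scope.

(** * Products of projective spaces

    The coordinates are indexed by a finite type [T], and [b : T -> K] sends
    a coordinate to the projective factor it belongs to; [K] indexes the
    factors.  A point is represented by any vector of homogeneous
    coordinates, so a subset of the product is a set of vectors that is
    stable under rescaling each block.  Sets defined by multihomogeneous
    equations are automatically of this kind. *)

Notation mpolyT F T := {mpoly F[#|T|]}.

Definition var (F : fieldType) (T : finType) (t : T) : mpolyT F T :=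
  'X_(enum_rank t).

Definition peval (F : fieldType) (T : finType) (P : mpolyT F T) (p : T -> F)
  : F := P.@[fun k => p (enum_val k)].

Definition mproj (F : fieldType) (T K : finType) (b : T -> K) : set (T -> F) :=
  [set p | forall j : K, exists2 t, b t = j & p t != 0].

Definition mhomog (F : fieldType) (T K : finType) (b : T -> K) (e : K -> nat)
    (P : mpolyT F T) : Prop :=
  forall m, m \in msupp P ->
  forall j : K, (\sum_(k < #|T| | b (enum_val k) == j) m k)%N = e j.

Definition zclosed (F : fieldType) (T K : finType) (b : T -> K)
    (Z : set (T -> F)) : Prop :=
  exists S : set (mpolyT F T),
    (forall P, S P -> exists e, mhomog b e P) /\
    Z = [set p | mproj b p /\ forall P, S P -> peval P p = 0].

Definition zopen (F : fieldType) (T K : finType) (b : T -> K)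
    (U : set (T -> F)) : Prop :=
  exists2 Z, zclosed b Z & U = mproj b `\` Z.

Definition zclosure (F : fieldType) (T K : finType) (b : T -> K)
    (A : set (T -> F)) : set (T -> F) :=
  [set p | forall Z, zclosed b Z -> A `<=` Z -> Z p].

Definition subvariety (F : fieldType) (T K : finType) (b : T -> K)
    (V : set (T -> F)) : Prop :=
  [/\ zclosed b V, V !=set0 &
    forall Y Z, zclosed b Y -> zclosed b Z ->
      V `<=` Y `|` Z -> V `<=` Y \/ V `<=` Z].

Definition vanishing_ideal (F : fieldType) (T : finType) (V : set (T -> F))
  : set (mpolyT F T) := [set P | forall p, V p -> peval P p = 0].

(** * Divisors on a smooth subvariety [X] of a product of projective spaces *)

Definition prime_divisor (F : fieldType) (T K : finType) (b : T -> K)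
    (X V : set (T -> F)) : Prop :=
  [/\ subvariety b V, V `<` X &
    forall W, subvariety b W -> V `<` W -> ~ W `<` X].

Definition curve (F : fieldType) (T K : finType) (b : T -> K)
    (X C : set (T -> F)) : Prop :=
  [/\ subvariety b C, C `<=` X, exists2 W, subvariety b W & W `<` C &
    forall W1 W2, subvariety b W1 -> subvariety b W2 ->
      W1 `<` W2 -> ~ W2 `<` C].

Fixpoint ideal_pow (A : comNzRingType) (J : set A) (n : nat) : set A :=
  if n is n'.+1 then
    [set P | exists2 s : seq (A * A),
       {in s, forall gh, J gh.1 /\ ideal_pow J n' gh.2} &
       P = \sum_(gh <- s) gh.1 * gh.2]
  else setT.

(** [P] lies in the [n]-th power of the maximal ideal of the local ring of [X]
    along [V]: that ring consists of the fractions of multihomogeneous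
    polynomials of equal multidegree, modulo the ideal of [X], whose
    denominator does not vanish identically on [V].  The factor [G] below
    clears the denominators. *)
Definition vanishes_to_order (F : fieldType) (T K : finType) (b : T -> K)
    (X V : set (T -> F)) (n : nat) (P : mpolyT F T) : Prop :=
  exists G Q : mpolyT F T,
    [/\ exists e, mhomog b e G,
        ~ vanishing_ideal V G,
        ideal_pow (vanishing_ideal V) n Q &
        vanishing_ideal X (G * P - Q)].

Definition ord_along (F : fieldType) (T K : finType) (b : T -> K)
    (X V : set (T -> F)) (P : mpolyT F T) : nat :=
  xget 0%N [set n | vanishes_to_order b X V n P /\
                    ~ vanishes_to_order b X V n.+1 P].

(** A divisor is the function giving the coefficient of each prime divisor;
    it takes the value [0] on sets that are not prime divisors. *)
Definition divisor_of (F : fieldType) (T K : finType) (b : T -> K)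
    (X : set (T -> F)) (P : mpolyT F T) (V : set (T -> F)) : nat :=
  if `[< prime_divisor b X V >] then ord_along b X V P else 0%N.

Definition effective_divisor (F : fieldType) (T K : finType) (b : T -> K)
    (X : set (T -> F)) (D : set (T -> F) -> nat) : Prop :=
  finite_set [set V | D V <> 0%N] /\
  forall V, D V <> 0%N -> prime_divisor b X V.

(** ** Numerical equivalence *)

(** The scheme-theoretic intersection of [V] and [C] is finite of length [n]:
    in all large diagonal multidegrees, the multihomogeneous coordinate ring
    of the intersection has dimension [n] over the base field. *)
Definition intersection_length (F : fieldType) (T K : finType) (b : T -> K)
    (V C : set (T -> F)) (n : nat) : Prop :=
  exists N : nat, forall k : nat, (N <= k)%N ->
  exists2 B : 'I_n -> mpolyT F T,
    forall i, mhomog b (fun=> k) (B i) &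
    forall P : mpolyT F T, mhomog b (fun=> k) P ->
      exists! c : 'rV[F]_n, exists Q1 Q2 : mpolyT F T,
        [/\ vanishing_ideal V Q1, vanishing_ideal C Q2 &
            P - \sum_(i < n) c ord0 i *: B i = Q1 + Q2].

(** The pairing of a divisor [D] with a curve on which the prime divisor [V]
    has degree [c V]. *)
Definition pairing (S : pzRingType) (F : fieldType) (T : finType)
    (c : set (T -> F) -> int) (D : set (T -> F) -> S) : S :=
  \sum_(V \in setT) D V * (c V)%:~R.

(** [c V] is the intersection number of [V] with [C], for all prime divisors
    [V].  On a smooth [X] this is determined by additivity, by invariance under
    linear equivalence, and by its value, the length of the intersection, on
    the prime divisors not containing [C]. *)
Definition intersection_numbers (F : fieldType) (T K : finType) (b : T -> K)
    (X C : set (T -> F)) (c : set (T -> F) -> int) : Prop :=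
  (forall V, prime_divisor b X V -> ~ C `<=` V ->
     exists2 n : nat, intersection_length b V C n & c V = n%:Z) /\
  (forall (e : K -> nat) (P Q : mpolyT F T),
     mhomog b e P -> mhomog b e Q ->
     ~ vanishing_ideal X P -> ~ vanishing_ideal X Q ->
     pairing c (fun V => (divisor_of b X P V)%:Z - (divisor_of b X Q V)%:Z)
     = 0).

Definition num_equiv (S : pzRingType) (F : fieldType) (T K : finType)
    (b : T -> K) (X : set (T -> F)) (D D' : set (T -> F) -> S) : Prop :=
  forall C c, curve b X C -> intersection_numbers b X C c ->
    pairing c D = pairing c D'.

(** The class of the [R]-divisor [D] in the Neron-Severi space belongs to the
    convex cone generated by the classes of effective divisors. *)
Definition in_effective_cone (R : realType) (F : fieldType) (T K : finType)
    (b : T -> K) (X : set (T -> F)) (D : set (T -> F) -> R) : Prop :=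
  exists (r : nat) (a : 'I_r -> R) (E : 'I_r -> set (T -> F) -> nat),
    [/\ forall k, 0 <= a k,
        forall k, effective_divisor b X (E k) &
        num_equiv b X D (fun V => \sum_(k < r) a k * (E k V)%:R)].

(** * Four lines in projective space *)

(** A line of P^3 is the common zero locus of two independent linear forms,
    the columns of a 4 x 2 matrix of rank 2; its Pluecker coordinates are the
    2 x 2 minors of that matrix.  All the minors, indexed by pairs (j, k), are
    kept: this places the Grassmannian of lines in a linear subspace of P^15,
    and does not change its Zariski topology. *)
Definition four_lines (F : fieldType) (A : 'I_4 -> 'M[F]_(4, 2)) : Prop :=
  forall i, \rank (A i) = 2%N.

Definition pluecker_coord : finType := ('I_4 * ('I_4 * 'I_4))%type.

Definition pluecker_block (t : pluecker_coord) : 'I_4 := t.1.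

Definition pluecker (F : fieldType) (A : 'I_4 -> 'M[F]_(4, 2))
    (t : pluecker_coord) : F :=
  let: (i, (j, k)) := t in
  A i j ord0 * A i k ord_max - A i j ord_max * A i k ord0.

Definition for_general_lines (F : fieldType)
    (Pr : ('I_4 -> 'M[F]_(4, 2)) -> Prop) : Prop :=
  exists U : set (pluecker_coord -> F),
    [/\ zopen pluecker_block U,
        exists2 A, four_lines A & U (pluecker A) &
        forall A, four_lines A -> U (pluecker A) -> Pr A].

(** * The blow-up

    It is embedded in P^3 x (P^1)^4: the coordinate [inl j] is the [j]-th
    coordinate of P^3, and [inr (i, a)] is the [a]-th coordinate of the
    [i]-th P^1. *)
Definition bl_coord : finType := ('I_4 + 'I_4 * 'I_2)%type.

Definition bl_block (t : bl_coord) : option 'I_4 :=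
  match t with inl _ => None | inr (i, _) => Some i end.

Definition base_pt (F : fieldType) (p : bl_coord -> F) : 'rV[F]_4 :=
  \row_j p (inl j).

Definition fiber_pt (F : fieldType) (p : bl_coord -> F) (i : 'I_4) : 'rV[F]_2 :=
  \row_a p (inr (i, a)).

(** The closure of the graph of the rational map given by the pairs of
    linear forms defining the lines. *)
Definition blowup (F : fieldType) (A : 'I_4 -> 'M[F]_(4, 2))
  : set (bl_coord -> F) :=
  zclosure bl_block
    [set p | mproj bl_block p /\ forall i, base_pt p *m A i != 0 /\
       exists t : F, fiber_pt p i = t *: (base_pt p *m A i)].

(** The pull-back of the plane with equation [\sum_j h_j x_j = 0]. *)
Definition plane_divisor (F : fieldType) (A : 'I_4 -> 'M[F]_(4, 2))
    (h : 'rV[F]_4) : set (bl_coord -> F) -> nat :=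
  divisor_of bl_block (blowup A)
    (\sum_(j < 4) h ord0 j *: var F (inl j : bl_coord)).

Definition exceptional_divisor (F : fieldType) (A : 'I_4 -> 'M[F]_(4, 2))
    (i : 'I_4) (V : set (bl_coord -> F)) : nat :=
  `[< V = [set p | blowup A p /\ base_pt p *m A i = 0] >].

(* Main.v *)
Require Import Defs.
From HB Require Import structures.
From mathcomp Require Import all_boot all_order all_algebra.
From mathcomp Require Import mpoly.
From mathcomp Require Import boolp classical_sets.
From mathcomp Require Import cardinality fsbigop reals complex.
From mathcomp Require Import zify ring lra.

Set Implicit Arguments.
Unset Strict Implicit.
Unset Printing Implicit Defensive.

Import Order.TTheory GRing.Theory Num.Theory.

Local Open Scope classical_set_scope.
Local Open Scope ring_scope.

(** Write [l_i] for the [i]-th line, [x *m A i] for its two equations, [E_i] for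
    the exceptional divisor over it and [X] for the blow-up.

    Prime divisors.  A surface of [X] is one of the [E_i] or the strict
    transform of a surface [f = 0] of P^3, with [f] a prime form: equations on
    [X] become forms on P^3 by restriction to the graph ([Psi]), and unique
    factorization together with the Nullstellensatz for one equation
    ([hypersurface_nullstellensatz]) single out [f].  This is [prime_divisorP].
    Orders of vanishing are read off in polynomial rings.  Along the strict
    transform of [f] the order of [P] is the exponent of [f] in [Psi P].  Along
    [E_i] it is the exponent of the parameter in [theta i P], where [theta i] is
    evaluation along a family of points that tends to a general point of [E_i].
    The same family measures the multiplicity [mult i f] of [f] along [l_i].
    Hence a function [cl h eps] that is additive on divisors, with the value
    [deg f * h - \sum_i mult i f * eps i] at the strict transform of [f] and
    [eps i] at [E_i], kills the principal divisors ([divisor_paired]).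

    Coordinates of a class.  The functions [cl 1 0] and [cl 0 (- delta_i)] are
    the intersection numbers with two kinds of curves: a line of P^3 that
    misses the four lines, and a fibre of [E_i] over [l_i] ([line_numbers],
    [fib_numbers]).  They compute the coordinates [d] and [m_i], so
    numerically equivalent divisors have the same coordinates.

    Necessity.  All the inequalities hold for [E_i], whose class is
    [(0; - delta_i)].  Let [f] be a prime form of degree [d] with
    multiplicities [m_i].  On a line through a general point of P^3 that meets
    [l_i] and [l_j], [f] has a zero of order [m_i] and another of order [m_j];
    so [m_i + m_j <= d].  Likewise [m_i + m_j + m_k <= d] if [f] does not vanish
    on all the lines that meet [l_i], [l_j] and [l_k].  These lines sweep out
    the quadric through [l_i], [l_j] and [l_k]; if [f] vanishes on it, then the
    quadric is a power of [f], up to a constant, and its class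
    [(2; 1, 1, 1, 0)] satisfies the inequalities.  In the other case the
    inequalities are sums of the preceding ones ([surface_inequalities]).

    Sufficiency.  By elementary convex geometry ([generated]) the cone defined
    by the inequalities is generated by the classes of the [E_i], of the planes
    through a line, [H - E_i], and of the quadrics through three lines,
    [2H - E_i - E_j - E_k].

    Generality.  Two properties of the lines are used: they are pairwise
    disjoint, and none of them lies on the quadric through the three others.
    The second one holds if the discriminant [discriminant] of the products of
    the incidence numbers of complementary pairs is not zero
    ([line_not_in_quadric]).  Both are open conditions on the Pluecker
    coordinates, and an explicit quadruple satisfies them. *)

(** * Prime elements *)

Section Divisibility.
Variable A : idomainType.
Implicit Types a b c p : A.

Definition divides a b := exists c, b = c * a.

Definition prime_elt p :=
  [/\ p != 0, p \isn't a GRing.unit &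
      forall a b, divides p (a * b) -> divides p a \/ divides p b].

Definition ufd := forall a, a != 0 ->
  exists (u : A) (s : seq A),
    [/\ u \is a GRing.unit, forall p, p \in s -> prime_elt p &
        a = u * \prod_(p <- s) p].

Lemma divides_mull a b c : divides a b -> divides a (c * b).
Proof. by case=> d ->; exists (c * d); rewrite mulrA. Qed.

Lemma divides_mulr a b c : divides a b -> divides a (b * c).
Proof. by rewrite mulrC; exact: divides_mull. Qed.

Lemma divides_refl a : divides a a.
Proof. by exists 1; rewrite mul1r. Qed.

Lemma divides0 a : divides a 0.
Proof. by exists 0; rewrite mul0r. Qed.

Lemma divides_trans a b c : divides a b -> divides b c -> divides a c.
Proof. by move=> [d ->] [e ->]; exists (e * d); rewrite mulrA. Qed.

Lemma dividesD a b c : divides a b -> divides a c -> divides a (b + c).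
Proof. by move=> [d ->] [e ->]; exists (d + e); rewrite mulrDl. Qed.

Lemma divides_sum (I : Type) (r : seq I) (P : pred I) (f : I -> A) a :
  (forall i, P i -> divides a (f i)) -> divides a (\sum_(i <- r | P i) f i).
Proof.
move=> H; elim/big_rec: _ => [|i x Pi]; first exact: divides0.
by apply: dividesD; exact: H.
Qed.

Lemma divides_unit a b : divides a b -> b \is a GRing.unit ->
  a \is a GRing.unit.
Proof. by move=> [c ->]; rewrite unitrM => /andP[]. Qed.

Lemma unit_divides a b : a \is a GRing.unit -> divides a b.
Proof. by move=> ua; exists (b / a); rewrite divrK. Qed.

Lemma prime_nunit p a : prime_elt p -> divides p a -> a \isn't a GRing.unit.
Proof. by move=> [_ np _] pa; apply: contra np; exact: divides_unit. Qed.

Lemma prime_dvdX p a n : prime_elt p -> divides p (a ^+ n) -> divides p a.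
Proof.
move=> Pp; elim: n => [|n IH].
  by rewrite expr0 => /(prime_nunit Pp); rewrite unitr1.
by rewrite exprS => /(let: And3 _ _ h := Pp in h)[].
Qed.

Lemma prime_dvd_prod p (I : eqType) (r : seq I) (P : pred I) (f : I -> A) :
  prime_elt p -> divides p (\prod_(i <- r | P i) f i) ->
  exists i, [/\ i \in r, P i & divides p (f i)].
Proof.
move=> Pp; elim: r => [|i r IH].
  by rewrite big_nil => /(prime_nunit Pp); rewrite unitr1.
rewrite big_cons; case: ifP => Pi.
  case/(let: And3 _ _ h := Pp in h) => [pi|/IH[j [jr Pj pj]]].
    by exists i; rewrite mem_head.
  by exists j; rewrite inE jr orbT.
by move=> /IH[j [jr Pj pj]]; exists j; rewrite inE jr orbT.
Qed.

Lemma prime_assoc p q : prime_elt p -> prime_elt q -> divides p q ->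
  exists2 u, u \is a GRing.unit & q = u * p.
Proof.
move=> [_ np _] [q0 _ Pq] [u qE]; exists u => //.
have [] := Pq u p; first by rewrite -qE; exact: divides_refl.
- case=> v vE; case/negP: np; apply/unitrP; exists v.
  have e : v * p = 1 by apply: (mulfI q0); rewrite mulr1 mulrCA mulrA -vE -qE.
  by split=> //; rewrite mulrC.
- case=> v pE; apply/unitrP; exists v.
  have p0 : p != 0 by apply: contraNneq q0 => p0; rewrite qE p0 mulr0.
  have e : v * u = 1 by apply: (mulIf p0); rewrite mul1r -mulrA -qE.
  by split=> //; rewrite mulrC.
Qed.

(** Applied to leading coefficients, this is the measure that decreases when a
    constant prime factor is split off from a polynomial. *)
Definition has_length (n : nat) a := exists (u : A) (s : seq A),
  [/\ size s = n, u \is a GRing.unit, forall p, p \in s -> prime_elt p &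
      a = u * \prod_(p <- s) p].

(** The prime [p] divides one of the factors of [p * b]; unless it is the first
    one, that factor can be cancelled from both sides. *)
Lemma has_length_div n p b : prime_elt p -> has_length n (p * b) ->
  exists2 k, n = k.+1 & has_length k b.
Proof.
move=> Pp [u [s [<- uu Ps E]]]; have p0 : p != 0 by case: Pp.
elim: s u uu Ps b E => [|x s IH] u uu Ps b E.
  have /(prime_nunit Pp) : divides p (p * b).
    by apply: divides_mulr; exact: divides_refl.
  by rewrite E big_nil mulr1 uu.
have Px : prime_elt x by apply: Ps; rewrite mem_head.
have Ps' q : q \in s -> prime_elt q by move=> qs; apply: Ps; rewrite inE qs orbT.
have x0 : x != 0 by case: Px.
rewrite big_cons in E.
have : divides p (x * (u * \prod_(q <- s) q)).
  by rewrite mulrCA -E; apply: divides_mulr; exact: divides_refl.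
case/(let: And3 _ _ h := Pp in h).
  move=> px; have [w uw xE] := prime_assoc Pp Px px.
  exists (size s) => //; exists (u * w), s; split=> //; first by rewrite unitrM uu.
  by apply: (mulfI p0); rewrite E xE; ring.
case=> b' E'; rewrite [b' * p]mulrC in E'.
have [k /= -> [u' [s' [<- uu' Ps'' E'']]]] := IH u uu Ps' b' (esym E').
exists (size s').+1 => //; exists u', (x :: s'); split=> //.
  by move=> q; rewrite inE => /orP[/eqP->|/Ps''].
apply: (mulfI p0); rewrite E big_cons mulrCA E' E''; ring.
Qed.
End Divisibility.

(** * Unique factorization for polynomials *)

Section PolyFactorial.
Variable A : idomainType.
Hypothesis facA : ufd A.
Implicit Types (p c : A) (f g q d : {poly A}).

Lemma divides_polyC p f : divides p%:P f <-> forall i, divides p f`_i.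
Proof.
split=> [[g ->] i|H]; first by rewrite coefMC; exists g`_i.
have /choice[h hE] : forall i, exists c, f`_i = c * p by move=> i; exact: H.
exists (\poly_(i < size f) h i); apply/polyP => i.
rewrite coefMC coef_poly; case: ltnP => [_|le]; first exact: hE.
by rewrite mul0r nth_default.
Qed.

(** Gauss's lemma: look at the first coefficients of [f] and [g] that are not
    multiples of [p]. *)
Lemma prime_polyC p : prime_elt p -> prime_elt p%:P.
Proof.
move=> Pp; have [p0 np Pmul] := Pp; split; first by rewrite polyC_eq0.
  by rewrite poly_unitE coefC eqxx size_polyC p0.
move=> f g /divides_polyC fg; apply: contrapT => /not_orP[nf ng].
have exm h : ~ divides p%:P h -> exists n, ~ divides p h`_n /\
    forall i, (i < n)%N -> divides p h`_i.
  move=> nh; have ex : exists n, `[< ~ divides p h`_n >].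
    apply: contrapT => /forallNP H; apply: nh; apply/divides_polyC => i.
    by apply: contrapT => ni; apply: (H i); apply/asboolP.
  case: (ex_minnP ex) => n /asboolP nn min; exists n; split=> // i lt.
  by apply: contrapT => /asboolP/min; rewrite leqNgt lt.
have [m [nm mlt]] := exm _ nf; have [n [nn nlt]] := exm _ ng.
have := fg (m + n)%N; rewrite coefM.
have mlt' : (m < (m + n).+1)%N by rewrite ltnS leq_addr.
rewrite (bigD1 (Ordinal mlt')) //= addKn => H.
have : divides p (f`_m * g`_n).
  set S := \sum_(i < _ | _) _ in H.
  have dS : divides p S.
    apply: divides_sum => i; rewrite -val_eqE /= => im.
    case: (ltngtP i m) im => // lt _.
      by apply: divides_mulr; exact: mlt.
    apply: divides_mull; apply: nlt; have := ltn_ord i; lia.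
  have -> : f`_m * g`_n = (f`_m * g`_n + S) + (-1) * S by ring.
  by apply: dividesD => //; apply: divides_mull.
by case/Pmul.
Qed.

(** The prime factors of [c] stay prime in [{poly A}], so each of them divides
    [q] or [d] and can be cancelled. *)
Lemma clear_denominator c f q d : c != 0 -> c%:P * f = q * d ->
  exists q' d' (c1 c2 : A), [/\ c1 != 0, c2 != 0, f = q' * d',
    q = c1%:P * q' & d = c2%:P * d'].
Proof.
move=> c0; have [u [s [uu Ps ->]]] := facA c0.
elim: s f q d Ps => [|p s IH] f q d Ps E.
  have u0 : u != 0 by apply: contraTneq uu => ->; rewrite unitr0.
  exists ((u^-1)%:P * q), d, u, 1; split; rewrite ?oner_neq0 ?mul1r //.
    rewrite -mulrA -E big_nil mulr1 mulrA -polyCM mulVr // mul1r //.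
  by rewrite mulrA -polyCM divrr // mul1r.
have Pp := Ps p (mem_head _ _).
have [p0 _ Pm] := prime_polyC Pp.
have Ps' x : x \in s -> prime_elt x by move=> xs; apply: Ps; rewrite inE xs orbT.
have : divides p%:P (q * d).
  by rewrite -E big_cons mulrCA polyCM -mulrA; apply: divides_mulr; exact: divides_refl.
case/Pm => [[q1 qE]|[d1 dE]].
  have [|q' [d' [c1 [c2 [n1 n2 fE q1E dE]]]]] := IH f q1 d Ps'.
    apply: (mulfI p0); rewrite [RHS]mulrA [p%:P * q1]mulrC -qE -E big_cons.
    by rewrite !polyCM; ring.
  exists q', d', (c1 * p), c2; split=> //.
    by rewrite mulf_neq0 // -(polyC_eq0 p).
  by rewrite qE q1E polyCM; ring.
have [|q' [d' [c1 [c2 [n1 n2 fE qE d1E]]]]] := IH f q d1 Ps'.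
  apply: (mulfI p0); rewrite [RHS]mulrCA [p%:P * d1]mulrC -dE -E big_cons.
  by rewrite !polyCM; ring.
exists q', d', c1, (c2 * p); split=> //.
  by rewrite mulf_neq0 // -(polyC_eq0 p).
by rewrite dE d1E polyCM; ring.
Qed.

Definition primitive f := forall p, prime_elt p -> ~ divides p%:P f.

Lemma primitive_dvd f g c : primitive f -> c != 0 ->
  divides f (c%:P * g) -> divides f g.
Proof.
move=> prim c0; have [u [s [uu Ps ->]]] := facA c0.
elim: s g Ps => [|p s IH] g Ps [w E].
  exists ((u^-1)%:P * w); rewrite -mulrA -E big_nil mulr1.
  by rewrite mulrA -polyCM mulVr // mul1r.
have Pp := Ps p (mem_head _ _); have [p0 _ Pm] := prime_polyC Pp.
have : divides p%:P (w * f).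
  by rewrite -E big_cons mulrCA polyCM -mulrA; apply: divides_mulr; exact: divides_refl.
case/Pm => [[w' wE]|]; last by move/(prim _ Pp).
apply: IH; first by move=> x xs; apply: Ps; rewrite inE xs orbT.
exists w'; apply: (mulfI p0); rewrite [RHS]mulrA [p%:P * w']mulrC -wE -E big_cons.
by rewrite !polyCM; ring.
Qed.

(** Take [d] of least degree in the ideal generated by [f] and [g]: the
    remainders of pseudo-division by [d] belong to the ideal, so they vanish. *)
Lemma least_combination f g : f != 0 ->
  exists d a b, [/\ d != 0, d = a * f + b * g,
    exists c q, c != 0 /\ c%:P * f = q * d &
    exists c q, c != 0 /\ c%:P * g = q * d].
Proof.
move=> f0.
pose I n := `[< exists d a b, [/\ size d = n, d != 0 & d = a * f + b * g] >].
have exI : exists n, I n.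
  by exists (size f); apply/asboolP; exists f, 1, 0; split=> //; ring.
case: (ex_minnP exI) => n /asboolP[d [a [b [sd d0 dE]]]] min.
have red h a' b' : h = a' * f + b' * g -> exists c q, c != 0 /\ c%:P * h = q * d.
  move=> hE; have lc : lead_coef d ^+ Pdiv.Ring.rscalp h d != 0.
    by rewrite expf_neq0 // lead_coef_eq0.
  exists (lead_coef d ^+ Pdiv.Ring.rscalp h d), (Pdiv.Ring.rdivp h d); split=> //.
  rewrite mul_polyC Pdiv.ComRing.rdivp_eq.
  suff -> : Pdiv.Ring.rmodp h d = 0 by rewrite addr0.
  apply/eqP; apply: contraT => r0.
  have := Pdiv.Ring.ltn_rmodp h d; rewrite d0 sd ltnNge => /negP[].
  apply: min; apply/asboolP; exists (Pdiv.Ring.rmodp h d).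
  set k := lead_coef d ^+ _ in lc.
  exists (k%:P * a' - Pdiv.Ring.rdivp h d * a), (k%:P * b' - Pdiv.Ring.rdivp h d * b).
  split=> //; have := Pdiv.ComRing.rdivp_eq d h; rewrite -/k -mul_polyC => e.
  have -> : Pdiv.Ring.rmodp h d = k%:P * h - Pdiv.Ring.rdivp h d * d.
    by rewrite e addrC addKr.
  by rewrite hE {2}dE; ring.
exists d, a, b; split=> //; first by apply: (red f 1 0); ring.
by apply: (red g 0 1); ring.
Qed.

Definition unsplittable f := forall q d, f = q * d ->
  (size q <= 1)%N \/ (size d <= 1)%N.

(** The constant [r] plays the part of a resultant: it lies in the ideal of [f]
    and [g], since a common factor of positive degree would be [f] up to a
    constant. *)
Lemma resultant_exists f g : primitive f -> unsplittable f -> f != 0 ->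
  ~ divides f g -> exists r a b, r != 0 /\ r%:P = a * f + b * g.
Proof.
move=> prim uns f0 nfg.
have [d [a [b [d0 dE [c [q [c0 cf]]] [c' [q' [c'0 cg]]]]]]] :=
  least_combination g f0.
have [sd|sd] := leqP (size d) 1.
  exists d`_0, a, b; split; last by rewrite -dE -size1_polyC.
  by rewrite -polyC_eq0 -size1_polyC.
have [q1 [d1 [c1 [c2 [c10 c20 fE qE d1E]]]]] := clear_denominator c0 cf.
case: (uns _ _ fE) => [sq|]; last first.
  by move: sd; rewrite d1E size_Cmul // ltnNge => /negbTE->.
exfalso; apply: nfg.
have q1E := size1_polyC sq; set e := q1`_0 in q1E.
have e0 : e != 0.
  by apply: contraNneq f0 => e0; rewrite fE q1E e0 mul0r.
have ue : e \is a GRing.unit.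
  have [u [[|p s] [uu Ps eE]]] := facA e0; first by rewrite eE big_nil mulr1.
  case: (prim p (Ps _ (mem_head _ _))); exists ((u * \prod_(x <- s) x)%:P * d1).
  by rewrite fE q1E eE big_cons !polyCM; ring.
have d1f : d1 = (e^-1)%:P * f.
  by rewrite fE q1E mulrA -polyCM mulVr // mul1r.
apply: (primitive_dvd prim c'0); rewrite cg d1E d1f.
by do 3 apply: divides_mull; exact: divides_refl.
Qed.

(** If [f] divides [g * h] but not [g], multiply a relation
    [r%:P = a * f + b * g] by [h]. *)
Lemma unsplittable_prime f : primitive f -> unsplittable f -> (1 < size f)%N ->
  prime_elt f.
Proof.
move=> prim uns sf; have f0 : f != 0 by rewrite -size_poly_gt0; lia.
split=> //; first by rewrite poly_unitE; case: eqP sf => // ->.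
move=> g h fgh; apply: contrapT => /not_orP[ng nh].
have [r [a [b [r0 rE]]]] := resultant_exists prim uns f0 ng.
apply: nh; apply: (primitive_dvd prim r0); rewrite rE mulrDl.
apply: dividesD; last by rewrite -mulrA; exact: divides_mull.
by rewrite mulrAC; exact/divides_mull/divides_refl.
Qed.

Lemma prime_primitive f : prime_elt f -> (1 < size f)%N -> primitive f.
Proof.
move=> Pf sf p Pp pf; have [u uu fE] := prime_assoc (prime_polyC Pp) Pf pf.
have [p0 _ _] := Pp.
by move: uu sf; rewrite poly_unitE fE mulrC size_Cmul // => /andP[/eqP->].
Qed.

Lemma prime_unsplittable f : prime_elt f -> unsplittable f.
Proof.
move=> Pf q d fE; have [f0 _ Pm] := Pf.
have [q0 d0] : q != 0 /\ d != 0.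
  by apply/andP; rewrite -negb_or -mulf_eq0 -fE.
have [] := Pm q d; first by rewrite -fE; exact: divides_refl.
- case=> v qE; right; have vd : v * d = 1.
    by apply: (mulfI f0); rewrite mulr1 {2}fE qE; ring.
  by have : d \is a GRing.unit by [apply/unitrP; exists v; split; rewrite // mulrC];
     rewrite poly_unitE => /andP[/eqP->].
- case=> v dE; left; have vd : v * q = 1.
    by apply: (mulfI f0); rewrite mulr1 {2}fE dE; ring.
  by have : q \is a GRing.unit by [apply/unitrP; exists v; split; rewrite // mulrC];
     rewrite poly_unitE => /andP[/eqP->].
Qed.

(** Splitting off the primes of [A] that divide [f]; there are finitely many
    because they divide the leading coefficient. *)
Lemma content_split f : f != 0 ->
  exists (u : A) (s : seq A) g, [/\ u \is a GRing.unit,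
    forall p, p \in s -> prime_elt p, primitive g & f = (u * \prod_(p <- s) p)%:P * g].
Proof.
move=> f0; have : exists n, has_length n (lead_coef f).
  have lf : lead_coef f != 0 by rewrite lead_coef_eq0.
  have [u [s [uu Ps E]]] := facA lf; by exists (size s), u, s.
case=> n; elim: n f f0 => [|n IH] f f0 len.
  exists 1, [::], f; split; rewrite ?unitr1 ?big_nil ?mulr1 ?mul1r //.
  move=> p Pp [g gE]; move: len; rewrite gE lead_coefM lead_coefC mulrC.
  by move/(has_length_div Pp) => [].
have [prim|/existsNP[p /not_implyP[Pp /contrapT[g gE]]]] := pselect (primitive f).
  by exists 1, [::], f; rewrite unitr1 big_nil mulr1 mul1r.
have g0 : g != 0 by apply: contraNneq f0 => g0; rewrite gE g0 mul0r.
move: len; rewrite gE lead_coefM lead_coefC mulrC => /(has_length_div Pp)[k [<-] len].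
have [u [s [h [uu Ps primh ->]]]] := IH g g0 len.
exists u, (p :: s), h; split=> //.
  by move=> x; rewrite inE => /orP[/eqP->|/Ps].
by rewrite big_cons !polyCM; ring.
Qed.

(** By induction on the degree, after splitting off the constant primes. *)
Theorem ufd_poly : ufd {poly A}.
Proof.
move=> f; have [n] := ubnP (size f); elim: n f => // n IH f sf f0.
have [u [s [g [uu Ps prim fE]]]] := content_split f0.
have s0 : u * \prod_(p <- s) p != 0.
  by apply: contraNneq f0 => e; rewrite fE e mul0r.
have g0 : g != 0 by apply: contraNneq f0 => e; rewrite fE e mulr0.
have sg : size g = size f by rewrite fE size_Cmul.
suff [u' [s' [uu' Ps' gE]]] : exists (u : {poly A}) (s : seq {poly A}),
    [/\ u \is a GRing.unit, forall h, h \in s -> prime_elt h &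
        g = u * \prod_(h <- s) h].
  exists (u%:P * u'), ([seq p%:P | p <- s] ++ s'); split.
  - by rewrite unitrM uu' andbT rmorph_unit.
  - move=> p; rewrite mem_cat => /orP[/mapP[q qs ->]|/Ps' //].
    exact/prime_polyC/Ps.
  - by rewrite fE gE big_cat /= big_map polyCM rmorph_prod; ring.
have [sg1|sg1] := leqP (size g) 1.
  have gE := size1_polyC sg1; have g00 : g`_0 != 0 by rewrite -polyC_eq0 -gE.
  have [v [t [uv Pt E]]] := facA g00.
  exists v%:P, [seq p%:P | p <- t]; split.
  - by rewrite rmorph_unit.
  - by move=> p /mapP[q qt ->]; exact/prime_polyC/Pt.
  - by rewrite {1}gE E big_map polyCM rmorph_prod.
have [uns|/existsNP[q /existsNP[d /not_implyP[gE /not_orP[]]]]] :=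
    pselect (unsplittable g).
  exists 1, [:: g]; split; rewrite ?unitr1 ?mul1r ?big_seq1 // => p.
  by rewrite inE => /eqP->; exact: unsplittable_prime.
move=> /negP; rewrite -ltnNge => sq /negP; rewrite -ltnNge => sd.
have q0 : q != 0 by rewrite -size_poly_gt0; lia.
have d0 : d != 0 by rewrite -size_poly_gt0; lia.
have sE : size g = (size q + size d).-1 by rewrite gE size_mul.
have [|u1 [s1 [uu1 Ps1 qE]]] := IH q _ q0; first by lia.
have [|u2 [s2 [uu2 Ps2 dE]]] := IH d _ d0; first by lia.
exists (u1 * u2), (s1 ++ s2); split.
- by rewrite unitrM uu1.
- by move=> p; rewrite mem_cat => /orP[/Ps1|/Ps2].
- by rewrite gE qE dE big_cat /=; ring.
Qed.

End PolyFactorial.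

(** * Multivariate polynomials over an algebraically closed field *)

Section RingIso.
Variables (A B : idomainType) (f : {rmorphism A -> B}) (g : B -> A).
Hypotheses (fK : cancel f g) (gK : cancel g f).

Lemma iso_divides a b : divides (f a) (f b) <-> divides a b.
Proof.
split=> [[c cE]|[c ->]]; last by exists (f c); rewrite rmorphM.
by exists (g c); apply: (can_inj fK); rewrite rmorphM gK.
Qed.

Lemma iso_unit a : (f a \is a GRing.unit) = (a \is a GRing.unit).
Proof.
apply/idP/idP; last exact: rmorph_unit.
move=> ufa; have [] := (iso_divides a 1).1; first exact: unit_divides.
by move=> c cE; apply/unitrP; exists c; split; rewrite // mulrC.
Qed.

Lemma iso_prime a : prime_elt (f a) <-> prime_elt a.
Proof.
have f0 x : (f x == 0) = (x == 0) by rewrite -(inj_eq (can_inj fK)) rmorph0.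
split=> [[n0 nu Pm]|[n0 nu Pm]]; split; rewrite ?f0 ?iso_unit // in n0 nu *.
  by move=> x y /iso_divides; rewrite rmorphM => /Pm[]/iso_divides; tauto.
move=> x y; rewrite -[x]gK -[y]gK -rmorphM => /iso_divides/Pm[]h;
  [left|right]; exact/iso_divides.
Qed.

Lemma ufd_iso : ufd B -> ufd A.
Proof.
move=> facB a a0; have fa0 : f a != 0 by rewrite -(rmorph0 f) (inj_eq (can_inj fK)).
have [u [s [uu Ps E]]] := facB _ fa0.
exists (g u), (map g s); split.
- by rewrite -iso_unit gK.
- by move=> p /mapP[q qs ->]; apply/iso_prime; rewrite gK; exact: Ps.
- apply: (can_inj fK); rewrite E rmorphM gK rmorph_prod big_map.
  by congr (_ * _); apply: eq_bigr => i _; rewrite gK.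
Qed.

End RingIso.

Lemma mpoly_hom_ext (n : nat) (R : comNzRingType) (S : comNzRingType)
    (f g : {rmorphism {mpoly R[n]} -> S}) :
  (forall c, f c%:MP = g c%:MP) -> (forall i, f 'X_i = g 'X_i) -> f =1 g.
Proof.
move=> fgC fgX p; rewrite [p]mpolyE !rmorph_sum; apply: eq_bigr => m _.
rewrite -mul_mpolyC !rmorphM fgC mpolyXE_id !rmorph_prod; congr (_ * _).
by apply: eq_bigr => i _; rewrite !rmorphXn fgX.
Qed.

Lemma poly_hom_ext (R : comNzRingType) (S : comNzRingType)
    (f g : {rmorphism {poly R} -> S}) :
  (forall c, f c%:P = g c%:P) -> f 'X = g 'X -> f =1 g.
Proof.
move=> fgC fgX p; rewrite -[p]coefK poly_def !rmorph_sum; apply: eq_bigr => m _.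
by rewrite -mul_polyC !rmorphM fgC !rmorphXn /= fgX.
Qed.

Section LastVariable.
Variables (R : comNzRingType) (n : nat).
Local Notation widen := (widen_ord (leqnSn n)).

Lemma muniX_last : muni ('X_ord_max : {mpoly R[n.+1]}) = 'X.
Proof.
rewrite /muni mmapX mmap1U; case: splitP => // j /= e.
by have := ltn_ord j; rewrite -e ltnn.
Qed.

Lemma muniX_widen i : muni ('X_(widen i) : {mpoly R[n.+1]}) = ('X_i)%:P.
Proof.
rewrite /muni mmapX mmap1U; case: splitP => [j /= e|k /= e].
  by congr ('X_ _)%:P; exact/val_inj.
by have := ltn_ord i; rewrite e; lia.
Qed.

Lemma ord_last_or_widen (i : 'I_n.+1) : i = ord_max \/ exists j, i = widen j.
Proof.
have := ltn_ord i; rewrite ltnS leq_eqVlt => /orP[/eqP e|lt].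
  by left; exact: val_inj.
by right; exists (Ordinal lt); exact: val_inj.
Qed.

Definition muni_inv (q : {poly {mpoly R[n]}}) : {mpoly R[n.+1]} :=
  horner_eval 'X_ord_max (map_poly (@mwiden n R) q).

Lemma mwiden_var i : mwiden ('X_i : {mpoly R[n]}) = 'X_(widen i).
Proof. by rewrite /mwiden mmapX mmap1U. Qed.

Lemma muniK : cancel (@muni n R) muni_inv.
Proof.
move=> p; rewrite /muni_inv.
apply: (@mpoly_hom_ext _ _ _ (horner_eval 'X_ord_max \o map_poly (@mwiden n R) \o @muni n R) idfun) => [c|i] /=.
  by rewrite muniC map_polyC /horner_eval hornerC /= mwidenC.
have [->|[j ->]] := ord_last_or_widen i.
  by rewrite muniX_last map_polyX /horner_eval hornerX.
by rewrite muniX_widen map_polyC /horner_eval hornerC /= mwiden_var.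
Qed.

Lemma muni_mwiden p : muni (mwiden p) = p%:P :> {poly {mpoly R[n]}}.
Proof.
apply: (@mpoly_hom_ext _ _ _ (@muni n R \o @mwiden n R) polyC) => [c|i] /=.
  by rewrite mwidenC muniC.
by rewrite mwiden_var muniX_widen.
Qed.

Lemma muni_invK : cancel muni_inv (@muni n R).
Proof.
move=> q; rewrite /muni_inv.
apply: (@poly_hom_ext _ _ (@muni n R \o horner_eval 'X_ord_max \o map_poly (@mwiden n R)) idfun) => [c|] /=.
  by rewrite map_polyC /horner_eval hornerC /= muni_mwiden.
by rewrite map_polyX /horner_eval hornerX muniX_last.
Qed.

Lemma meval_muni (p : {mpoly R[n.+1]}) (v : 'I_n -> R) x :
  p.@[fun i => oapp v x (unlift ord_max i)] = (map_poly (meval v) (muni p)).[x].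
Proof.
set w := fun i => _.
have wl : w ord_max = x by rewrite /w unlift_none.
have ww j : w (widen j) = v j.
  have -> : widen j = lift ord_max j by apply: val_inj; rewrite /= /bump leqNgt ltn_ord.
  by rewrite /w liftK.
apply: (@mpoly_hom_ext _ _ _ (meval w) (horner_eval x \o map_poly (meval v) \o @muni n R)) => [c|i] /=.
  by rewrite mevalC muniC map_polyC /horner_eval hornerC /= mevalC.
rewrite mevalXU; have [->|[j ->]] := ord_last_or_widen i.
  by rewrite wl muniX_last map_polyX /horner_eval hornerX.
by rewrite ww muniX_widen map_polyC /horner_eval hornerC /= mevalXU.
Qed.

End LastVariable.

(** In no variables there are only constants. *)
Lemma unit_mpoly0 (F : fieldType) (p : {mpoly F[0]}) :
  p != 0 -> p \is a GRing.unit.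
Proof.
have pE : p = (p@_0)%:MP.
  apply/mpolyP => m; rewrite mcoeffC; have -> : m = 0%MM by apply/mnmP => -[].
  by rewrite eqxx mulr1.
by rewrite pE mpolyC_eq0 => p0; rewrite rmorph_unit // unitfE.
Qed.

Lemma ufd_mpoly (F : fieldType) n : ufd {mpoly F[n]}.
Proof.
elim: n => [p p0|n IH].
  by exists p, [::]; rewrite big_nil mulr1 unit_mpoly0.
exact: ufd_iso (@muniK F n) (@muni_invK F n) (ufd_poly IH).
Qed.

Section Nullstellensatz.
Variable F : numClosedFieldType.

Lemma poly_nonroot (p : {poly F}) : p != 0 -> exists x, p.[x] != 0.
Proof.
move=> p0; apply: contrapT => /forallNP H.
pose s := [seq (i%:R : F) | i <- iota 0 (size p)].
have us : uniq s.
  by rewrite map_inj_uniq ?iota_uniq // => i j /eqP; rewrite eqr_nat => /eqP.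
have rs : all (root p) s.
  by apply/allP => x _; rewrite /root; apply: contrapT => /negP; exact: H.
by have := max_poly_roots p0 rs us; rewrite size_map size_iota ltnn.
Qed.

(** The last variable is specialised once the leading coefficient does not
    vanish at the chosen values of the others. *)
Lemma mpoly_nonroot n (p : {mpoly F[n]}) : p != 0 -> exists v, p.@[v] != 0.
Proof.
elim: n p => [|n IH] p p0.
  have /unit_mpoly0 up := p0; exists (fun=> 0).
  by rewrite -unitfE; exact: (rmorph_unit (meval _)).
have q0 : muni p != 0 by rewrite -(muni0 n F) (inj_eq (can_inj (@muniK F n))).
have [|v lv] := IH (lead_coef (muni p)); first by rewrite lead_coef_eq0.
have [|x mx] := @poly_nonroot (map_poly (meval v) (muni p)).
  apply: contraNneq lv => /(congr1 (fun q : {poly F} => q`_(size (muni p)).-1)).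
  by rewrite coef_map coef0 => ->.
by exists (fun i => oapp v x (unlift ord_max i)); rewrite meval_muni.
Qed.

Lemma prime_polyC_inv (A : idomainType) (p : A) :
  prime_elt (p%:P : {poly A}) -> prime_elt p.
Proof.
have dC (a b : A) : divides a%:P b%:P <-> divides a b.
  split=> [/divides_polyC/(_ 0%N)|[c ->]]; first by rewrite coefC eqxx.
  by exists c%:P; rewrite polyCM.
move=> [p0 np Pm]; split; first by rewrite -polyC_eq0.
  by apply: contra np => up; rewrite rmorph_unit.
by move=> a b /dC; rewrite polyCM => /Pm[]/dC; tauto.
Qed.

(** If [f] does not divide [g], take a point of the other coordinates at which
    the resultant does not vanish.  Over it [f] has a root in the last
    coordinate, so that [g], and with it the resultant, vanishes. *)
Theorem hypersurface_nullstellensatz n (f g : {mpoly F[n]}) : prime_elt f ->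
  (forall v, f.@[v] = 0 -> g.@[v] = 0) -> divides f g.
Proof.
elim: n f g => [|n IH] f g Pf fg.
  by have [/unit_mpoly0 uf /negP[]] := Pf.
apply/(iso_divides (@muniK F n) (@muni_invK F n)).
have Pf' : prime_elt (muni f) by apply/(iso_prime (@muniK F n) (@muni_invK F n)).
have fg' v x : (map_poly (meval v) (muni f)).[x] = 0 ->
    (map_poly (meval v) (muni g)).[x] = 0.
  have := fg (fun i => oapp v x (unlift ord_max i)).
  by rewrite (meval_muni f) (meval_muni g).
suff key (f' g' : {poly {mpoly F[n]}}) : prime_elt f' -> (forall v x,
    (map_poly (meval v) f').[x] = 0 -> (map_poly (meval v) g').[x] = 0) ->
  divides f' g' by exact: key Pf' fg'.
move=> {Pf' fg'}{}Pf {}fg.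
have [sf|sf] := leqP (size f') 1.
  have fE := size1_polyC sf; move: Pf fg; rewrite fE => Pf fg.
  apply/divides_polyC => i.
  apply: IH; first exact: prime_polyC_inv.
  move=> v fv; have g0 : map_poly (meval v) g' = 0.
    apply/eqP; apply: contraT => /poly_nonroot[x /eqP[]].
    by apply: fg; rewrite map_polyC hornerC.
  by rewrite -(coef_map (meval v)) g0 coef0.
apply: contrapT => nfg; have [f0 _ _] := Pf.
have facA := @ufd_mpoly F n.
have [r [a [b [r0 rE]]]] := resultant_exists facA (prime_primitive Pf sf)
  (prime_unsplittable Pf) f0 nfg.
(* At [v] the degree of [f'] does not drop and the resultant does not vanish. *)
have [|v] := @mpoly_nonroot n (r * lead_coef f').
  by rewrite mulf_neq0 // lead_coef_eq0.
rewrite mevalM mulf_eq0 negb_or => /andP[rv lv].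
have sfv : size (map_poly (meval v) f') = size f' by exact: size_map_poly_id0.
have [|x rx] := closed_rootP (map_poly (meval v) f') _; first by rewrite sfv; lia.
case/negP: rv; apply/eqP.
have := congr1 (fun q => (map_poly (meval v) q).[x]) rE.
rewrite map_polyC hornerC /= rmorphD !rmorphM !hornerE (eqP rx) /=.
by rewrite fg ?(eqP rx) // !mulr0 addr0.
Qed.

End Nullstellensatz.

(** * Evaluation and homogeneity *)

Section Evaluation.
Variables (F : fieldType) (T : finType).

(** Unlike evaluation at points, [ev] takes its values in an arbitrary algebra;
    the parametrised families below are given by [v] with polynomial values. *)
Definition ev (S : comNzRingType) (iota : {rmorphism F -> S}) (v : T -> S)
  : mpolyT F T -> S := mmap iota (fun k => v (enum_val k)).

HB.instance Definition _ S iota v := GRing.RMorphism.copy (@ev S iota v)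
  (mmap iota (fun k => v (enum_val k))).

Definition pcst (c : F) : mpolyT F T := c%:MP.

HB.instance Definition _ := GRing.RMorphism.copy pcst (@mpolyC #|T| F).

Lemma ev_cst (S : comNzRingType) (iota : {rmorphism F -> S}) v c :
  ev iota v (pcst c) = iota c.
Proof. exact: mmapC. Qed.

Lemma ev_var (S : comNzRingType) (iota : {rmorphism F -> S}) v t :
  ev iota v (var F t) = v t.
Proof. by rewrite /ev /var mmapX mmap1U enum_rankK. Qed.

Lemma hom_ext (S : comNzRingType) (f g : {rmorphism mpolyT F T -> S}) :
  (forall c, f (pcst c) = g (pcst c)) -> (forall t, f (var F t) = g (var F t)) ->
  f =1 g.
Proof.
move=> fgC fgX; apply: mpoly_hom_ext => // i.
by rewrite -(enum_valK i); exact: fgX.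
Qed.

Lemma ev_unique (S : comNzRingType) (f : {rmorphism mpolyT F T -> S})
    (iota : {rmorphism F -> S}) v :
  (forall c, f (pcst c) = iota c) -> (forall t, f (var F t) = v t) ->
  f =1 ev iota v.
Proof. by move=> fC fX; apply: (@hom_ext _ f (ev iota v)) => x /=; rewrite ?ev_cst ?ev_var. Qed.

Lemma eq_ev (S : comNzRingType) (i1 i2 : {rmorphism F -> S}) v1 v2 :
  i1 =1 i2 -> v1 =1 v2 -> ev i1 v1 =1 ev i2 v2.
Proof. by move=> e1 e2; apply: (@ev_unique _ (ev i1 v1)) => x /=; rewrite ?ev_cst ?ev_var. Qed.

(** Used throughout to compare two evaluations: it suffices to compare the
    images of the variables. *)
Lemma ev_hom (S S' : comNzRingType) (g : {rmorphism S -> S'})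
    (iota : {rmorphism F -> S}) v P :
  g (ev iota v P) = ev (g \o iota) (g \o v) P.
Proof.
by apply: (@ev_unique _ (g \o ev iota v)) => x /=; rewrite ?ev_cst ?ev_var.
Qed.

Lemma ev_var_id P : ev pcst (@var F T) P = P.
Proof. by apply/esym; apply: (@ev_unique _ idfun) => x. Qed.

Lemma pevalE P (p : T -> F) : peval P p = ev idfun p P.
Proof. by []. Qed.

Lemma pevalM P Q (p : T -> F) : peval (P * Q) p = peval P p * peval Q p.
Proof. by rewrite /peval mevalM. Qed.
Lemma pevalD P Q (p : T -> F) : peval (P + Q) p = peval P p + peval Q p.
Proof. by rewrite /peval mevalD. Qed.
Lemma pevalB P Q (p : T -> F) : peval (P - Q) p = peval P p - peval Q p.
Proof. by rewrite /peval mevalB. Qed.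
Lemma peval_var t (p : T -> F) : peval (var F t) p = p t.
Proof. by rewrite pevalE ev_var. Qed.
Lemma peval_cst c (p : T -> F) : peval (pcst c) p = c.
Proof. by rewrite pevalE ev_cst. Qed.
Lemma peval_sum (I : Type) (r : seq I) (P : pred I) (f : I -> mpolyT F T) (p : T -> F) :
  peval (\sum_(i <- r | P i) f i) p = \sum_(i <- r | P i) peval (f i) p.
Proof. by rewrite pevalE rmorph_sum. Qed.
Lemma peval_prod (I : Type) (r : seq I) (P : pred I) (f : I -> mpolyT F T) (p : T -> F) :
  peval (\prod_(i <- r | P i) f i) p = \prod_(i <- r | P i) peval (f i) p.
Proof. by rewrite pevalE rmorph_prod. Qed.
Lemma pevalX P n (p : T -> F) : peval (P ^+ n) p = peval P p ^+ n.
Proof. by rewrite pevalE rmorphXn. Qed.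

(** ** Weighted homogeneity *)

Definition wdeg (w : T -> nat) (m : 'X_{1..#|T|}) : nat :=
  (\sum_k m k * w (enum_val k))%N.

Definition whom (w : T -> nat) (d : nat) (P : mpolyT F T) : Prop :=
  forall m, m \in msupp P -> wdeg w m = d.

(** The grading as a one-parameter family of substitutions; it turns
    homogeneity into an equation that is stable under ring operations. *)
Definition grading (w : T -> nat) : mpolyT F T -> {poly mpolyT F T} :=
  ev (polyC \o pcst) (fun t => (var F t)%:P * 'X^(w t)).

HB.instance Definition _ w := GRing.RMorphism.on (grading w).

Lemma grading_coef w P k m : ((grading w P)`_k)@_m = P@_m *+ (wdeg w m == k).
Proof.
have monE (n : 'X_{1..#|T|}) : grading w 'X_[n] = ('X_[n])%:P * 'X^(wdeg w n).
  rewrite mpolyXE_id rmorph_prod /= /wdeg expr_sum rmorph_prod -big_split /=.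
  apply: eq_bigr => i _; rewrite rmorphXn /= rmorphXn.
  have -> : 'X_i = var F (enum_val i) by rewrite /var enum_valK.
  by rewrite /grading ev_var exprMn mulnC exprM.
rewrite {1}[P]mpolyE rmorph_sum /= coef_sum raddf_sum /=.
have -> : P@_m *+ (wdeg w m == k) =
    (\sum_(n <- msupp P) P@_n *: 'X_[n])@_m *+ (wdeg w m == k) by rewrite -mpolyE.
rewrite raddf_sum /= -sumrMnl; apply: eq_bigr => n _.
rewrite -mul_mpolyC rmorphM /= -/(pcst _) /grading ev_cst /= -/(grading w _) monE.
rewrite mulrA -polyCM coefCM coefXn mul_mpolyC eq_sym.
have [->|nm] := eqVneq n m.
  by case: eqP => _; rewrite ?mulr1 ?mulr1n ?mulr0 ?mcoeff0.
rewrite mcoeffZ mcoeffX (negbTE nm) mulr0 mul0rn.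
by case: eqP => _; rewrite ?mulr1 ?mulr0 ?mcoeff0 // mcoeffZ mcoeffX (negbTE nm) mulr0.
Qed.

Lemma whomP w d P : whom w d P <-> grading w P = P%:P * 'X^d.
Proof.
split=> [H|E m].
  apply/polyP => k; rewrite coefCM coefXn; apply/mpolyP => m.
  rewrite grading_coef; have [mP|mP] := boolP (m \in msupp P).
    by rewrite (H _ mP) eq_sym; case: eqP => _; rewrite ?mulr1 ?mulr0 ?mcoeff0.
  rewrite (memN_msupp_eq0 mP) mul0rn; case: eqP => _; rewrite ?mulr1 ?mulr0 ?mcoeff0 //.
  by rewrite (memN_msupp_eq0 mP).
rewrite mcoeff_msupp => mP; apply/eqP; apply: contraT => dm; case/negP: mP.
have := grading_coef w P (wdeg w m) m.
by rewrite E coefCM coefXn (negbTE dm) mulr0 mcoeff0 eqxx mulr1n => <-.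
Qed.

Lemma whomD w d P Q : whom w d P -> whom w d Q -> whom w d (P + Q).
Proof. by move=> /whomP p /whomP q; apply/whomP; rewrite rmorphD /= p q polyCD mulrDl. Qed.

Lemma whomM w d e P Q : whom w d P -> whom w e Q -> whom w (d + e) (P * Q).
Proof.
move=> /whomP p /whomP q; apply/whomP; rewrite rmorphM /= p q polyCM exprD.
by rewrite mulrACA.
Qed.

Lemma whom_cst w c : whom w 0 (pcst c).
Proof. by apply/whomP; rewrite /grading ev_cst /= expr0 mulr1. Qed.

Lemma whom_var w t : whom w (w t) (var F t).
Proof. by apply/whomP; rewrite /grading ev_var. Qed.

Lemma whom0 w d : whom w d 0.
Proof. by move=> m; rewrite msupp0. Qed.

End Evaluation.

(** The factors of a monomial are monomials, as ['X] is prime. *)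
Lemma monomial_factor (A : idomainType) (g h : {poly A}) c d :
  c != 0 -> g * h = c%:P * 'X^d -> exists c' d', g = c'%:P * 'X^d'.
Proof.
move=> c0; elim: d g h => [|d IH] g h; rewrite ?expr0 ?mulr1 => E.
  have gh0 : g * h != 0 by rewrite E polyC_eq0.
  have [g0 h0] : g != 0 /\ h != 0 by apply/andP; rewrite -negb_or -mulf_eq0.
  exists g`_0, 0%N; rewrite expr0 mulr1; apply: size1_polyC.
  have := congr1 (fun p : {poly A} => size p) E; rewrite size_mul // size_polyC c0.
  by rewrite -!size_poly_gt0 in g0 h0; lia.
have X0 : 'X != 0 :> {poly A} by rewrite polyX_eq0.
have rootX (p : {poly A}) : p`_0 = 0 -> exists q, p = q * 'X.
  move=> p0; exists (\poly_(i < (size p).-1) p`_i.+1); apply/polyP => i.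
  rewrite coefMX; case: i => [|i] //=; rewrite coef_poly.
  by case: ltnP => // le; rewrite nth_default //; lia.
have := congr1 (fun p : {poly A} => p`_0) E.
rewrite coef0M coefCM coefXn mulr0 => /eqP; rewrite mulf_eq0 => /orP[]/eqP/rootX[q qE].
  have [|c' [d' gE]] := IH q h; last by exists c', d'.+1; rewrite qE gE exprSr mulrA.
  by apply: (mulIf X0); rewrite -[RHS]mulrA -exprSr -E qE; ring.
apply: (IH g q); apply: (mulIf X0); rewrite -[RHS]mulrA -exprSr -E qE; ring.
Qed.

(** The grading of a factor is a factor of a monomial. *)
Lemma whom_factor (F : fieldType) (T : finType) (w : T -> nat) d
    (P Q : mpolyT F T) :
  P * Q != 0 -> whom w d (P * Q) -> exists d', whom w d' P.
Proof.
move=> PQ0 /whomP; rewrite rmorphM => /(monomial_factor PQ0)[c [d' E]].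
exists d'; apply/whomP; rewrite E; congr (_%:P * _).
have h1 : P = horner_eval 1 (grading w P).
  rewrite /grading ev_hom -[LHS]ev_var_id; apply: eq_ev => x /=.
    by rewrite /horner_eval hornerC.
  by rewrite /horner_eval !hornerE expr1n mulr1.
by rewrite h1 E /horner_eval !hornerE expr1n mulr1.
Qed.

(** ** Multihomogeneity *)

Section Multihomogeneous.
Variables (F : fieldType) (T K : finType) (b : T -> K).
Implicit Types (P Q : mpolyT F T) (e : K -> nat).

Lemma mhomogE e P :
  mhomog b e P <-> forall j, whom (fun t => (b t == j) : nat) (e j) P.
Proof.
have E m j : wdeg (fun t => (b t == j) : nat) m =
    (\sum_(k < #|T| | b (enum_val k) == j) m k)%N.
  rewrite /wdeg [RHS]big_mkcond; apply: eq_bigr => k _.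
  by case: eqP; rewrite ?muln1 ?muln0.
by split=> H => [j m|m mP j]; rewrite ?E -?E; [move=> mP; rewrite E|]; exact: H.
Qed.

Lemma mhomogD e P Q : mhomog b e P -> mhomog b e Q -> mhomog b e (P + Q).
Proof. by move=> /mhomogE p /mhomogE q; apply/mhomogE => j; apply: whomD. Qed.

Lemma mhomogM e e' P Q : mhomog b e P -> mhomog b e' Q ->
  mhomog b (fun j => (e j + e' j)%N) (P * Q).
Proof. by move=> /mhomogE p /mhomogE q; apply/mhomogE => j; apply: whomM. Qed.

Lemma mhomog_cst (c : F) : mhomog b (fun=> 0%N) (pcst T c).
Proof. by apply/mhomogE => j; exact: whom_cst. Qed.

Lemma mhomog_var t : mhomog b (fun j => (b t == j) : nat) (var F t).
Proof. by apply/mhomogE => j; exact: (@whom_var F T (fun u => (b u == j) : nat) t). Qed.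

Lemma mhomog0 e : mhomog b e (0 : mpolyT F T).
Proof. by apply/mhomogE => j; exact: whom0. Qed.

Lemma eq_mhomog e e' P : e =1 e' -> mhomog b e P -> mhomog b e' P.
Proof. by move=> E H m mP j; rewrite -E; exact: H. Qed.

Lemma mhomogZ (c : F) e P : mhomog b e P -> mhomog b e (pcst T c * P).
Proof. by move=> H; apply: eq_mhomog _ (mhomogM (@mhomog_cst c) H). Qed.

Lemma mhomogB e P Q : mhomog b e P -> mhomog b e Q -> mhomog b e (P - Q).
Proof.
move=> HP HQ; apply: mhomogD => //.
have -> : - Q = pcst T (-1) * Q by rewrite rmorphN rmorph1 mulN1r.
exact: mhomogZ.
Qed.

Lemma mhomog_sum (I : Type) (r : seq I) (p : pred I) (f : I -> mpolyT F T) e :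
  (forall i, p i -> mhomog b e (f i)) -> mhomog b e (\sum_(i <- r | p i) f i).
Proof.
move=> H; elim/big_rec: _ => [|i x pi]; first exact: mhomog0.
by apply: mhomogD; exact: H.
Qed.

Lemma mhomog_prod (I : Type) (r : seq I) (p : pred I) (f : I -> mpolyT F T)
    (e : I -> K -> nat) : (forall i, p i -> mhomog b (e i) (f i)) ->
  mhomog b (fun j => \sum_(i <- r | p i) e i j)%N (\prod_(i <- r | p i) f i).
Proof.
move=> H; elim: r => [|i r IH].
  by apply: (@eq_mhomog (fun=> 0%N)) => [j|]; rewrite big_nil // -(rmorph1 (@pcst F T));
     exact: mhomog_cst.
rewrite big_cons; case pi: (p i).
  by apply: eq_mhomog _ (mhomogM (H i pi) IH) => j; rewrite big_cons pi.
by apply: eq_mhomog _ IH => j; rewrite big_cons pi.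
Qed.

Lemma mhomogX e P n : mhomog b e P -> mhomog b (fun j => (n * e j)%N) (P ^+ n).
Proof.
move=> H; elim: n => [|n IH].
  by rewrite expr0 -(rmorph1 (@pcst F T)); exact: mhomog_cst.
by rewrite exprS; apply: eq_mhomog _ (mhomogM H IH) => j; rewrite mulSn.
Qed.

Lemma ev_scale (S : comNzRingType) (iota : {rmorphism F -> S}) (v : T -> S)
    (l : K -> S) e P : mhomog b e P ->
  ev iota (fun t => l (b t) * v t) P = (\prod_j l j ^+ e j) * ev iota v P.
Proof.
move=> H; rewrite /ev /mmap mulr_sumr; apply: eq_big_seq => m mP.
rewrite mulrCA; congr (_ * _); rewrite /mmap1.
transitivity (\prod_k (l (b (enum_val k)) ^+ m k * v (enum_val k) ^+ m k)).
  by apply: eq_bigr => k _; exact: exprMn.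
rewrite big_split /=; congr (_ * _).
rewrite (partition_big (fun k => b (enum_val k)) predT) //=.
apply: eq_bigr => j _; rewrite -(H m mP j) expr_sum; apply: eq_bigr => k /eqP.
by move=> <-.
Qed.

Lemma peval_scale (p : T -> F) (l : K -> F) e P : mhomog b e P ->
  peval P (fun t => l (b t) * p t) = (\prod_j l j ^+ e j) * peval P p.
Proof. exact: ev_scale. Qed.

End Multihomogeneous.

(** * The Zariski topology of a product of projective spaces *)

Section Zariski.
Variables (F : fieldType) (T K : finType) (b : T -> K).
Implicit Types (P Q : mpolyT F T) (e : K -> nat) (A Z V : set (T -> F)).

Definition vanishes_on P A := forall p, A p -> peval P p = 0.

Lemma zclosed_mproj Z : zclosed b Z -> Z `<=` mproj b.
Proof. by move=> [S [_ ->]] p []. Qed.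

Lemma zclosure_mproj A : A `<=` mproj b -> zclosure b A `<=` mproj b.
Proof.
move=> Ab p; apply => //; exists set0; split=> //.
by apply/seteqP; split=> q // [].
Qed.

Lemma sub_zclosure A : A `<=` zclosure b A.
Proof. by move=> p Ap Z _; apply. Qed.

Lemma zclosureP A : A `<=` mproj b -> zclosure b A =
  [set p | mproj b p /\ forall e P, mhomog b e P -> vanishes_on P A -> peval P p = 0].
Proof.
move=> Ab; apply/seteqP; split=> [p Ap|p [bp H] Z [S [hS ZE]] AZ].
  apply: Ap; last by move=> q Aq; split; [exact: Ab|move=> e P _; exact].
  exists [set P | (exists e, mhomog b e P) /\ vanishes_on P A]; split.
    by move=> P [].
  apply/seteqP; split=> q [bq H]; split=> //; first by move=> P [[e he]]; exact: (H e).
  by move=> e P he PA; apply: H; split=> //; exists e.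
rewrite ZE; split=> // P SP; have [e he] := hS P SP; apply: (H e) => // q Aq.
by have := AZ q Aq; rewrite ZE => -[_]; exact.
Qed.

Lemma zclosed_zclosure A : A `<=` mproj b -> zclosed b (zclosure b A).
Proof.
move=> Ab; exists [set P | (exists e, mhomog b e P) /\ vanishes_on P A]; split.
  by move=> P [].
rewrite zclosureP //; apply/seteqP; split=> q [bq H]; split=> //.
  by move=> P [[e he]]; exact: (H e).
by move=> e P he PA; apply: H; split=> //; exists e.
Qed.

Lemma vanishes_zclosure e P A : A `<=` mproj b -> mhomog b e P ->
  vanishes_on P A -> vanishes_on P (zclosure b A).
Proof. by move=> Ab he PA p; rewrite zclosureP // => -[_ H]; exact: (H e). Qed.

Lemma zclosure_sub A Z : zclosed b Z -> A `<=` Z -> zclosure b A `<=` Z.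
Proof. by move=> hZ AZ p; exact. Qed.

(** Closed sets are defined by equations that are homogeneous in each block. *)
Lemma zclosed_separate Z p : zclosed b Z -> mproj b p -> ~ Z p ->
  exists e P, [/\ mhomog b e P, vanishes_on P Z & peval P p != 0].
Proof.
move=> [S [hS ->]] bp nZ; apply: contrapT => H; apply: nZ; split=> // P SP.
apply: contrapT => /eqP Pp; apply: H; have [e he] := hS P SP.
by exists e, P; split=> // q [_]; exact.
Qed.

Lemma zclosed_inter Z (I : Type) (P : I -> mpolyT F T) :
  zclosed b Z -> (forall i, exists e, mhomog b e (P i)) ->
  zclosed b [set p | Z p /\ forall i, peval (P i) p = 0].
Proof.
move=> [S [hS ->]] hP; exists (S `|` range P); split.
  by move=> Q [/hS //|[i _ <-]].
apply/seteqP; split=> p /=.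
  by move=> [[bp HS] HP]; split=> // Q [/HS //|[i _ <-]].
move=> [bp H]; split; first by split=> // Q SQ; apply: H; left.
by move=> i; apply: H; right; exists i.
Qed.

Lemma zclosed_scale Z p (l : K -> F) : zclosed b Z -> (forall j, l j != 0) ->
  Z p -> Z (fun t => l (b t) * p t).
Proof.
move=> [S [hS ->]] l0 [bp H]; split=> [j|P SP].
  by have [t bt pt] := bp j; exists t => //; rewrite mulf_neq0.
by have [e he] := hS P SP; rewrite (peval_scale _ _ he) H // mulr0.
Qed.

(** Cut [V] with the zero loci of [P] and of [Q]. *)
Lemma subvariety_prime V P Q e e' : subvariety b V ->
  mhomog b e P -> mhomog b e' Q -> vanishes_on (P * Q) V ->
  vanishes_on P V \/ vanishes_on Q V.
Proof.
move=> [cV _ irr] hP hQ PQ.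
have cl e1 R : mhomog b e1 R -> zclosed b [set p | V p /\ forall i : unit, peval R p = 0].
  by move=> hR; apply: zclosed_inter => // _; exists e1.
have [|H|H] := irr _ _ (cl _ _ hP) (cl _ _ hQ).
- move=> p Vp; have := PQ p Vp; rewrite pevalM => /eqP.
  by rewrite mulf_eq0 => /orP[]/eqP H; [left|right].
- by left=> p /H[_ /(_ tt)].
- by right=> p /H[_ /(_ tt)].
Qed.

Lemma subvariety_prime_prod V (I : eqType) (r : seq I) (f : I -> mpolyT F T) :
  subvariety b V -> (forall i, i \in r -> exists e, mhomog b e (f i)) ->
  vanishes_on (\prod_(i <- r) f i) V ->
  exists2 i, i \in r & vanishes_on (f i) V.
Proof.
move=> sV; elim: r => [|i r IH] hf.
  rewrite big_nil; have [_ [p Vp] _] := sV => /(_ p Vp).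
  by rewrite /peval meval1 => /eqP; rewrite oner_eq0.
have [e he] := hf i (mem_head _ _).
have hf' j : j \in r -> exists e, mhomog b e (f j).
  by move=> jr; apply: hf; rewrite inE jr orbT.
have [e' he'] : exists e', mhomog b e' (\prod_(i <- r) f i).
  elim: (r) hf' => [|j s IHs] hs.
    by exists (fun=> 0%N); rewrite big_nil -(rmorph1 (@pcst F T)); exact: mhomog_cst.
  have [e1 he1] := hs j (mem_head _ _).
  have [|e2 he2] := IHs; first by move=> k ks; apply: hs; rewrite inE ks orbT.
  by rewrite big_cons; eexists; exact: mhomogM he1 he2.
rewrite big_cons => /(subvariety_prime sV he he')[H|/(IH hf')[j jr H]].
  by exists i; rewrite ?mem_head.
by exists j; rewrite // inE jr orbT.
Qed.

(** The criterion by which all the subvarieties below are shown to be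
    irreducible: they are closures of images of families for which vanishing of
    [P] means vanishing, or divisibility, in an integral domain. *)
Lemma subvariety_zclosure A : A `<=` mproj b -> A !=set0 ->
  (forall e e' P Q, mhomog b e P -> mhomog b e' Q -> vanishes_on (P * Q) A ->
     vanishes_on P A \/ vanishes_on Q A) ->
  subvariety b (zclosure b A).
Proof.
move=> Ab [p0 Ap0] prime; split; first exact: zclosed_zclosure.
  by exists p0; exact: sub_zclosure.
move=> Y Z cY cZ AYZ; apply: contrapT => /not_orP[nY nZ].
have sep W : zclosed b W -> ~ zclosure b A `<=` W ->
    exists e P, [/\ mhomog b e P, vanishes_on P W & ~ vanishes_on P A].
  move=> cW nW; have [p /not_implyP[Ap nWp]] : exists p, ~ (zclosure b A p -> W p).
    by apply: contrapT => /forallNP H; apply: nW => p; exact: contrapT (H p).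
  have [e [P [he PW Pp]]] := zclosed_separate cW (zclosure_mproj Ab Ap) nWp.
  exists e, P; split=> // PA; case/eqP: Pp.
  exact: (vanishes_zclosure Ab he PA).
have [e [P [he PY PA]]] := sep _ cY nY; have [e' [Q [he' QZ QA]]] := sep _ cZ nZ.
have [] // := prime _ _ _ _ he he'.
move=> p Ap; rewrite pevalM; have [/PY->|/QZ->] := AYZ p (sub_zclosure Ap).
  by rewrite mul0r.
by rewrite mulr0.
Qed.

End Zariski.

(** ** Order of vanishing *)

Section Order.
Variables (F : fieldType) (T K : finType) (b : T -> K) (X V : set (T -> F)).

Lemma ideal_powS (A : comNzRingType) (J : set A) n P :
  ideal_pow J n.+1 P -> ideal_pow J n P.
Proof.
elim: n P => [|n IH] P //= [s sP ->]; exists s => // gh ghs.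
by have [] := sP gh ghs; split=> //; exact: IH.
Qed.

Lemma vanishes_to_orderS n P :
  vanishes_to_order b X V n.+1 P -> vanishes_to_order b X V n P.
Proof. by move=> [G [Q [hG nG /ideal_powS hQ E]]]; exists G, Q. Qed.

Lemma vanishes_to_order_le m n P : (m <= n)%N ->
  vanishes_to_order b X V n P -> vanishes_to_order b X V m P.
Proof. by move=> /subnK <-; elim: (n - m)%N => // k IH /vanishes_to_orderS. Qed.

Lemma ord_along_eq n P : vanishes_to_order b X V n P ->
  ~ vanishes_to_order b X V n.+1 P -> ord_along b X V P = n.
Proof.
move=> Vn nVn; rewrite /ord_along; case: xgetP => [m -> [Vm nVm]|/(_ n)[]//].
apply/eqP; rewrite eqn_leq; apply/andP; split; rewrite leqNgt; apply/negP => lt.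
  by apply: nVn; exact: vanishes_to_order_le Vm.
by apply: nVm; exact: vanishes_to_order_le Vn.
Qed.

Lemma ideal_pow_exp (A : comNzRingType) (J : set A) n (a c : A) :
  J a -> ideal_pow J n (c * a ^+ n).
Proof.
move=> Ja; elim: n c => // n IH c.
exists [:: (a, c * a ^+ n)]; last by rewrite big_seq1 /= exprS mulrCA.
by move=> gh; rewrite inE => /eqP->; split=> //; exact: IH.
Qed.

(** This bounds orders of vanishing from above: a homomorphism that sends the
    ideal of [V] to multiples of [pi] sends its powers to multiples of powers
    of [pi]. *)
Lemma hom_ideal_pow (A : comNzRingType) (D : idomainType) (J : set A)
    (f : {rmorphism A -> D}) (pi : D) n P :
  (forall a, J a -> divides pi (f a)) -> ideal_pow J n P ->
  divides (pi ^+ n) (f P).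
Proof.
move=> Jpi; elim: n P => [|n IH] P; first by move=> _; apply: unit_divides; rewrite unitr1.
move=> [s sP ->]; rewrite rmorph_sum big_seq; apply: divides_sum => gh ghs.
have [/Jpi[u uE] /IH[v vE]] := sP gh ghs.
by exists (u * v); rewrite rmorphM uE vE exprS; ring.
Qed.

End Order.

(** * Valuations attached to prime elements *)

Section PrimeOrder.
Variables (D : idomainType) (pi : D).
Hypothesis pi_prime : prime_elt pi.

Definition has_ord n a := divides (pi ^+ n) a /\ ~ divides (pi ^+ n.+1) a.

Lemma pi_neq0 : pi != 0. Proof. by case: pi_prime. Qed.

Lemma dividesX_le m n a : (m <= n)%N -> divides (pi ^+ n) a -> divides (pi ^+ m) a.
Proof.
move=> /subnK <- [c ->]; exists (c * pi ^+ (n - m)).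
by rewrite exprD mulrA.
Qed.

Lemma has_ord_unique m n a : has_ord m a -> has_ord n a -> m = n.
Proof.
move=> [ma nma] [na nna]; apply/eqP; rewrite eqn_leq; apply/andP.
by split; rewrite leqNgt; apply/negP => lt; [apply: nna|apply: nma];
  apply: dividesX_le lt _.
Qed.

Lemma has_ordP n a : has_ord n a <-> exists2 c, a = c * pi ^+ n & ~ divides pi c.
Proof.
split=> [[[c cE] H]|[c -> H]].
  exists c => // -[d dE]; apply: H; exists d.
  by rewrite cE dE exprS mulrA.
split; first by exists c.
move=> [d /eqP]; rewrite exprS mulrA (inj_eq (mulIf (expf_neq0 _ pi_neq0))).
by move=> /eqP E; apply: H; exists d.
Qed.

Lemma has_ordM m n a b : has_ord m a -> has_ord n b -> has_ord (m + n) (a * b).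
Proof.
move=> /has_ordP[c -> nc] /has_ordP[d -> nd]; apply/has_ordP.
exists (c * d); first by rewrite exprD; ring.
by have [_ _ H] := pi_prime => /H[].
Qed.

Lemma has_ord0 a : ~ divides pi a -> has_ord 0 a.
Proof. by move=> na; apply/has_ordP; exists a; rewrite // mulr1. Qed.

(** The denominators allowed in the definition of the order are prime to [pi]. *)
Lemma dividesX_cancel n a b : ~ divides pi a -> divides (pi ^+ n) (a * b) ->
  divides (pi ^+ n) b.
Proof.
move=> na; elim: n b => [|n IH] b H; first by apply: unit_divides; rewrite unitr1.
have : divides pi (a * b).
  by apply: divides_trans H; rewrite exprS; apply: divides_mulr; exact: divides_refl.
case/(let: And3 _ _ h := pi_prime in h) => // -[c cE].
have [d dE] : divides (pi ^+ n) c.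
  apply: IH; case: H => d /eqP; rewrite cE mulrA exprSr mulrA.
  by rewrite (inj_eq (mulIf pi_neq0)) => /eqP ->; exists d.
by exists d; rewrite cE dE exprSr mulrA.
Qed.

(** The measure [gauge] is the degree; it bounds the exponent. *)
Lemma has_ord_exists (gauge : D -> nat) (a : D) :
  (forall c : D, c != 0 -> (gauge c < gauge (c * pi)%R)%N) -> a != 0 -> exists n, has_ord n a.
Proof.
move=> hgauge a0; apply: contrapT => /forallNP H.
have all n : divides (pi ^+ n) a.
  elim: n => [|n IH]; first by apply: unit_divides; rewrite unitr1.
  by apply: contrapT => nd; apply: (H n).
have [c cE] := all (gauge a).+1.
have c0 : c != 0 by apply: contraNneq a0 => c0; rewrite cE c0 mul0r.
have lt n : (n <= gauge (c * pi ^+ n)%R)%N.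
  elim: n => // n IH; rewrite exprSr mulrA; apply: leq_ltn_trans IH _.
  by apply: hgauge; rewrite mulf_neq0 // expf_neq0 // pi_neq0.
by have := lt (gauge a).+1; rewrite -cE ltnn.
Qed.

End PrimeOrder.

(** The order along [V] is computed by any homomorphism [theta] that is
    compatible with vanishing on [X] and [V].  Only the lower bound, that
    divisibility by [pi ^+ n] implies vanishing to order [n], has to be
    supplied in each case. *)
Lemma ord_valuation (F : fieldType) (T K : finType) (b : T -> K)
    (X V : set (T -> F)) (D : idomainType) (pi : D)
    (theta : {rmorphism mpolyT F T -> D}) (e : K -> nat) P n :
  prime_elt pi ->
  (forall Q, vanishing_ideal X Q -> theta Q = 0) ->
  (forall Q, vanishing_ideal V Q -> divides pi (theta Q)) ->
  (forall e G, mhomog b e G -> divides pi (theta G) -> vanishing_ideal V G) ->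
  (divides (pi ^+ n) (theta P) -> vanishes_to_order b X V n P) ->
  has_ord pi n (theta P) -> ord_along b X V P = n.
Proof.
move=> pr hX hV hG hP [d nd]; apply: ord_along_eq; first exact: hP.
move=> [G [Q [[e' he'] nG hQ /hX]]]; rewrite rmorphB rmorphM => /eqP.
rewrite subr_eq0 => /eqP E; apply: nd.
apply: (@dividesX_cancel _ _ pr _ (theta G)).
  by move=> dG; apply: nG; apply: hG dG; exact: he'.
by rewrite E; exact: (hom_ideal_pow hV hQ).
Qed.

(** ** Degrees of products and substitutions *)

Section MoreDegrees.
Variables (F : fieldType) (T : finType).

Lemma whom_unique (w : T -> nat) d d' (P : mpolyT F T) :
  P != 0 -> whom w d P -> whom w d' P -> d = d'.
Proof.
rewrite -msupp_eq0; case E: (msupp P) => [|m s] // _ h h'.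
by rewrite -(h m) -?(h' m) // E mem_head.
Qed.

Lemma whom_quot (w : T -> nat) d d1 (P Q : mpolyT F T) : P * Q != 0 ->
  whom w d (P * Q) -> whom w d1 P -> whom w (d - d1) Q /\ (d1 <= d)%N.
Proof.
move=> PQ0 h hP; rewrite mulrC in PQ0 h.
have [d' hQ] := whom_factor PQ0 h.
have E := whom_unique PQ0 h (whomM hQ hP).
by rewrite E addnK leq_addl.
Qed.

Lemma ev_scale_weight (S : comNzRingType) (iota : {rmorphism F -> S})
    (v : T -> S) (w : T -> nat) (l : S) d (P : mpolyT F T) : whom w d P ->
  ev iota (fun t => l ^+ w t * v t) P = l ^+ d * ev iota v P.
Proof.
move=> /whomP /(congr1 (horner_eval l \o map_poly (ev iota v))) /=.
rewrite rmorphM /= map_polyC map_polyXn /horner_eval !hornerE mulrC => <-.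
apply/esym; rewrite /grading.
apply: (@ev_unique _ _ _ (horner_eval l \o map_poly (ev iota v) \o
  ev (polyC \o @pcst F T) (fun t => (var F t)%:P * 'X^(w t)))) => x /=.
  by rewrite ev_cst /= map_polyC /horner_eval hornerC /= ev_cst.
rewrite ev_var rmorphM /= map_polyC map_polyXn /horner_eval !hornerE /= ev_var.
by rewrite mulrC.
Qed.

Lemma whom_ev (T' : finType) (v : T -> mpolyT F T') (w : T -> nat)
    (w' : T' -> nat) d (P : mpolyT F T) :
  (forall t, whom w' (w t) (v t)) -> whom w d P -> whom w' d (ev (@pcst F T') v P).
Proof.
move=> hv hP; apply/whomP.
have -> : grading w' (ev (@pcst F T') v P) =
    ev (polyC \o @pcst F T') (fun t => 'X ^+ w t * (v t)%:P) P.
  rewrite {1}/grading ev_hom; apply: eq_ev => x /=.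
    by rewrite -/(grading w' _) /grading ev_cst.
  by have /whomP := hv x; rewrite /grading => ->; rewrite mulrC.
by rewrite (ev_scale_weight _ _ _ hP) mulrC ev_hom.
Qed.

Lemma mhomog_total (K : finType) (b : T -> K) e (P : mpolyT F T) :
  mhomog b e P -> whom (fun=> 1%N) (\sum_j e j) P.
Proof.
move=> h m mP; rewrite /wdeg (partition_big (fun k => b (enum_val k)) predT) //=.
by apply: eq_bigr => j _; rewrite -(h m mP j); apply: eq_bigr => k _; rewrite muln1.
Qed.

Lemma whom_weight0 (P : mpolyT F T) : whom (fun=> 0%N) 0 P.
Proof. by move=> m _; rewrite /wdeg big1 // => k _; rewrite muln0. Qed.

Lemma mpolyT_nonroot (F' : numClosedFieldType) (P : mpolyT F' T) :
  P != 0 -> exists p : T -> F', peval P p != 0.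
Proof.
move=> /mpoly_nonroot[v vP]; exists (v \o enum_rank); rewrite /peval.
by congr (_ != 0): vP; apply: meval_eq => k /=; rewrite enum_valK.
Qed.

Lemma nullstellensatzT (F' : numClosedFieldType) (f g : mpolyT F' T) :
  prime_elt f -> (forall p : T -> F', peval f p = 0 -> peval g p = 0) ->
  divides f g.
Proof.
move=> Pf fg; apply: hypersurface_nullstellensatz => // v.
have E (h : mpolyT F' T) : h.@[v] = peval h (v \o enum_rank).
  by rewrite /peval; apply: meval_eq => k /=; rewrite enum_valK.
by rewrite !E; exact: fg.
Qed.

Lemma prime_msize (f : mpolyT F T) : prime_elt f -> (1 < msize f)%N.
Proof.
move=> [f0 nf _]; rewrite ltnNge; apply: contra nf => /msize1_polyC fE.
move: f0; rewrite fE mpolyC_eq0 => f0; apply: (rmorph_unit (@mpolyC #|T| F)).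
by rewrite unitfE.
Qed.

Lemma prime_has_ord (f g : mpolyT F T) : prime_elt f -> g != 0 ->
  exists n, has_ord f n g.
Proof.
move=> Pf; apply: (@has_ord_exists _ _ Pf (fun p : mpolyT F T => msize p)) => c c0.
rewrite msizeM ?(pi_neq0 Pf) //; have := prime_msize Pf.
have : (0 < msize c)%N by rewrite lt0n msize_poly_eq0.
by set a := msize c; set b := msize f; lia.
Qed.

End MoreDegrees.

Lemma prime_X (A : idomainType) : prime_elt ('X : {poly A}).
Proof.
split; first by rewrite polyX_eq0.
  by rewrite poly_unitE size_polyX.
have XP (p : {poly A}) : p`_0 = 0 -> divides 'X p.
  move=> p0; exists (\poly_(i < (size p).-1) p`_i.+1); apply/polyP => i.
  rewrite coefMX; case: i => [|i] //=; rewrite coef_poly.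
  by case: ltnP => // le; rewrite nth_default //; lia.
move=> a b [c /(congr1 (fun p : {poly A} => p`_0))]; rewrite coefMX /= coef0M.
by move=> /eqP; rewrite mulf_eq0 => /orP[]/eqP/XP; tauto.
Qed.

Lemma divides_X (A : idomainType) (p : {poly A}) : divides 'X p <-> p`_0 = 0.
Proof.
split=> [[c ->]|p0]; first by rewrite coefMX.
exists (\poly_(i < (size p).-1) p`_i.+1); apply/polyP => i.
rewrite coefMX; case: i => [|i] //=; rewrite coef_poly.
by case: ltnP => // le; rewrite nth_default //; lia.
Qed.

Lemma X_has_ord (A : idomainType) (p : {poly A}) : p != 0 ->
  exists n, has_ord 'X n p.
Proof.
apply: (@has_ord_exists _ _ (@prime_X A) (fun p : {poly A} => size p)) => c c0.
by rewrite size_mulX.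
Qed.

(** * The blow-up and its prime divisors *)

Definition pt (S : Type) (x : 'rV[S]_4) (y : 'I_4 -> 'rV[S]_2) (t : bl_coord) : S :=
  match t with inl j => x ord0 j | inr (i, a) => y i ord0 a end.

Lemma base_ptE (F : fieldType) x (y : 'I_4 -> 'rV[F]_2) : base_pt (pt x y) = x.
Proof. by apply/rowP => j; rewrite mxE. Qed.

Lemma fiber_ptE (F : fieldType) x (y : 'I_4 -> 'rV[F]_2) i : fiber_pt (pt x y) i = y i.
Proof. by apply/rowP => j; rewrite mxE. Qed.

Lemma pt_eta (F : fieldType) (p : bl_coord -> F) : pt (base_pt p) (fiber_pt p) = p.
Proof. by apply/funext => -[j|[i a]]; rewrite /= mxE. Qed.

Lemma hom_pt (S S' : comNzRingType) (g : {rmorphism S -> S'}) x y t :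
  g (pt x y t) = pt (map_mx g x) (fun i => map_mx g (y i)) t.
Proof. by case: t => [j|[i a]]; rewrite /= mxE. Qed.

Lemma rv_neq0 (F : fieldType) n (x : 'rV[F]_n) : (exists j, x ord0 j != 0) <-> x != 0.
Proof.
split=> [[j]|x0]; first by apply: contraNneq => ->; rewrite mxE.
apply: contrapT => /forallNP H; case/negP: x0; apply/eqP/rowP => j.
by rewrite mxE; apply/eqP; apply: contrapT => /negP; exact: H.
Qed.

Lemma mproj_pt (F : fieldType) x (y : 'I_4 -> 'rV[F]_2) :
  mproj bl_block (pt x y) <-> x != 0 /\ forall i, y i != 0.
Proof.
split=> [H|[x0 y0] [i|]].
- split=> [|i].
    have [[j|[i a]] //= _ h] := H None; apply/rv_neq0; by exists j.
  have [[j|[k a]] //= [<-] h] := H (Some i); apply/rv_neq0; by exists a.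
- by have /rv_neq0[a ya] := y0 i; exists (inr (i, a)).
- by have /rv_neq0[j xj] := x0; exists (inl j).
Qed.

Section BlowUp.
Variables (F : numClosedFieldType) (A : 'I_4 -> 'M[F]_(4, 2)).

Local Notation Mx := (mpolyT F 'I_4).
Local Notation Mbl := (mpolyT F bl_coord).
Local Notation X := (blowup A).
Local Notation cx := (@pcst F 'I_4).
Local Notation cb := (@pcst F bl_coord).

Definition gpt (S : comNzRingType) (iota : {rmorphism F -> S}) (x : 'rV[S]_4) :=
  pt x (fun i => x *m map_mx iota (A i)).

Definition evx (S : comNzRingType) (iota : {rmorphism F -> S}) (x : 'rV[S]_4)
  : Mx -> S := ev iota (x ord0).
HB.instance Definition _ S iota x := GRing.RMorphism.on (@evx S iota x).

Definition xvars : 'rV[Mx]_4 := \row_j var F j.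

(** Restriction to the graph: the linear forms [x *m A i] replace the
    coordinates of the [i]-th projective line. *)
Definition Psi : Mbl -> Mx := ev cx (gpt cx xvars).
HB.instance Definition _ := GRing.RMorphism.on Psi.

Lemma hom_gpt (S S' : comNzRingType) (g : {rmorphism S -> S'})
    (iota : {rmorphism F -> S}) (x : 'rV[S]_4) t :
  g (gpt iota x t) = gpt (g \o iota) (map_mx g x) t.
Proof.
rewrite /gpt hom_pt; case: t => [j|[i a]] //=.
by rewrite map_mxM /= -map_mx_comp.
Qed.

Lemma evx_xvars (S : comNzRingType) (iota : {rmorphism F -> S}) (x : 'rV[S]_4) :
  map_mx (evx iota x) xvars = x.
Proof. by apply/rowP => j; rewrite !mxE /evx ev_var. Qed.

Lemma eq_gpt (S : comNzRingType) (i1 i2 : {rmorphism F -> S}) x :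
  i1 =1 i2 -> gpt i1 x = gpt i2 x.
Proof.
move=> e; apply/funext => -[j|[i a]] //=.
by congr ((_ *m _) _ _); apply/matrixP => u v; rewrite !mxE e.
Qed.

Lemma evx_Psi (S : comNzRingType) (iota : {rmorphism F -> S}) x P :
  evx iota x (Psi P) = ev iota (gpt iota x) P.
Proof.
have E : evx iota x \o cx =1 iota by move=> c /=; rewrite /evx ev_cst.
rewrite /Psi ev_hom; apply: eq_ev => // t /=.
by rewrite hom_gpt evx_xvars (eq_gpt x E).
Qed.

Definition evf (x : 'rV[F]_4) (f : Mx) : F := peval f (x ord0).

Lemma evfE x f : evf x f = evx idfun x f. Proof. by []. Qed.

Lemma evf_Psi x P : evf x (Psi P) = peval P (gpt idfun x).
Proof. by rewrite evfE evx_Psi. Qed.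

Lemma evfM x f g : evf x (f * g) = evf x f * evf x g.
Proof. exact: pevalM. Qed.

Lemma gpt_idE x : gpt idfun x = pt x (fun i => x *m A i).
Proof.
by apply/funext => -[j|[i a]] //=; congr ((_ *m _) _ _); apply/matrixP => u v; rewrite mxE.
Qed.

Lemma evf_nonroot (f : Mx) : f != 0 -> exists x, evf x f != 0.
Proof.
move=> /mpolyT_nonroot[p fp]; exists (\row_j p j); rewrite /evf.
by congr (peval _ _ != 0): fp; apply/funext => j; rewrite mxE.
Qed.

Lemma nullstellensatzx (f g : Mx) : prime_elt f ->
  (forall x, evf x f = 0 -> evf x g = 0) -> divides f g.
Proof.
move=> Pf H; apply: nullstellensatzT => // p.
have E : p = (\row_j p j) ord0 by apply/funext => j; rewrite mxE.
by rewrite E; exact: H.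
Qed.

Definition lform (i : 'I_4) (a : 'I_2) : Mx := (xvars *m map_mx cx (A i)) ord0 a.

Lemma evx_lform (S : comNzRingType) (iota : {rmorphism F -> S}) x i a :
  evx iota x (lform i a) = (x *m map_mx iota (A i)) ord0 a.
Proof.
transitivity (map_mx (evx iota x) (xvars *m map_mx cx (A i)) ord0 a); first by rewrite mxE.
rewrite map_mxM evx_xvars -map_mx_comp; congr ((_ *m _) _ _).
by apply/matrixP => u v; rewrite !mxE /= /evx ev_cst.
Qed.

Lemma evf_lform x i a : evf x (lform i a) = (x *m A i) ord0 a.
Proof.
rewrite evfE evx_lform; congr ((_ *m _) _ _); by apply/matrixP => u v; rewrite mxE.
Qed.

Definition isform d (f : Mx) := whom (fun=> 1%N) d f.

Lemma lform_isform i a : isform 1 (lform i a).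
Proof.
rewrite /lform mxE; elim/big_ind: _ => [|f g|j _]; first exact: whom0.
  exact: whomD.
rewrite !mxE; apply: (@whomM _ _ _ 1 0); last exact: whom_cst.
exact: (@whom_var F 'I_4 (fun=> 1%N)).
Qed.

(** ** Polynomials on the blow-up *)

Definition xb : 'rV[Mbl]_4 := \row_j var F (inl j : bl_coord).
Definition lb i a : Mbl := (xb *m map_mx cb (A i)) ord0 a.
Definition yv (i : 'I_4) (a : 'I_2) : Mbl := var F (inr (i, a) : bl_coord).
Definition pullx : Mx -> Mbl := evx cb xb.
HB.instance Definition _ := GRing.RMorphism.on pullx.

Definition deg0 (d : nat) (j : option 'I_4) : nat := if j is Some _ then 0%N else d.
Definition deg1 (d : nat) (i : 'I_4) (j : option 'I_4) : nat := if j == Some i then d else 0%N.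

Lemma Psi_pullx f : Psi (pullx f) = f.
Proof.
rewrite /pullx /evx ev_hom -[RHS]ev_var_id; apply: eq_ev => t /=.
  by rewrite /Psi ev_cst.
by rewrite mxE /Psi ev_var /gpt /= mxE.
Qed.

Lemma pullx_lform i a : pullx (lform i a) = lb i a.
Proof. exact: evx_lform. Qed.

Lemma Psi_lb i a : Psi (lb i a) = lform i a.
Proof. by rewrite -pullx_lform Psi_pullx. Qed.

Lemma Psi_yv i a : Psi (yv i a) = lform i a.
Proof. by rewrite /yv /Psi ev_var. Qed.

Lemma Psi_cst c : Psi (cb c) = cx c. Proof. by rewrite /Psi ev_cst. Qed.

Lemma peval_pullx f p : peval (pullx f) p = evf (base_pt p) f.
Proof.
rewrite pevalE /pullx /evx ev_hom evfE; apply: eq_ev => t /=; first by rewrite ev_cst.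
by rewrite !mxE ev_var.
Qed.

Lemma mhomog_pullx d f : isform d f -> mhomog bl_block (deg0 d) (pullx f).
Proof.
move=> hf; apply/mhomogE => -[i|].
  apply: (whom_ev (w := fun=> 0%N) (d := 0%N) _ (@whom_weight0 _ _ f)) => j.
  rewrite mxE.
  exact: (@whom_var F bl_coord (fun t => (bl_block t == Some i) : nat)).
apply: (whom_ev _ hf) => j; rewrite mxE.
exact: (@whom_var F bl_coord (fun t => (bl_block t == None) : nat)).
Qed.

Lemma mhomog_lb i a : mhomog bl_block (deg0 1) (lb i a).
Proof. by rewrite -pullx_lform; apply: mhomog_pullx; exact: lform_isform. Qed.

Lemma mhomog_yv i a : mhomog bl_block (deg1 1 i) (yv i a).
Proof.
apply: eq_mhomog _ (@mhomog_var F _ _ bl_block (inr (i, a))) => j.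
by rewrite /deg1 eq_sym; case: eqP.
Qed.

Lemma peval_lb i a p : peval (lb i a) p = (base_pt p *m A i) ord0 a.
Proof. by rewrite -pullx_lform peval_pullx evf_lform. Qed.

Lemma peval_yv i a p : peval (yv i a) p = fiber_pt p i ord0 a.
Proof. by rewrite peval_var mxE. Qed.

Lemma homog_Psi e P : mhomog bl_block e P -> isform (\sum_j e j) (Psi P).
Proof.
move=> /mhomog_total hP; apply: (whom_ev _ hP) => -[j|[i a]].
  by rewrite /= mxE; exact: (@whom_var F 'I_4 (fun=> 1%N)).
exact: lform_isform.
Qed.

(** ** Points of the graph *)

Definition graph : set (bl_coord -> F) :=
  [set p | mproj bl_block p /\ forall i, base_pt p *m A i != 0 /\
       exists t : F, fiber_pt p i = t *: (base_pt p *m A i)].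

Lemma graph_mproj : graph `<=` mproj bl_block. Proof. by move=> p []. Qed.

Lemma blowup_mproj : X `<=` mproj bl_block.
Proof. exact: zclosure_mproj graph_mproj. Qed.

Lemma zclosed_blowup : zclosed bl_block X.
Proof. exact: zclosed_zclosure graph_mproj. Qed.

Lemma gpt_graph x : (forall i, x *m A i != 0) -> graph (gpt idfun x).
Proof.
move=> H; rewrite gpt_idE; split.
  apply/mproj_pt; split=> //.
  by apply: contraNneq (H ord0) => ->; rewrite mul0mx.
by move=> i; rewrite base_ptE fiber_ptE; split=> //; exists 1; rewrite scale1r.
Qed.

Definition tscale (t : 'I_4 -> F) (j : option 'I_4) := if j is Some i then t i else 1.

(** A point of the graph differs from the standard representative only by the
    scaling of its projective coordinates. *)
Lemma graph_scale p : graph p -> exists2 t : 'I_4 -> F, (forall i, t i != 0) &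
  p = fun u => tscale t (bl_block u) * gpt idfun (base_pt p) u.
Proof.
rewrite -{1}(pt_eta p) => -[/mproj_pt[x0 y0] H].
have /choice[t tE] : forall i, exists t, fiber_pt p i = t *: (base_pt p *m A i).
  by move=> i; have [_ []] := H i => t; rewrite pt_eta => E; exists t.
exists t; first by move=> i; apply: contraNneq (y0 i) => t0; rewrite tE t0 scale0r.
rewrite gpt_idE -{1}(pt_eta p); apply/funext => -[j|[i a]] /=; first by rewrite mul1r.
by rewrite tE mxE.
Qed.

Lemma tscale_prod_neq0 t (e : option 'I_4 -> nat) : (forall i, t i != 0) ->
  \prod_j tscale t j ^+ e j != 0.
Proof.
move=> t0; apply/prodf_neq0 => -[i|] _ /=; last by rewrite expr1n oner_eq0.
exact: expf_neq0.
Qed.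

Lemma peval_graph e P p : mhomog bl_block e P -> graph p ->
  (peval P p == 0) = (evf (base_pt p) (Psi P) == 0).
Proof.
move=> he /graph_scale[t t0 E]; rewrite evf_Psi {1}E (peval_scale _ _ he).
by rewrite mulf_eq0 (negbTE (tscale_prod_neq0 _ t0)).
Qed.

Lemma vanishes_blowup e P : mhomog bl_block e P ->
  (forall p, graph p -> peval P p = 0) -> vanishing_ideal X P.
Proof. by move=> he H; exact: (vanishes_zclosure graph_mproj he). Qed.

Lemma Psi0_vanishes e P : mhomog bl_block e P -> Psi P = 0 -> vanishing_ideal X P.
Proof.
move=> he P0; apply: (vanishes_blowup he) => p gp; apply/eqP.
by rewrite (peval_graph he gp) P0 evfE rmorph0.
Qed.

Lemma graph_relation i a a' p : X p ->
  (base_pt p *m A i) ord0 a * fiber_pt p i ord0 a' =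
  (base_pt p *m A i) ord0 a' * fiber_pt p i ord0 a.
Proof.
move=> Xp; have H : vanishing_ideal X (lb i a * yv i a' - lb i a' * yv i a).
  apply: (@Psi0_vanishes (fun j => deg0 1 j + deg1 1 i j)%N).
    by apply: mhomogB; apply: mhomogM; rewrite ?mhomog_lb ?mhomog_yv //;
       (exact: mhomog_lb || exact: mhomog_yv).
  by rewrite rmorphB !rmorphM /= !Psi_lb !Psi_yv mulrC subrr.
have := H p Xp; rewrite pevalB !pevalM !peval_lb !peval_yv => /eqP.
by rewrite subr_eq0 => /eqP.
Qed.

Lemma proportional2 (v y : 'rV[F]_2) : v != 0 ->
  (forall a a', v ord0 a * y ord0 a' = v ord0 a' * y ord0 a) ->
  exists t, y = t *: v.
Proof.
move=> /rv_neq0[a va] H; exists (y ord0 a / v ord0 a); apply/rowP => a'.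
by rewrite mxE; apply: (mulfI va); rewrite H; field.
Qed.

Lemma graphP p : X p -> (forall i, base_pt p *m A i != 0) -> graph p.
Proof.
move=> Xp H; split; first exact: blowup_mproj.
move=> i; split=> //; apply: proportional2 => // a a'; exact: graph_relation.
Qed.

End BlowUp.

Lemma big_option (R : Type) (idx : R) (op : Monoid.com_law idx) (I : finType)
    (f : option I -> R) :
  \big[op/idx]_(j : option I) f j = op (f None) (\big[op/idx]_(i : I) f (Some i)).
Proof.
rewrite (bigD1 None) //=; congr (op _ _).
rewrite (reindex_omap Some id) /=; first by apply: eq_bigl => i; rewrite eqxx.
by case.
Qed.

Lemma form_msize (F : fieldType) (T : finType) d (P : mpolyT F T) :
  P != 0 -> whom (fun=> 1%N) d P -> msize P = d.+1.
Proof.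
move=> P0 h; rewrite -mlead_deg //; congr _.+1.
have := h (mlead P); rewrite mlead_supp // => /(_ isT) <-.
by rewrite mdegE /wdeg; apply: eq_bigr => i _; rewrite muln1.
Qed.

Lemma zclosure_id (F : fieldType) (T K : finType) (b : T -> K) Z :
  zclosed b Z -> zclosure b Z = Z :> set (T -> F).
Proof.
move=> cZ; apply/seteqP; split; last exact: sub_zclosure.
by move=> p; apply.
Qed.

Section PrimeDivisors.
Variables (F : numClosedFieldType) (A : 'I_4 -> 'M[F]_(4, 2)).
Hypothesis disjoint_lines :
  forall i j, i != j -> (row_mx (A i) (A j) : 'M_4) \in unitmx.

Local Notation Mx := (mpolyT F 'I_4).
Local Notation X := (blowup A).
Local Notation cx := (@pcst F 'I_4).
Local Notation Psi := (Psi A).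
Local Notation lform := (lform A).
Local Notation lb := (lb A).
Local Notation yv := (yv F).

(** ** Coordinates adapted to one of the lines *)

(** Any line other than the [i]-th one gives coordinates adapted to the
    [i]-th line. *)
Definition mate (i : 'I_4) : 'I_4 := if i == ord0 then ord_max else ord0.

Lemma mate_neq i : i != mate i.
Proof. by rewrite /mate; case: (eqVneq i ord0) => [->|]. Qed.

Definition frame i j : 'M[F]_(2 + 2, 4) := invmx (row_mx (A i) (A j) : 'M_4).
(** For [i] and [j] distinct, [x *m A i *m dual i j] is the projection of [x] to
    the [j]-th line from the [i]-th one; see [dual_sum]. *)
Definition dual i j : 'M[F]_(2, 4) := usubmx (frame i j).

Lemma frame_blocks i j : i != j ->
  [/\ dual i j *m A i = 1%:M, dual i j *m A j = 0, dsubmx (frame i j) *m A i = 0 &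
      dsubmx (frame i j) *m A j = 1%:M].
Proof.
move=> ij; have : frame i j *m row_mx (A i) (A j) = 1%:M :> 'M[F]_(2 + 2).
  exact: mulVmx (disjoint_lines ij).
rewrite -[frame i j]vsubmxK -/(dual i j) mul_col_row.
rewrite (_ : 1%:M = block_mx 1%:M 0 0 1%:M :> 'M[F]_(2 + 2)); last first.
  by rewrite -scalar_mx_block.
by rewrite vsubmxK => /eq_block_mx [].
Qed.

(** For [w : 'rV_2], [w *m sec i] is a point at which the equations of the
    [i]-th line take the values [w]. *)
Definition sec i : 'M[F]_(2, 4) := dual i (mate i).
(** For [u : 'rV_2], [u *m ker i] runs through the points of the [i]-th line. *)
Definition ker i : 'M[F]_(2, 4) := dsubmx (frame i (mate i)).

Lemma sec_lines i : sec i *m A i = 1%:M. Proof. by case: (frame_blocks (mate_neq i)). Qed.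
Lemma ker_lines i : ker i *m A i = 0. Proof. by case: (frame_blocks (mate_neq i)). Qed.
Lemma ker_mate i : ker i *m A (mate i) = 1%:M. Proof. by case: (frame_blocks (mate_neq i)). Qed.

Lemma decomposition i : A i *m sec i + A (mate i) *m ker i = 1%:M.
Proof.
have U := disjoint_lines (mate_neq i).
have : row_mx (A i) (A (mate i)) *m frame i (mate i) = 1%:M :> 'M[F]_4 by exact: mulmxV U.
by rewrite -[frame i _]vsubmxK mul_row_col.
Qed.

Lemma disjoint_eq0 i j (x : 'rV[F]_4) : i != j -> x *m A i = 0 -> x *m A j = 0 -> x = 0.
Proof.
move=> ij xi xj; rewrite -(mulmxK (disjoint_lines ij) x).
have E : x *m row_mx (A i) (A j) = 0 :> 'rV_(2 + 2) by rewrite mul_mx_row xi xj row_mx0.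
have -> : x *m (row_mx (A i) (A j) : 'M_4) = 0 by exact: E.
by rewrite mul0mx.
Qed.

Lemma ker_neq0 i (u : 'rV[F]_2) : u != 0 -> u *m ker i != 0.
Proof.
apply: contra_neq => H; rewrite -[u]mulmx1 -(ker_mate i) mulmxA H mul0mx //.
Qed.

Lemma ker_other i k (u : 'rV[F]_2) : k != i -> u != 0 -> u *m ker i *m A k != 0.
Proof.
move=> ki u0; apply: contra_neq (ker_neq0 i u0) => H.
by apply: (disjoint_eq0 ki H); rewrite -mulmxA ker_lines mulmx0.
Qed.

Lemma on_line i (x : 'rV[F]_4) : x *m A i = 0 -> x = x *m A (mate i) *m ker i.
Proof.
move=> xi; rewrite -{1}[x]mulmx1 -(decomposition i) mulmxDr !mulmxA xi mul0mx.
by rewrite add0r.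
Qed.

Lemma evf_sec i a b : evf (row a (sec i)) (lform i b) = (a == b)%:R.
Proof. by rewrite evf_lform -row_mul sec_lines !mxE. Qed.

Lemma lform_neq0 i a : lform i a != 0.
Proof.
apply/eqP => /(congr1 (evf (row a (sec i)))).
by rewrite evf_sec eqxx evfE rmorph0 => /eqP; rewrite oner_eq0.
Qed.

Lemma generic_good (g : Mx) : g != 0 ->
  exists x, evf x g != 0 /\ forall i, x *m A i != 0.
Proof.
move=> g0; have [|x] := @evf_nonroot F (g * \prod_i lform i ord0).
  by rewrite mulf_neq0 //; apply/prodf_neq0 => i _; exact: lform_neq0.
rewrite evfM mulf_eq0 negb_or => /andP[gx]; rewrite evfE rmorph_prod /= => H.
exists x; split=> // i; apply/rv_neq0; exists ord0; rewrite -evf_lform evfE.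
by move/prodf_neq0: H; apply.
Qed.

Lemma vanishes_Psi0 P : vanishing_ideal X P -> Psi P = 0.
Proof.
move=> H; apply/eqP; apply: contraT => /generic_good[x [Px gx]].
move: Px; rewrite evf_Psi H ?eqxx //; apply: sub_zclosure; exact: gpt_graph.
Qed.

(** ** Strict transforms of surfaces *)

Definition surf_graph (f : Mx) : set (bl_coord -> F) :=
  [set p | graph A p /\ evf (base_pt p) f = 0].

Definition strict (f : Mx) := zclosure bl_block (surf_graph f).

Lemma surf_graph_mproj f : surf_graph f `<=` mproj bl_block.
Proof. by move=> p [[]]. Qed.

(** A prime that divides two independent linear forms would make them
    proportional. *)
Lemma prime_column f i : prime_elt f -> exists a, ~ divides f (lform i a).
Proof.
move=> Pf; apply: contrapT => /forallNP H.
have /choice[c cE] : forall a, exists c, lform i a = c * f.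
  by move=> a; exact: contrapT (H a).
have f0 := pi_neq0 Pf.
have c1 a : c a = cx ((c a)@_0).
  have c0 : c a != 0.
    by apply: contraNneq (lform_neq0 i a) => c0; rewrite cE c0 mul0r.
  apply: msize1_polyC; have := form_msize (lform_neq0 i a) (@lform_isform _ A i a).
  rewrite cE msizeM // => E2; have E1 := prime_msize Pf.
  by move: (msize f) (msize (c a)) E1 E2 => m n; lia.
have E a b : cx ((c b)@_0) * lform i a = cx ((c a)@_0) * lform i b.
  by rewrite !cE -!c1; ring.
have E' a b x : (c b)@_0 * evf x (lform i a) = (c a)@_0 * evf x (lform i b).
  by have := congr1 (evf x) (E a b); rewrite !evfM /evf !peval_cst.
have := E' ord0 ord_max (row ord0 (sec i)); rewrite !evf_sec eqxx mulr1 mulr0 => z.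
by have := lform_neq0 i ord_max; rewrite cE c1 z rmorph0 mul0r eqxx.
Qed.

Lemma prime_columns f : prime_elt f ->
  exists col : 'I_4 -> 'I_2, forall i, ~ divides f (lform i (col i)).
Proof.
move=> Pf; have /choice[col H] : forall i, exists a, ~ divides f (lform i a).
  by move=> i; exact: prime_column.
by exists col.
Qed.

(** The Nullstellensatz only needs the points away from the four lines: the
    equations of a line can be chosen not to be multiples of [f]. *)
Lemma surface_divides f g : prime_elt f ->
  (forall x, (forall i, x *m A i != 0) -> evf x f = 0 -> evf x g = 0) ->
  divides f g.
Proof.
move=> Pf H; have [col hcol] := prime_columns Pf.
have : divides f (g * \prod_i lform i (col i)).
  apply: nullstellensatzx => // x fx; rewrite evfM.
  have [gx|/existsNP[i /negP]] := pselect (forall i, x *m A i != 0).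
    by rewrite H // mul0r.
  rewrite negbK => /eqP xi; rewrite [X in _ * X](_ : _ = 0) ?mulr0 //.
  by rewrite evfE rmorph_prod (bigD1 i) //= -evfE evf_lform xi mxE mul0r.
case/(let: And3 _ _ h := Pf in h) => // /(prime_dvd_prod Pf)[i [_ _ hi]].
by case: (hcol i).
Qed.

Lemma strict_divides f P : prime_elt f -> vanishing_ideal (strict f) P ->
  divides f (Psi P).
Proof.
move=> Pf H; apply: surface_divides => // x gx fx; rewrite evf_Psi H //.
apply: sub_zclosure; split; first exact: gpt_graph.
by rewrite gpt_idE base_ptE.
Qed.

Lemma strict_vanishes e f P : mhomog bl_block e P -> divides f (Psi P) ->
  vanishing_ideal (strict f) P.
Proof.
move=> he [c cE]; apply: (vanishes_zclosure (@surf_graph_mproj f) he) => p [gp fp].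
by apply/eqP; rewrite (peval_graph he gp) cE evfM fp mulr0.
Qed.

Lemma strict_subX f : strict f `<=` X.
Proof.
apply: zclosure_sub; first exact: zclosed_blowup.
by move=> p [gp _]; exact: sub_zclosure.
Qed.

Lemma strict_subvariety f : prime_elt f -> subvariety bl_block (strict f).
Proof.
move=> Pf; apply: subvariety_zclosure; first exact: surf_graph_mproj.
  apply: contrapT => /forallNP H.
  have : divides f 1.
    apply: surface_divides => // x gx fx; case: (H (gpt A idfun x)).
    by split; [exact: gpt_graph|rewrite gpt_idE base_ptE].
  by move/(prime_nunit Pf); rewrite unitr1.
move=> e e' P Q hP hQ PQ; have : divides f (Psi (P * Q)).
  by apply: (strict_divides Pf); exact: (vanishes_zclosure (@surf_graph_mproj f) (mhomogM hP hQ)).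
rewrite rmorphM => /(let: And3 _ _ h := Pf in h)[] /strict_vanishes H; [left|right];
  by move=> p fp; apply: H; [eassumption|exact: sub_zclosure].
Qed.

Lemma strict_proper d f : prime_elt f -> isform d f -> strict f `<` X.
Proof.
move=> Pf hf; split; first exact: strict_subX.
move=> XW; have [f0 _ _] := Pf.
have H : vanishing_ideal (strict f) (pullx f).
  apply: (strict_vanishes (mhomog_pullx hf)); rewrite Psi_pullx; exact: divides_refl.
have : Psi (pullx f) = 0 by apply: vanishes_Psi0 => p /XW; exact: H.
by rewrite Psi_pullx => /eqP; rewrite (negbTE f0).
Qed.

(** On the graph the fibre coordinates of [P] can be traded for equations of
    the lines, at the expense of the factors [G] and [Y]. *)
Lemma clear_fibers e P (col : 'I_4 -> 'I_2) : mhomog bl_block e P ->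
  let G := \prod_i lb i (col i) ^+ e (Some i) in
  let Y := \prod_i yv i (col i) ^+ e (Some i) in
  [/\ exists e', mhomog bl_block e' G, exists e', mhomog bl_block e' Y,
      Psi G = Psi Y & forall f, Psi P = f -> vanishing_ideal X (G * P - Y * pullx f)].
Proof.
move=> he G Y.
have hG := @mhomog_prod F _ _ bl_block _ (index_enum 'I_4) xpredT _ _
  (fun i _ => mhomogX (n := e (Some i)) (@mhomog_lb F A i (col i))).
have hY := @mhomog_prod F _ _ bl_block _ (index_enum 'I_4) xpredT _ _
  (fun i _ => mhomogX (n := e (Some i)) (@mhomog_yv F i (col i))).
have EGY : Psi G = Psi Y.
  by rewrite /G /Y !rmorph_prod; apply: eq_bigr => i _; rewrite !rmorphXn /= Psi_lb Psi_yv.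
split; [by eexists; exact: hG|by eexists; exact: hY|by []|].
move=> f fE; have hf : isform (\sum_j e j) f by rewrite -fE; exact: homog_Psi he.
apply: (@Psi0_vanishes _ A (fun j => (\sum_i e (Some i) * deg0 1 j + e j)%N)); last first.
  by rewrite rmorphB !rmorphM /= Psi_pullx fE EGY subrr.
apply: mhomogB; first exact: mhomogM hG he.
apply: eq_mhomog _ (mhomogM hY (mhomog_pullx hf)) => -[k|] /=.
  rewrite addn0 [in RHS]big1 ?add0n; last by move=> i _; rewrite muln0.
  rewrite (bigD1 k) //= /deg1 eqxx muln1 big1 ?addn0 // => i ik.
  by case: eqP => [[E]|]; rewrite ?muln0 //; rewrite E eqxx in ik.
rewrite big_option /= [X in (X + _)%N]big1; last by move=> i _; rewrite muln0.
by rewrite add0n addnC; congr (_ + _)%N; apply: eq_bigr => i _; rewrite muln1.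
Qed.

Lemma nonzero_fiber V i : subvariety bl_block V -> exists a, ~ vanishing_ideal V (yv i a).
Proof.
move=> sV; have [cV [p Vp] _] := sV; apply: contrapT => /forallNP H.
have /(_ (Some i))[[j|[k a]] //= [ki]] := zclosed_mproj cV Vp.
by have /contrapT/(_ p Vp) := H a; rewrite peval_var ki => ->; rewrite eqxx.
Qed.

(** An equation of [V] that does not vanish on [X] becomes, after multiplication
    by fibre coordinates, the pull-back of a form; as [V] is irreducible, one
    of the prime factors of the form vanishes on [V]. *)
Lemma on_prime_surface V : subvariety bl_block V -> V `<` X ->
  exists f d, [/\ prime_elt f, isform d f & vanishing_ideal V (pullx f)].
Proof.
move=> sV [VX nXV]; have [cV [p0 Vp0] _] := sV.
have [p /not_implyP[Xp nVp]] : exists p, ~ (X p -> V p).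
  by apply: contrapT => /forallNP H; apply: nXV => p; exact: contrapT (H p).
have [e [P [he PV Pp]]] := zclosed_separate cV (blowup_mproj Xp) nVp.
have f0 : Psi P != 0.
  by apply: contraNneq Pp => P0; rewrite (Psi0_vanishes he P0).
have hf : isform (\sum_j e j) (Psi P) by exact: homog_Psi he.
have /choice[col hcol] : forall i, exists a, ~ vanishing_ideal V (yv i a).
  by move=> i; exact: nonzero_fiber.
have [_ [eY hY] _ /(_ _ erefl) H] := clear_fibers col he.
have Vf : vanishing_ideal V (pullx (Psi P)).
  have [] // := subvariety_prime sV hY (mhomog_pullx hf).
    move=> q Vq; have := H q (VX q Vq); rewrite pevalB !pevalM (PV q Vq) mulr0 sub0r.
    by move/eqP; rewrite oppr_eq0 => /eqP.
  have hc : forall i, i \in index_enum 'I_4 ->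
      exists e', mhomog bl_block e' (yv i (col i) ^+ e (Some i)).
    by move=> i _; eexists; exact: (mhomogX (@mhomog_yv F i (col i))).
  move/(subvariety_prime_prod sV hc) => [i _ Hi]; case: (hcol i) => q Vq.
  by have := Hi q Vq; rewrite pevalX => /eqP; rewrite expf_eq0 => /andP[_ /eqP].
have [u [s [uu Ps E]]] := @ufd_mpoly F #|'I_4| _ f0.
have hs (g : Mx) : g \in s -> exists d, isform d g.
  move=> gs; move: f0 hf; rewrite E (big_rem g) //= mulrCA => fg0.
  exact: whom_factor fg0.
have hs' (g : Mx) : g \in s -> exists e', mhomog bl_block e' (pullx g).
  by move=> /hs[d hd]; exists (deg0 d); exact: mhomog_pullx.
have [|g gs Hg] := subvariety_prime_prod sV hs'.
  move=> q Vq; have := Vf q Vq; rewrite E rmorphM rmorph_prod /= pevalM => /eqP.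
  rewrite mulf_eq0 => /orP[|/eqP //].
  have upu : pullx u \is a GRing.unit by rewrite rmorph_unit.
  have : peval (pullx u) q \is a GRing.unit by exact: (rmorph_unit (ev idfun q) upu).
  by rewrite unitfE => /negbTE ->.
by have [d hd] := hs g gs; exists g, d; split=> //; exact: Ps.
Qed.

Lemma prime_divides_assoc (f g : Mx) : prime_elt f -> prime_elt g -> divides f g ->
  divides g f.
Proof.
move=> Pf Pg /(prime_assoc Pf Pg)[u uu ->].
by exists u^-1; rewrite mulrA mulVr // mul1r.
Qed.

(** ** The exceptional divisors *)

Definition exc i : set (bl_coord -> F) := [set p | X p /\ base_pt p *m A i = 0].

Lemma lb_eq0 i p : (forall a, peval (lb i a) p = 0) -> base_pt p *m A i = 0.
Proof.
move=> H; apply/rowP => a; rewrite [RHS]mxE; have := H a; rewrite peval_lb.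
exact.
Qed.

Lemma zclosed_exc i : zclosed bl_block (exc i).
Proof.
have -> : exc i = [set p | X p /\ forall a, peval (lb i a) p = 0].
  apply/seteqP; split=> p [Xp H]; split=> //; first by move=> a; rewrite peval_lb H mxE.
  exact: lb_eq0.
by apply: zclosed_inter (@zclosed_blowup F A) _ => a; eexists; exact: mhomog_lb.
Qed.

(** Outside the exceptional divisors the two sets have the same equations, and
    an irreducible [V] that is not contained in one of them is determined
    there. *)
Lemma strict_sup V f : subvariety bl_block V -> V `<=` X ->
  (forall i, ~ V `<=` exc i) -> vanishing_ideal V (pullx f) -> V `<=` strict f.
Proof.
move=> sV VX nE Vf p Vp; rewrite /strict (zclosureP (@surf_graph_mproj f)) /=.
have [cV _ _] := sV; split; first exact: (zclosed_mproj cV).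
move=> e P he PW.
have /choice[col hcol] : forall i, exists a, ~ vanishing_ideal V (lb i a).
  move=> i; apply: contrapT => /forallNP H; apply: (nE i) => q Vq.
  split; first exact: VX.
  by apply: lb_eq0 => a; exact: contrapT (H a) q Vq.
have hc : forall i, i \in index_enum 'I_4 -> exists e', mhomog bl_block e' (lb i (col i)).
  by move=> i _; eexists; exact: mhomog_lb.
have hG := @mhomog_prod F _ _ bl_block _ (index_enum 'I_4) xpredT _ _
  (fun i _ => @mhomog_lb F A i (col i)).
have [] := subvariety_prime sV he hG; last 2 first.
- by apply.
- by move/(subvariety_prime_prod sV hc) => [i _ /(hcol i)].
move=> q Vq; rewrite pevalM.
have [gq|/existsNP[i /negP]] := pselect (forall i, base_pt q *m A i != 0).
  rewrite PW ?mul0r //; split; first by apply: graphP => //; exact: VX.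
  by rewrite -peval_pullx; exact: Vf.
rewrite negbK => /eqP qi; rewrite [X in _ * X](_ : _ = 0) ?mulr0 //.
by rewrite peval_prod (bigD1 i) //= peval_lb qi mxE mul0r.
Qed.

Lemma strict_not_exc f i : prime_elt f -> ~ strict f `<=` exc i.
Proof.
move=> Pf H; have [a []] := prime_column i Pf.
rewrite -(Psi_lb A); apply: (strict_divides Pf) => p /H[_ pi].
by rewrite peval_lb pi mxE.
Qed.

(** The images of the exceptional divisors in P^3 are disjoint lines. *)
Lemma exc_disjoint i j p : exc i p -> exc j p -> i = j.
Proof.
move=> [Xp pi] [_ pj]; apply/eqP; apply: contraT => ij.
have := disjoint_eq0 ij pi pj => p0.
have := blowup_mproj Xp; rewrite -(pt_eta p) => /mproj_pt[].
by rewrite p0 eqxx.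
Qed.

End PrimeDivisors.

(** * The valuation of an exceptional divisor *)

Lemma var_neq0 (F : fieldType) (T : finType) (t : T) : var F t != 0.
Proof.
apply/eqP => /(congr1 (ev idfun (fun=> 1 : F))).
by rewrite ev_var rmorph0 => /eqP; rewrite oner_eq0.
Qed.

Section Exceptional.
Variables (F : numClosedFieldType) (A : 'I_4 -> 'M[F]_(4, 2)).
Hypothesis dl : forall i j, i != j -> (row_mx (A i) (A j) : 'M_4) \in unitmx.

Local Notation Mx := (mpolyT F 'I_4).
Local Notation Mbl := (mpolyT F bl_coord).
Local Notation X := (blowup A).
Local Notation cx := (@pcst F 'I_4).
Local Notation Psi := (Psi A).
Local Notation lform := (lform A).
Local Notation ker := (ker A).
Local Notation sec := (sec A).
Local Notation exc := (exc A).
Local Notation UW := (('I_2 + 'I_4)%type : finType).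
Local Notation Muw := (mpolyT F UW).
Local Notation D := {poly Muw}.
Local Notation cD := (polyC \o @pcst F UW).

Definition uw (S : Type) (u : 'rV[S]_2) (w : 'rV[S]_4) (t : UW) : S :=
  match t with inl a => u ord0 a | inr j => w ord0 j end.

Definition uvec : 'rV[D]_2 := \row_a (var F (inl a : UW))%:P.
Definition wvec : 'rV[D]_4 := \row_j (var F (inr j : UW))%:P.

Definition xpt (S : comNzRingType) (iota : {rmorphism F -> S}) i
    (u : 'rV[S]_2) (w : 'rV[S]_4) (s : S) :=
  u *m map_mx iota (ker i) + s *: w.

Definition tpt (S : comNzRingType) (iota : {rmorphism F -> S}) i
    (u : 'rV[S]_2) (w : 'rV[S]_4) (s : S) :=
  pt (xpt iota i u w s) (fun k => if k == i then w *m map_mx iota (A i)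
                               else xpt iota i u w s *m map_mx iota (A k)).

(** A one-parameter family of points, for [s] tending to 0, whose limit is the
    general point of the exceptional divisor: base point [u *m ker i] on the line
    and normal direction [w]. *)
Definition theta i : Mbl -> D := ev cD (tpt cD i uvec wvec 'X).
HB.instance Definition _ i := GRing.RMorphism.on (theta i).

(** The order of [Phi i f] in ['X] is the multiplicity of [f] along the line. *)
Definition Phi i : Mx -> D := evx cD (xpt cD i uvec wvec 'X).
HB.instance Definition _ i := GRing.RMorphism.on (Phi i).

Lemma hom_xpt (S S' : comNzRingType) (g : {rmorphism S -> S'})
    (iota : {rmorphism F -> S}) i u w s :
  map_mx g (xpt iota i u w s) = xpt (g \o iota) i (map_mx g u) (map_mx g w) (g s).
Proof. by rewrite /xpt map_mxD map_mxM map_mxZ -map_mx_comp. Qed.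

Lemma hom_tpt (S S' : comNzRingType) (g : {rmorphism S -> S'})
    (iota : {rmorphism F -> S}) i u w s t :
  g (tpt iota i u w s t) = tpt (g \o iota) i (map_mx g u) (map_mx g w) (g s) t.
Proof.
rewrite /tpt hom_pt hom_xpt; case: t => [j|[k a]] //=.
by case: eqP => _; rewrite map_mxM /= ?hom_xpt -map_mx_comp.
Qed.

Lemma map_mx_idfun (S : Type) m n (M : 'M[S]_(m, n)) : map_mx idfun M = M.
Proof. exact: map_mx_id. Qed.

Lemma eq_map_mx (S S' : Type) (f g : S -> S') m n (M : 'M_(m, n)) :
  f =1 g -> map_mx f M = map_mx g M.
Proof. by move=> e; apply/matrixP => u v; rewrite !mxE e. Qed.

Lemma eq_xpt (S : comNzRingType) (i1 i2 : {rmorphism F -> S}) i u w s :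
  i1 =1 i2 -> xpt i1 i u w s = xpt i2 i u w s.
Proof. by move=> e; rewrite /xpt (eq_map_mx _ e). Qed.

Lemma eq_tpt (S : comNzRingType) (i1 i2 : {rmorphism F -> S}) i u w s :
  i1 =1 i2 -> tpt i1 i u w s = tpt i2 i u w s.
Proof.
move=> e; apply/funext => -[j|[k a]]; rewrite /tpt /= (eq_xpt _ _ _ _ e) //.
by case: eqP => _; rewrite (eq_map_mx _ e).
Qed.

(** Values of the parameters; identities between homomorphisms on the parameter
    ring reduce to identities between families of points. *)
Definition evD (S : comNzRingType) (iota : {rmorphism F -> S})
    (u : 'rV[S]_2) (w : 'rV[S]_4) (s : S) : D -> S :=
  horner_eval s \o map_poly (ev iota (uw u w)).
HB.instance Definition _ S iota u w s := GRing.RMorphism.on (@evD S iota u w s).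

Lemma evDX S iota u w s : @evD S iota u w s 'X = s.
Proof. by rewrite /evD /= map_polyX /horner_eval hornerX. Qed.

Lemma evD_cst S iota u w s c : @evD S iota u w s (cD c) = iota c.
Proof. by rewrite /evD /= map_polyC /horner_eval hornerC /= ev_cst. Qed.

Lemma evD_u S iota u w s : map_mx (@evD S iota u w s) uvec = u.
Proof.
by apply/rowP => a; rewrite !mxE /evD /= map_polyC /horner_eval hornerC /= ev_var.
Qed.

Lemma evD_w S iota u w s : map_mx (@evD S iota u w s) wvec = w.
Proof.
by apply/rowP => a; rewrite !mxE /evD /= map_polyC /horner_eval hornerC /= ev_var.
Qed.

Lemma evD_theta S iota i u w s P :
  @evD S iota u w s (theta i P) = ev iota (tpt iota i u w s) P.
Proof.
have E : evD iota u w s \o cD =1 iota by move=> c; exact: evD_cst.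
rewrite /theta ev_hom; apply: eq_ev => // t /=.
by rewrite hom_tpt /= evD_u evD_w evDX (eq_tpt _ _ _ _ E).
Qed.

Lemma evD_Phi S iota i u w s f :
  @evD S iota u w s (Phi i f) = evx iota (xpt iota i u w s) f.
Proof.
have E : evD iota u w s \o cD =1 iota by move=> c; exact: evD_cst.
rewrite /Phi /evx ev_hom; apply: eq_ev => // j /=.
transitivity (map_mx (evD iota u w s) (xpt cD i uvec wvec 'X) ord0 j); first by rewrite [RHS]mxE.
by rewrite hom_xpt /= evD_u evD_w evDX (eq_xpt _ _ _ _ E).
Qed.

Lemma xpt_id i u w s : xpt idfun i u w s = u *m ker i + s *: w.
Proof. by rewrite /xpt map_mx_idfun. Qed.

Lemma evD_nonroot (d : D) : d != 0 -> exists u w s, evD idfun u w s d != 0.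
Proof.
move=> d0; have [|p lp] := @mpolyT_nonroot _ _ (lead_coef d); first by rewrite lead_coef_eq0.
have [|s ds] := @poly_nonroot _ (map_poly (ev idfun p) d).
  apply: contraNneq lp => /(congr1 (fun q : {poly F} => q`_(size d).-1)).
  by rewrite coef_map coef0 => /eqP.
exists (\row_a p (inl a)), (\row_j p (inr j)), s; rewrite /evD /= /horner_eval.
congr (_ .[_] != 0): ds; apply: eq_map_poly => c; apply: eq_ev => // -[a|j] /=; by rewrite mxE.
Qed.

Lemma coef0_nonroot (p : Muw) : p != 0 -> exists u w, ev idfun (uw u w) p != 0.
Proof.
move=> /mpolyT_nonroot[q pq]; exists (\row_a q (inl a)), (\row_j q (inr j)).
congr (_ != 0): pq; apply: eq_ev => // -[a|j] /=; by rewrite mxE.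
Qed.

Lemma evD0 (d : D) u w : evD idfun u w 0 d = ev idfun (uw u w) d`_0.
Proof. by rewrite /evD /= /horner_eval horner_coef0 coef_map. Qed.

(** At [u = 0], [s = 1] the family of points runs through the whole space. *)
Lemma Phi_inj i f : Phi i f = 0 -> f = 0.
Proof.
move/(congr1 (evD cx 0 (xvars F) 1)); rewrite evD_Phi rmorph0 => <-.
rewrite /xpt mul0mx add0r scale1r /evx -[LHS]ev_var_id; apply: eq_ev => // j.
by rewrite mxE.
Qed.

(** On the family, the equations of the [i]-th line are [s] times the
    coordinates on the [i]-th projective line.  This relation between total
    and strict transforms makes [mult i f] appear in the class of a surface. *)
Lemma Phi_Psi_weight i n P : whom (fun t => (bl_block t == Some i) : nat) n P ->
  Phi i (Psi P) = 'X^n * theta i P.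
Proof.
move=> hP; rewrite /Phi evx_Psi -(ev_scale_weight _ _ _ hP).
apply: eq_ev => // -[j|[k a]]; rewrite /gpt /tpt /=; first by rewrite expr0 mul1r.
have [[->]|ki] := eqVneq (Some k) (Some i).
  rewrite eqxx {1}/xpt mulmxDl -mulmxA -map_mxM ker_lines // map_mx0 mulmx0 add0r.
  by rewrite -scalemxAl mxE expr1.
have kiF : (k == i) = false by apply: contraNF ki => /eqP ->.
by rewrite kiF expr0 mul1r.
Qed.

Lemma Phi_Psi e P i : mhomog bl_block e P ->
  Phi i (Psi P) = 'X^(e (Some i)) * theta i P.
Proof. by move=> /mhomogE/(_ (Some i)); exact: Phi_Psi_weight. Qed.

Lemma tpt_graph i (u : 'rV[F]_2) w s : s != 0 ->
  (forall k, xpt idfun i u w s *m A k != 0) -> graph A (tpt idfun i u w s).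
Proof.
move=> s0 H; have Ei : xpt idfun i u w s *m A i = s *: (w *m A i).
  by rewrite xpt_id mulmxDl -mulmxA ker_lines // mulmx0 add0r scalemxAl.
have wi : w *m A i != 0.
  by apply: contra_neq (H i) => wi; rewrite Ei wi scaler0.
split.
  apply/mproj_pt; split; first by apply: contra_neq (H i) => ->; rewrite mul0mx.
  by move=> k; rewrite !map_mx_idfun; case: (eqVneq k i).
move=> k; rewrite /tpt base_ptE fiber_ptE; split=> //; rewrite !map_mx_idfun.
case: (eqVneq k i) => [->|_]; last by exists 1; rewrite scale1r.
by exists s^-1; rewrite Ei scalerA mulVf // scale1r.
Qed.

(** For general values of the parameters the family lies on the graph. *)
Lemma theta_vanishes i P : vanishing_ideal X P -> theta i P = 0.
Proof.
move=> H; apply/eqP; apply: contraT => P0.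
have [|u [w [s]]] := @evD_nonroot (theta i P * ('X * \prod_k Phi i (lform k ord0))).
  rewrite !mulf_neq0 ?polyX_eq0 //; apply/prodf_neq0 => k _.
  apply: contra_neq (lform_neq0 dl k ord0); exact: Phi_inj.
rewrite !rmorphM /= evDX rmorph_prod evD_theta !mulf_eq0 !negb_or => /and3P[Pp s0 /prodf_neq0 L].
have gp : graph A (tpt idfun i u w s).
  apply: tpt_graph => // k; apply/rv_neq0; exists ord0.
  have /= := L k isT; rewrite evD_Phi evx_lform; congr (_ != 0).
  by congr ((_ *m _) _ _); rewrite map_mx_idfun.
by case/eqP: Pp; apply: H; exact: sub_zclosure.
Qed.

(** ** Points of the exceptional divisor *)

Definition ept i (u : 'rV[F]_2) w := tpt idfun i u w 0.

Lemma ept_exc i u w : u != 0 -> w *m A i != 0 -> exc i (ept i u w).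
Proof.
move=> u0 wi; have E : xpt idfun i u w 0 = u *m ker i by rewrite xpt_id scale0r addr0.
split; last by rewrite /ept /tpt base_ptE E -mulmxA ker_lines // mulmx0.
rewrite /blowup zclosureP; last exact: graph_mproj; split.
  apply/mproj_pt; rewrite E; split; first exact: ker_neq0.
  by move=> k; rewrite !map_mx_idfun; case: (eqVneq k i) => // ki; exact: ker_other.
move=> e P he /(vanishes_blowup he)/(theta_vanishes i) P0.
by rewrite pevalE -evD_theta P0 rmorph0.
Qed.

(** The family at [s = 0] covers the exceptional divisor up to scaling. *)
Lemma exc_ept i p : exc i p -> exists u w l, [/\ u != 0, w *m A i != 0,
  forall j, l j != 0 & p = fun t => l (bl_block t) * ept i u w t].
Proof.
move=> [Xp pi]; have := blowup_mproj Xp; rewrite -(pt_eta p) => /mproj_pt[x0 y0].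
rewrite pt_eta; set x := base_pt p in pi x0 *; set u := x *m A (mate i).
have xE : x = u *m ker i by apply: on_line.
have u0 : u != 0 by apply: contra_neq x0 => u0; rewrite xE u0 mul0mx.
have /choice[t tE] : forall k, exists t, k != i -> fiber_pt p k = t *: (x *m A k).
  move=> k; have [->|ki] := eqVneq k i; first by exists 0.
  have [|a a'|t tE] := @proportional2 _ (x *m A k) (fiber_pt p k).
  - by rewrite xE; exact: ker_other.
  - exact: graph_relation.
  - by exists t.
pose w := fiber_pt p i *m sec i.
have wE : w *m A i = fiber_pt p i by rewrite /w -mulmxA sec_lines // mulmx1.
exists u, w, (fun j => if j is Some k then if k == i then 1 else t k else 1).
split=> //; first by rewrite wE.
  case=> [k|]; last exact: oner_neq0; have [_|ki] := eqVneq k i; first exact: oner_neq0.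
  by apply: contra_neq (y0 k) => t0; rewrite tE // t0 scale0r.
rewrite -{1}(pt_eta p); rewrite /ept /tpt xpt_id scale0r addr0 -xE;
  apply/funext => -[j|[k a]] /=; rewrite ?map_mx_idfun.
  by rewrite mul1r.
by have [->|ki] := eqVneq k i; rewrite ?mul1r ?wE // tE // mxE.
Qed.

Lemma exc_divides i P : vanishing_ideal (exc i) P -> divides 'X (theta i P).
Proof.
move=> H; apply/divides_X/eqP; apply: contraT => P0.
pose L : Muw := ((\row_j var F (inr j : UW)) *m map_mx (@pcst F UW) (A i)) ord0 ord0.
have evL u w : ev idfun (uw u w) L = (w *m A i) ord0 ord0.
  rewrite /L !mxE rmorph_sum; apply: eq_bigr => j _.
  by rewrite !mxE rmorphM /= ev_var ev_cst.
have L0 : L != 0.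
  apply/eqP => /(congr1 (ev idfun (uw (0 : 'rV[F]_2) (row ord0 (sec i))))).
  rewrite evL rmorph0 -row_mul sec_lines // !mxE eqxx => /eqP.
  by rewrite oner_eq0.
have [|u [w]] := @coef0_nonroot ((theta i P)`_0 * (var F (inl ord0 : UW) * L)).
  by rewrite !mulf_neq0 ?var_neq0.
rewrite !rmorphM /= !mulf_eq0 !negb_or ev_var evL => /and3P[Pp u0 wi].
have : exc i (ept i u w) by apply: ept_exc; apply/rv_neq0; exists ord0.
by move/H => /eqP; rewrite pevalE /ept -evD_theta evD0 (negbTE Pp).
Qed.

Lemma exc_vanishes i e P : mhomog bl_block e P -> divides 'X (theta i P) ->
  vanishing_ideal (exc i) P.
Proof.
move=> he /divides_X P0 p /exc_ept[u [w [l [_ _ _ ->]]]].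
rewrite (peval_scale _ _ he) pevalE /ept -evD_theta evD0 P0 rmorph0 mulr0 //.
Qed.

Lemma exc_nonempty i : exc i !=set0.
Proof.
exists (ept i (delta_mx ord0 ord0) (row ord0 (sec i))); apply: ept_exc.
  by apply/rv_neq0; exists ord0; rewrite mxE !eqxx oner_neq0.
by apply/rv_neq0; exists ord0; rewrite -row_mul sec_lines // !mxE eqxx oner_neq0.
Qed.

Lemma exc_subX i : exc i `<=` X. Proof. by move=> p []. Qed.

Lemma exc_subvariety i : subvariety bl_block (exc i).
Proof.
rewrite -(zclosure_id (zclosed_exc A i)); apply: subvariety_zclosure.
- by move=> p /exc_subX; exact: blowup_mproj.
- exact: exc_nonempty.
move=> e e' P Q hP hQ /exc_divides; rewrite rmorphM.
have [_ _ h] := prime_X Muw.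
by move/h => [] /exc_vanishes H; [left|right]; apply: H; eassumption.
Qed.

Lemma exc_proper i : exc i `<` X.
Proof.
split; first exact: exc_subX.
have [x [_ gx]] := generic_good dl (oner_neq0 Mx).
move=> /(_ (gpt A idfun x)) []; first by apply: sub_zclosure; exact: gpt_graph.
by move=> _; rewrite gpt_idE base_ptE => /eqP; rewrite (negbTE (gx i)).
Qed.

End Exceptional.

Lemma big_enum_valT (R : Type) (idx : R) (op : Monoid.com_law idx) (T : finType)
    (G : T -> 'I_#|T| -> R) :
  \big[op/idx]_(k < #|T|) G (enum_val k) k = \big[op/idx]_(t : T) G t (enum_rank t).
Proof.
rewrite [RHS](reindex (@enum_val T xpredT)) /=; last first.
  by exists enum_rank => x _; [exact: enum_valK|exact: enum_rankK].
by apply: eq_bigr => k _; rewrite enum_valK.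
Qed.

(** * Lifting forms with multiplicity along a line *)

Section Orders.
Variables (F : numClosedFieldType) (A : 'I_4 -> 'M[F]_(4, 2)).
Hypothesis dl : forall i j, i != j -> (row_mx (A i) (A j) : 'M_4) \in unitmx.

Local Notation Mx := (mpolyT F 'I_4).
Local Notation cx := (@pcst F 'I_4).
Local Notation cb := (@pcst F bl_coord).
Local Notation Psi := (Psi A).
Local Notation Phi := (Phi A).
Local Notation lform := (lform A).
Local Notation lb := (lb A).
Local Notation yv := (yv F).
Local Notation ker := (ker A).
Local Notation sec := (sec A).

Lemma evx_hom (S S' : comNzRingType) (g : {rmorphism S -> S'})
    (iota : {rmorphism F -> S}) x f :
  g (evx iota x f) = evx (g \o iota) (map_mx g x) f.
Proof. by rewrite /evx ev_hom; apply: eq_ev => // j /=; rewrite mxE. Qed.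

Lemma eq_evx (S : comNzRingType) (i1 i2 : {rmorphism F -> S}) x1 x2 (f : Mx) :
  i1 =1 i2 -> x1 = x2 -> evx i1 x1 f = evx i2 x2 f.
Proof. by move=> e ->; exact: eq_ev. Qed.

Lemma PsiM P Q : Psi (P * Q) = Psi P * Psi Q. Proof. exact: rmorphM. Qed.
Lemma PsiXn P n : Psi (P ^+ n) = Psi P ^+ n. Proof. exact: rmorphXn. Qed.

Section Polarization.
Local Notation RQ := (('I_2 + 'I_2)%type : finType).
Local Notation Mrq := (mpolyT F RQ).
Local Notation cq := (@pcst F RQ).

Let rvec : 'rV[Mrq]_2 := \row_a var F (inl a : RQ).
Let qvec : 'rV[Mrq]_2 := \row_a var F (inr a : RQ).
Let zvec i : 'rV[Mrq]_4 := rvec *m map_mx cq (ker i) + qvec *m map_mx cq (sec i).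
Let wq (t : RQ) : nat := if t is inr _ then 1%N else 0%N.

Lemma adapted_form i d f : isform d f -> whom (fun=> 1%N) d (evx cq (zvec i) f).
Proof.
have lin (v : 'rV[Mrq]_2) (M : 'M[F]_(2, 4)) j :
    (forall a, whom (fun=> 1%N) 1 (v ord0 a)) ->
    whom (fun=> 1%N) 1 (\sum_a v ord0 a * map_mx cq M a j).
  move=> hv; elim/big_ind: _ => [|p q|a _]; [exact: whom0|exact: whomD|].
  by rewrite mxE; apply: (@whomM _ _ _ 1 0); [exact: hv|exact: whom_cst].
have hz j : whom (fun=> 1%N) 1 (zvec i ord0 j).
  rewrite !mxE; apply: whomD; apply: lin => a; rewrite mxE.
    exact: (@whom_var F RQ (fun=> 1%N)).
  exact: (@whom_var F RQ (fun=> 1%N)).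
move=> hf; exact: (@whom_ev F 'I_4 RQ (zvec i ord0) (fun=> 1%N) (fun=> 1%N) d f hz hf).
Qed.

(** In coordinates adapted to the line, the degree in the equations of the line
    is the order along the family defining [Phi i]. *)
Lemma adapted_grading i f : grading wq (evx cq (zvec i) f) =
  evD (polyC \o cq) (map_mx polyC rvec)
    (map_mx polyC qvec *m map_mx (polyC \o cq) (sec i)) 'X (Phi i f).
Proof.
have Ec (M : 'M[F]_(2, 4)) : map_mx (grading wq) (map_mx cq M) = map_mx (polyC \o cq) M.
  by apply/matrixP => u v; rewrite !mxE /grading ev_cst.
have Er : map_mx (grading wq) rvec = map_mx polyC rvec.
  by apply/rowP => a; rewrite !mxE /grading ev_var expr0 mulr1.
have Eq : map_mx (grading wq) qvec = 'X *: map_mx polyC qvec.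
  by apply/rowP => a; rewrite !mxE /grading ev_var mulrC.
rewrite evD_Phi; apply: (etrans (evx_hom (grading wq : {rmorphism _ -> _}) cq (zvec i) f)).
apply: eq_evx => [c|]; first by rewrite /= /grading ev_cst.
by rewrite /zvec /xpt map_mxD (map_mxM _ rvec) (map_mxM _ qvec) /= !Ec Er Eq scalemxAl.
Qed.

Lemma adapted_back i f :
  ev cx (fun t => match t with inl a => lform (mate i) a | inr a => lform i a end)
    (evx cq (zvec i) f) = f.
Proof.
set h := fun t => _.
have Ec (M : 'M[F]_(2, 4)) : map_mx (ev cx h) (map_mx cq M) = map_mx cx M.
  by apply/matrixP => u v; rewrite !mxE ev_cst.
have Er : map_mx (ev cx h) rvec = xvars F *m map_mx cx (A (mate i)).
  by apply/rowP => a; rewrite !mxE ev_var /h /lform !mxE.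
have Eq : map_mx (ev cx h) qvec = xvars F *m map_mx cx (A i).
  by apply/rowP => a; rewrite !mxE ev_var /h /lform !mxE.
apply: (etrans (evx_hom (ev cx h : {rmorphism _ -> _}) cq (zvec i) f)).
transitivity (evx cx (xvars F) f); last first.
  rewrite /evx -[RHS]ev_var_id; apply: eq_ev => // j; exact: mxE.
apply: eq_evx => [c|]; first by rewrite /= ev_cst.
rewrite /zvec map_mxD (map_mxM _ rvec) (map_mxM _ qvec) /= !Ec Er Eq.
rewrite -!mulmxA -!map_mxM -mulmxDr -map_mxD.
by rewrite addrC (decomposition dl) map_mx1 mulmx1.
Qed.

(** Each monomial of [f] in adapted coordinates contains at least [m] of the
    equations of the line; replace [m] of them by the coordinates on the
    [i]-th projective line. *)
Lemma polarization i d m f : isform d f -> divides ('X^m) (Phi i f) ->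
  exists P, mhomog bl_block (fun j => deg0 (d - m) j + deg1 m i j)%N P /\ Psi P = f.
Proof.
move=> hf [H HE]; set g := evx cq (zvec i) f.
have hg : whom (fun=> 1%N) d g by exact: adapted_form.
pose nr (mon : 'X_{1..#|RQ|}) a := mon (enum_rank (inl a : RQ)).
pose nq (mon : 'X_{1..#|RQ|}) a := mon (enum_rank (inr a : RQ)).
have gm mon : mon \in msupp g -> (m <= nq mon ord0 + nq mon ord_max)%N.
  move=> mg; have -> : (nq mon ord0 + nq mon ord_max)%N = wdeg wq mon.
    rewrite /wdeg (big_enum_valT _ (fun t k => mon k * wq t)%N) big_sumType /=.
    rewrite big1 ?add0n; last by move=> a _; rewrite muln0.
    by rewrite !big_ord_recl big_ord0 /= !muln1 addn0; congr (_ + mon (enum_rank (inr _)))%N;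
      exact: val_inj.
  rewrite leqNgt; apply/negP => lt; move: mg; rewrite mcoeff_msupp => /negP; apply.
  have := grading_coef wq g (wdeg wq mon) mon; rewrite eqxx mulr1n => <-.
  by rewrite /g adapted_grading HE rmorphM rmorphXn /= evDX coefMXn lt mcoeff0.
have gd mon : mon \in msupp g ->
    (nr mon ord0 + nr mon ord_max + (nq mon ord0 + nq mon ord_max) = d)%N.
  move=> /hg <-; rewrite /wdeg (big_enum_valT _ (fun t k => mon k * 1)%N) big_sumType /=.
  rewrite !big_ord_recl !big_ord0 /= !muln1 !addn0.
  by congr (_ + mon (enum_rank (inl _)) + (_ + mon (enum_rank (inr _))))%N; exact: val_inj.
(* A monomial has degree at least [m] in the two equations of the line; [p0] and
   [p1] of them are replaced, as many as possible of the first kind. *)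
pose p0 mon := minn (nq mon ord0) m; pose p1 mon := (m - p0 mon)%N.
pose Z mon := lb (mate i) ord0 ^+ nr mon ord0 * lb (mate i) ord_max ^+ nr mon ord_max *
  (yv i ord0 ^+ p0 mon * lb i ord0 ^+ (nq mon ord0 - p0 mon)) *
  (yv i ord_max ^+ p1 mon * lb i ord_max ^+ (nq mon ord_max - p1 mon)).
exists (\sum_(mon <- msupp g) cb g@_mon * Z mon); split.
  rewrite big_seq; apply: mhomog_sum => mon mg; apply: mhomogZ.
  have hl k a n := mhomogX (n := n) (@mhomog_lb F A k a).
  have hy k a n := mhomogX (n := n) (@mhomog_yv F k a).
  apply: eq_mhomog _ (mhomogM (mhomogM (mhomogM (hl (mate i) ord0 (nr mon ord0))
    (hl (mate i) ord_max (nr mon ord_max)))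
    (mhomogM (hy i ord0 (p0 mon)) (hl i ord0 (nq mon ord0 - p0 mon)%N)))
    (mhomogM (hy i ord_max (p1 mon)) (hl i ord_max (nq mon ord_max - p1 mon)%N))).
  have := gm mon mg; have := gd mon mg; rewrite /p1 /p0.
  move: (nr mon ord0) (nr mon ord_max) (nq mon ord0) (nq mon ord_max) => a b c e E1 E2.
  move=> [k|] /=; rewrite /deg1 /=; last by lia.
  by case: eqP => _; lia.
rewrite rmorph_sum -[RHS](adapted_back i) -/g /ev /mmap.
apply: eq_big_seq => mon mg; rewrite /= PsiM Psi_cst; congr (_ * _).
rewrite /mmap1 (big_enum_valT _ (fun t k =>
  match t with inl a => lform (mate i) a | inr a => lform i a end ^+ mon k)).
have E := gm mon mg; have o1 : lift ord0 ord0 = ord_max :> 'I_2 by exact: val_inj.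
have PZ : Psi (Z mon) = lform (mate i) ord0 ^+ nr mon ord0 *
    lform (mate i) ord_max ^+ nr mon ord_max *
    (lform i ord0 ^+ p0 mon * lform i ord0 ^+ (nq mon ord0 - p0 mon)) *
    (lform i ord_max ^+ p1 mon * lform i ord_max ^+ (nq mon ord_max - p1 mon)).
  by rewrite /Z !PsiM !PsiXn !Psi_lb !Psi_yv.
have E0 : lform i ord0 ^+ p0 mon * lform i ord0 ^+ (nq mon ord0 - p0 mon) =
    lform i ord0 ^+ nq mon ord0.
  by rewrite -exprD subnKC // geq_minl.
have E1 : lform i ord_max ^+ p1 mon * lform i ord_max ^+ (nq mon ord_max - p1 mon) =
    lform i ord_max ^+ nq mon ord_max.
  rewrite -exprD subnKC // /p1 /p0.
  by move: (nq mon ord0) (nq mon ord_max) E => a b; lia.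
rewrite PZ E0 E1 big_sumType /=.
rewrite (big_ord_recl 1) (big_ord_recl 0) big_ord0.
rewrite (big_ord_recl 1) (big_ord_recl 0) big_ord0 !o1.
by rewrite !mulr1 mulrA.
Qed.

End Polarization.

End Orders.

(** * Orders along prime divisors *)

Section Orders.
Variables (F : numClosedFieldType) (A : 'I_4 -> 'M[F]_(4, 2)).
Hypothesis dl : forall i j, i != j -> (row_mx (A i) (A j) : 'M_4) \in unitmx.

Local Notation Mbl := (mpolyT F bl_coord).
Local Notation X := (blowup A).
Local Notation cx := (@pcst F 'I_4).
Local Notation cb := (@pcst F bl_coord).
Local Notation Psi := (Psi A).
Local Notation theta := (theta A).
Local Notation lform := (lform A).
Local Notation lb := (lb A).
Local Notation yv := (yv F).
Local Notation ker := (ker A).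
Local Notation sec := (sec A).
Local Notation exc := (exc A).

Lemma ker_unit i j : j != i -> ker i *m A j \in unitmx.
Proof.
move=> ji; rewrite -row_free_unit -kermx_eq0; apply/rowV0P => v /sub_kermxP vN.
apply/eqP; apply: contraT => v0; have := ker_other dl ji v0.
by rewrite -mulmxA vN eqxx.
Qed.

Lemma lb_exc i a : vanishing_ideal (exc i) (lb i a).
Proof. by move=> p [_ pi]; rewrite peval_lb pi mxE. Qed.

Lemma mhomog_subst i d f (z : 'rV[Mbl]_4) :
  (forall j, mhomog bl_block (fun k => deg0 1 k + deg1 1 i k)%N (z ord0 j)) ->
  isform d f -> mhomog bl_block (fun k => deg0 d k + deg1 d i k)%N (evx cb z f).
Proof.
move=> hz hf; apply/mhomogE => k; have H j := (mhomogE _ _ _).1 (hz j) k.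
have [e1|e0] : (deg0 1 k + deg1 1 i k = 1 /\ deg0 d k + deg1 d i k = d \/
    deg0 1 k + deg1 1 i k = 0 /\ deg0 d k + deg1 d i k = 0)%N.
- case: k {H} => [k|]; rewrite /deg1 /=; last by left; lia.
  by case: eqP => _; [left|right].
- case: e1 => e1 ->; apply: (whom_ev _ hf) => j; have := H j; rewrite e1; exact.
- case: e0 => e0 ->; apply: (whom_ev (w := fun=> 0%N) _ (@whom_weight0 _ _ f)) => j.
  have := H j; rewrite e0; exact.
Qed.

(** Comparison of the multidegrees of both sides in [exc_order]. *)
Lemma deg_count i (e : option 'I_4 -> nat) n j :
  let d := (\sum_j e j)%N in let k := e (Some i) in (k + n <= d)%N ->
  ((\sum_(l | l != i) e (Some l) * deg1 1 l j) + k * deg1 1 i j +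
   (deg0 d j + deg1 d i j - (k + n) * deg0 1 j) + n * deg0 1 j =
  (\sum_(l | l != i) e (Some l) * deg0 1 j) + d * deg1 1 i j + e j)%N.
Proof.
move=> d k; have dE : d = (e None + (k + \sum_(j | j != i) e (Some j)))%N.
  by rewrite /d big_option /=; congr (_ + _)%N; rewrite (bigD1 i).
case: j => [j|] knd; rewrite /deg1 /=.
  rewrite !muln0 !addn0 subn0 [in RHS]big1 ?add0n; last by move=> l _; rewrite muln0.
  have [->|ji] := eqVneq j i.
    rewrite eqxx !muln1 big1 ?add0n; last first.
      by move=> l li; have [[E]|] := eqVneq (Some i) (Some l); rewrite ?muln0 //;
        rewrite E eqxx in li.
    by rewrite addnC.
  have -> : (Some j == Some i) = false by apply: contraNF ji => /eqP[->].
  rewrite !muln0 !addn0 add0n (bigD1 j) //= eqxx muln1 big1 ?addn0 // => l /andP[_ lj].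
  by have [[E]|] := eqVneq (Some j) (Some l); rewrite ?muln0 //; rewrite E eqxx in lj.
have -> : (\sum_(l < 4 | l != i) e (Some l) * 0 = 0)%N by apply: big1 => l _; rewrite muln0.
under eq_bigr do rewrite muln1.
by move: knd; rewrite dE; move: (\sum_(j | j != i) e (Some j))%N => s; lia.
Qed.

(** Evaluating the family at a point of the blow-up itself, with [lb i ord0] as
    the parameter, turns divisibility by ['X^n] into divisibility by a power of
    [lform i ord0]. *)
Lemma exc_chart i e n P : mhomog bl_block e P -> divides ('X^n) (theta i P) ->
  let d := (\sum_j e j)%N in let k := e (Some i) in
  exists T, lform i ord0 ^+ (k + n) * Psi T = lform i ord0 ^+ d * Psi P /\
    (T != 0 -> mhomog bl_block (fun j => (deg0 d j + deg1 d i j) - (k + n) * deg0 1 j)%N T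
    /\ (k + n <= d)%N).
Proof.
move=> he [H HE] d k.
have hf : isform d (Psi P) by exact: homog_Psi.
pose yr : 'rV[Mbl]_2 := \row_a yv i a.
(* The point [z] is [yv i ord0] times the base point, written with
   [lb i ord0] as the parameter of the family. *)
pose z := xpt A cb i (yv i ord0 *: (xb F *m map_mx cb (A (mate i))))
  (yr *m map_mx cb (sec i)) (lb i ord0).
pose T := evD cb (yv i ord0 *: (xb F *m map_mx cb (A (mate i))))
  (yr *m map_mx cb (sec i)) (lb i ord0) H.
have TE : lb i ord0 ^+ (k + n) * T = evx cb z (Psi P).
  rewrite -evD_Phi (Phi_Psi dl i he) HE !rmorphM !rmorphXn /= !evDX -/T exprD.
  by rewrite -!mulrA [T * _]mulrC.
have Ec (p q : nat) (M : 'M[F]_(p, q)) : map_mx Psi (map_mx cb M) = map_mx cx M.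
  by apply/matrixP => u v; rewrite !mxE Psi_cst.
have Exb : map_mx Psi (xb F) = xvars F.
  by apply/rowP => j; rewrite !mxE /Psi ev_var /gpt /= mxE.
have Eyr : map_mx Psi yr = xvars F *m map_mx cx (A i).
  by apply/rowP => a; rewrite !mxE Psi_yv /lform !mxE.
have Ez : map_mx Psi z = lform i ord0 *: xvars F.
  have E1 : map_mx Psi (yv i ord0 *: (xb F *m map_mx cb (A (mate i))) *m map_mx cb (ker i)) =
      lform i ord0 *: (xvars F *m map_mx cx (A (mate i)) *m map_mx cx (ker i)).
    by rewrite map_mxM map_mxZ (map_mxM _ (xb F)) /= !Ec Exb Psi_yv -scalemxAl.
  have E2 : map_mx Psi (lb i ord0 *: (yr *m map_mx cb (sec i))) =
      lform i ord0 *: (xvars F *m map_mx cx (A i) *m map_mx cx (sec i)).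
    by rewrite scalemxAl map_mxM map_mxZ /= !Ec Eyr Psi_lb -scalemxAl.
  rewrite /z /xpt map_mxD E1 E2 -scalerDr -!mulmxA -!map_mxM -mulmxDr -map_mxD.
  by rewrite addrC (decomposition dl) map_mx1 mulmx1.
have PsiT : lform i ord0 ^+ (k + n) * Psi T = lform i ord0 ^+ d * Psi P.
  transitivity (Psi (lb i ord0 ^+ (k + n) * T)); first by rewrite PsiM PsiXn Psi_lb.
  rewrite TE; apply: (etrans (evx_hom (Psi : {rmorphism _ -> _}) cb z (Psi P))).
  transitivity (evx cx (lform i ord0 *: xvars F) (Psi P)).
    by apply: eq_evx => // c; exact: Psi_cst.
  rewrite -[X in _ = _ * X]ev_var_id -(ev_scale_weight (w := fun=> 1%N) _ _ _ hf).
  by apply: eq_ev => // j; rewrite !mxE expr1.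
have hz j : mhomog bl_block (fun k => deg0 1 k + deg1 1 i k)%N (z ord0 j).
  have hlin (v : 'I_2 -> Mbl) (M : 'M[F]_(2, 4)) :
      (forall a, mhomog bl_block (fun k => deg0 1 k + deg1 1 i k)%N (v a)) ->
      mhomog bl_block (fun k => deg0 1 k + deg1 1 i k)%N (\sum_a v a * map_mx cb M a j).
    by move=> hv; apply: mhomog_sum => a _; rewrite mxE mulrC; exact: mhomogZ.
  rewrite /z /xpt [_ *: (yr *m _)]scalemxAl mxE; apply: mhomogD; rewrite mxE; apply: hlin => a.
    rewrite mxE mulrC; apply: mhomogM; [exact: mhomog_lb|exact: mhomog_yv].
  rewrite !mxE; apply: mhomogM; [exact: mhomog_lb|exact: mhomog_yv].
have hTE := mhomog_subst hz hf; rewrite -TE in hTE.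
have hl n' := mhomogX (n := n') (@mhomog_lb F A i ord0).
have hT : T != 0 -> mhomog bl_block (fun j => (deg0 d j + deg1 d i j) - (k + n) * deg0 1 j)%N T
    /\ (k + n <= d)%N.
  move=> T0; have l0 : lb i ord0 != 0.
    by apply: contra_neq (lform_neq0 dl i ord0); rewrite -(Psi_lb A) => ->; exact: rmorph0.
  have N0 : lb i ord0 ^+ (k + n) * T != 0 by exact: mulf_neq0 (expf_neq0 _ l0) T0.
  have Q j := whom_quot N0 ((mhomogE _ _ _).1 hTE j) ((mhomogE _ _ _).1 (hl (k + n)%N) j).
  split; last by have [_] := Q None; rewrite /deg1 /= muln1 addn0.
  by apply/mhomogE => j; have [] := Q j.
exact: (ex_intro _ T (conj PsiT hT)).
Qed.

Lemma sec_unit i : row ord0 (sec i) *m A i = row ord0 1%:M.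
Proof. by rewrite -row_mul sec_lines. Qed.

Lemma unit_row_neq0 : row ord0 1%:M != 0 :> 'rV[F]_2.
Proof. by apply/rv_neq0; exists ord0; rewrite !mxE eqxx oner_neq0. Qed.

Lemma lb_not_exc i j : j != i -> ~ vanishing_ideal (exc i) (lb j ord0).
Proof.
move=> ji H; pose u : 'rV[F]_2 := row ord0 (invmx (ker i *m A j)).
have uE : u *m ker i *m A j = row ord0 1%:M.
  by rewrite -mulmxA -row_mul (mulVmx (ker_unit ji)).
have u0 : u != 0.
  by apply: contra_neq unit_row_neq0 => u0; rewrite -uE u0 !mul0mx.
have wi : row ord0 (sec i) *m A i != 0 by rewrite sec_unit unit_row_neq0.
have := H _ (ept_exc dl u0 wi); rewrite peval_lb /ept /tpt base_ptE xpt_id scale0r addr0 uE.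
by rewrite !mxE eqxx => /eqP; rewrite oner_eq0.
Qed.

Lemma yv_not_exc i : ~ vanishing_ideal (exc i) (yv i ord0).
Proof.
move=> H; have wi : row ord0 (sec i) *m A i != 0 by rewrite sec_unit unit_row_neq0.
have := H _ (ept_exc dl unit_row_neq0 wi); rewrite peval_yv /ept /tpt fiber_ptE eqxx.
by rewrite map_mx_idfun sec_unit !mxE eqxx => /eqP; rewrite oner_eq0.
Qed.

Lemma clearing_not_exc i (a : 'I_4 -> nat) d :
  ~ vanishing_ideal (exc i) ((\prod_(j | j != i) lb j ord0 ^+ a j) * yv i ord0 ^+ d).
Proof.
have Px := prime_X (mpolyT F (('I_2 + 'I_4)%type : finType)).
have [_ _ h] := Px; move/(exc_divides dl); rewrite rmorphM rmorph_prod rmorphXn => /h[].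
  move/(prime_dvd_prod Px) => [j [_ ji]]; rewrite rmorphXn => /(prime_dvdX Px).
  by move/(exc_vanishes dl (@mhomog_lb F A j ord0)); exact: lb_not_exc.
by move/(prime_dvdX Px)/(exc_vanishes dl (@mhomog_yv F i ord0)); exact: yv_not_exc.
Qed.

(** By [exc_chart] a multiple of [P] agrees on the graph with a multiple of
    [lb i ord0 ^+ n], and [lb i ord0] vanishes on the exceptional divisor. *)
Lemma exc_order i e n P : mhomog bl_block e P -> divides ('X^n) (theta i P) ->
  vanishes_to_order bl_block X (exc i) n P.
Proof.
move=> he hX; set d := (\sum_j e j)%N; set k := e (Some i).
have [T [PsiT hT]] := exc_chart he hX.
pose G := (\prod_(j | j != i) lb j ord0 ^+ e (Some j)) * yv i ord0 ^+ d.
pose Y := (\prod_(j | j != i) yv j ord0 ^+ e (Some j)) * yv i ord0 ^+ k.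
have hY0 := @mhomog_prod F _ _ bl_block _ (index_enum 'I_4) (fun j => j != i) _ _
  (fun j _ => mhomogX (n := e (Some j)) (@mhomog_yv F j ord0)).
have hG0 := @mhomog_prod F _ _ bl_block _ (index_enum 'I_4) (fun j => j != i) _ _
  (fun j _ => mhomogX (n := e (Some j)) (@mhomog_lb F A j ord0)).
have hy n' := mhomogX (n := n') (@mhomog_yv F i ord0).
have hl n' := mhomogX (n := n') (@mhomog_lb F A i ord0).
have hG := mhomogM hG0 (hy d).
exists G, (Y * T * lb i ord0 ^+ n); split.
- by eexists; exact: hG.
- exact: clearing_not_exc.
- by apply: ideal_pow_exp; exact: lb_exc.
have [T0|T0] := eqVneq T 0.
  rewrite T0 mulr0 mul0r subr0; apply: (Psi0_vanishes (mhomogM hG he)).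
  move: PsiT; rewrite T0 rmorph0 mulr0 => /esym/eqP.
  rewrite mulf_eq0 expf_eq0 (negbTE (lform_neq0 dl i ord0)) andbF /= => /eqP P0.
  by rewrite PsiM P0 mulr0.
have [hT1 knd] := hT T0.
apply: (@Psi0_vanishes _ A _ _ (mhomogB (mhomogM hG he) _)); last first.
  have EGY : Psi (\prod_(j | j != i) lb j ord0 ^+ e (Some j)) =
            Psi (\prod_(j | j != i) yv j ord0 ^+ e (Some j)).
    by rewrite !rmorph_prod; apply: eq_bigr => j _; rewrite !rmorphXn /= Psi_lb Psi_yv.
  rewrite rmorphB /= /G /Y !PsiM !PsiXn Psi_yv Psi_lb EGY.
  move: PsiT; rewrite exprD -/d -/k.
  move: (Psi (\prod_(_ | _) _)) (Psi T) (Psi P) (lform i ord0) => a b c l E.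
  by apply/eqP; rewrite subr_eq0 -[a * _ * c]mulrA -E; apply/eqP; ring.
apply: eq_mhomog _ (mhomogM (mhomogM (mhomogM hY0 (hy k)) hT1) (hl n)) => j.
exact: deg_count.
Qed.

End Orders.

Section DivisorsOfPolynomials.
Variables (F : numClosedFieldType) (A : 'I_4 -> 'M[F]_(4, 2)).
Hypothesis dl : forall i j, i != j -> (row_mx (A i) (A j) : 'M_4) \in unitmx.

Local Notation Mx := (mpolyT F 'I_4).
Local Notation X := (blowup A).
Local Notation Psi := (Psi A).
Local Notation Phi := (Phi A).
Local Notation theta := (theta A).
Local Notation exc := (exc A).
Local Notation strict := (strict A).

Lemma strict_order f d e n P : prime_elt f -> isform d f ->
  mhomog bl_block e P -> divides (f ^+ n) (Psi P) ->
  vanishes_to_order bl_block X (strict f) n P.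
Proof.
move=> Pf hf he [h hE]; have [col hcol] := prime_columns dl Pf.
have [hG _ EGY /(_ _ erefl) H] := clear_fibers A col he.
set G := \prod_i _ in hG EGY H; set Y := \prod_i _ in EGY H.
exists G, (Y * pullx h * pullx f ^+ n); split=> //.
- move/(strict_divides dl Pf); rewrite rmorph_prod => /(prime_dvd_prod Pf)[i [_ _]].
  by rewrite rmorphXn /= Psi_lb => /(prime_dvdX Pf); exact: hcol.
- apply: ideal_pow_exp; apply: (strict_vanishes (mhomog_pullx hf)).
  by rewrite Psi_pullx; exact: divides_refl.
have -> : Y * pullx h * pullx f ^+ n = Y * pullx (Psi P); last by [].
by rewrite hE rmorphM rmorphXn mulrA.
Qed.

(** ** Multiplicity of a surface along a line *)

(** The multiplicity is the generic order of [f] along lines through a general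
    point of the [i]-th line. *)
Definition mult i (f : Mx) : nat := xget 0%N [set m | has_ord 'X m (Phi i f)].

Lemma Phi_neq0 i f : f != 0 -> Phi i f != 0.
Proof. by apply: contra_neq; exact: Phi_inj. Qed.

Lemma multP i f : f != 0 -> has_ord 'X (mult i f) (Phi i f).
Proof.
move=> f0; have [m hm] := X_has_ord (Phi_neq0 i f0).
by rewrite /mult; case: xgetP => [k -> //|/(_ m)].
Qed.

Lemma mult_eq i f m : has_ord 'X m (Phi i f) -> mult i f = m.
Proof.
move=> hm; rewrite /mult; case: xgetP => [k -> hk|/(_ m)//].
exact: has_ord_unique hk hm.
Qed.

Lemma multM i f g : f != 0 -> g != 0 -> mult i (f * g) = (mult i f + mult i g)%N.
Proof.
move=> f0 g0; apply: mult_eq; rewrite rmorphM.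
by apply: has_ordM; [exact: prime_X|exact: multP|exact: multP].
Qed.

Lemma mult_unit i f : f \is a GRing.unit -> mult i f = 0%N.
Proof.
move=> uf; apply: mult_eq; apply: (has_ord0 (prime_X _)) => /divides_unit h.
by have [_ /negP[]] := prime_X (mpolyT F (('I_2 + 'I_4)%type : finType)); apply: h; rewrite rmorph_unit.
Qed.

Lemma theta_has_ord i e P : mhomog bl_block e P -> Psi P != 0 ->
  exists2 n, has_ord 'X n (theta i P) & mult i (Psi P) = (e (Some i) + n)%N.
Proof.
move=> he P0; have E := Phi_Psi dl i he.
have t0 : theta i P != 0.
  by apply: contra_neq (Phi_neq0 i P0) => t0; rewrite E t0 mulr0.
have [n hn] := X_has_ord t0; exists n => //; apply: mult_eq; rewrite E.
apply: (has_ordM (prime_X _) _ hn); apply/(has_ordP (prime_X _)); exists 1.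
  by rewrite mul1r.
have Px := prime_X (mpolyT F (('I_2 + 'I_4)%type : finType)).
by move/(prime_nunit Px); rewrite unitr1.
Qed.

(** ** The prime divisors of the blow-up *)

Definition prime_form (f : Mx) := prime_elt f /\ exists d, isform d f.

(** The lift of [f] with its full multiplicity contains the strict transform
    but not the exceptional divisor. *)
Lemma exc_not_strict i f : prime_form f -> ~ exc i `<=` strict f.
Proof.
move=> [Pf [d hf]] H; have f0 := pi_neq0 Pf; have [hm nm] := multP i f0.
have [P [hP PE]] := polarization dl hf hm.
have : divides 'X (theta i P).
  apply: (exc_divides dl) => p /H; apply: (strict_vanishes hP).
  by rewrite PE; exact: divides_refl.
move=> [c cE]; apply: nm; have := Phi_Psi dl i hP; rewrite PE /deg1 /= eqxx add0n => ->.
by exists c; rewrite cE exprSr mulrCA.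
Qed.

Lemma strict_ideal f d : prime_elt f -> isform d f -> vanishing_ideal (strict f) (pullx f).
Proof.
move=> Pf hf; apply: (strict_vanishes (mhomog_pullx hf)).
by rewrite Psi_pullx; exact: divides_refl.
Qed.

Lemma on_strict V : subvariety bl_block V -> V `<` X -> (forall i, ~ V `<=` exc i) ->
  exists2 f, prime_form f & V `<=` strict f.
Proof.
move=> sV VX nV; have [f [d [Pf hf Vf]]] := on_prime_surface sV VX.
exists f; first by split=> //; exists d.
by apply: strict_sup => //; case: VX.
Qed.

Lemma strict_sub_divides f g : prime_form f -> prime_form g ->
  strict f `<=` strict g -> divides f g.
Proof.
move=> [Pf _] [Pg [d hg]] H; rewrite -[g](Psi_pullx A); apply: (strict_divides dl Pf).
by move=> p /H; exact: strict_ideal hg p.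
Qed.

Lemma strict_assoc f g : divides f g -> divides g f -> strict f = strict g.
Proof.
suff H a c : divides a c -> strict a `<=` strict c.
  by move=> h1 h2; apply/seteqP; split; exact: H.
move=> [k kE] p Hp Z cZ cZ'; apply: Hp => // q [gq aq]; apply: cZ'; split=> //.
by rewrite kE evfM aq mulr0.
Qed.

Lemma prime_strict f : prime_form f -> prime_divisor bl_block X (strict f).
Proof.
move=> Pf; have [Pf1 [d hf]] := Pf; split.
- exact: strict_subvariety.
- exact: strict_proper hf.
move=> W sW [fW nW] WX; have nE i : ~ W `<=` exc i.
  by move=> WE; apply: (strict_not_exc dl (i := i) Pf1) => p /fW /WE.
have [g Pg Wg] := on_strict sW WX nE; have [Pg1 _] := Pg.
have fg : divides f g by apply: strict_sub_divides => // p /fW/Wg.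
have gf := prime_divides_assoc Pf1 Pg1 fg.
by apply: nW => p /Wg; rewrite (strict_assoc fg gf).
Qed.

Lemma prime_exc i : prime_divisor bl_block X (exc i).
Proof.
split; [exact: exc_subvariety|exact: exc_proper|move=> W sW [iW nW] WX].
have nE j : ~ W `<=` exc j.
  move=> WE; have [p Ep] := exc_nonempty dl i.
  have ij := exc_disjoint dl Ep (WE _ (iW _ Ep)); apply: nW; rewrite ij; exact: WE.
have [g Pg Wg] := on_strict sW WX nE.
by apply: (exc_not_strict (i := i) Pg) => p /iW /Wg.
Qed.

(** A divisor that is not exceptional is contained in, hence equal to, the
    strict transform of a prime surface. *)
Theorem prime_divisorP V : prime_divisor bl_block X V ->
  (exists i, V = exc i) \/ (exists2 f, prime_form f & V = strict f).
Proof.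
move=> [sV VX maxV].
have [[i VE]|/forallNP nE] := pselect (exists i, V `<=` exc i).
  left; exists i; apply/seteqP; split=> //; apply: contrapT => nV.
  by apply: (maxV (exc i)); [exact: exc_subvariety|split|exact: exc_proper].
have [f Pf Vf] := on_strict sV VX nE; right; exists f => //.
have [Pf1 [d hf]] := Pf; apply/seteqP; split=> //; apply: contrapT => nV.
by apply: (maxV (strict f)); [exact: strict_subvariety|split|exact: strict_proper hf].
Qed.

Lemma exc_neq_strict i f : prime_form f -> exc i <> strict f.
Proof. by move=> Pf E; apply: (exc_not_strict (i := i) Pf); rewrite E. Qed.

Lemma exc_inj i j : exc i = exc j -> i = j.
Proof.
move=> E; have [p Ep] := exc_nonempty dl i; apply: (exc_disjoint dl Ep).
by rewrite -E.
Qed.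

(** ** Orders of vanishing *)

Lemma divisor_strict f e n P : prime_form f -> mhomog bl_block e P ->
  has_ord f n (Psi P) -> divisor_of bl_block X P (strict f) = n.
Proof.
move=> Pf he hn; have [Pf1 [d hf]] := Pf; rewrite /divisor_of asboolT; last exact: prime_strict.
apply: (@ord_valuation _ _ _ _ _ _ _ f Psi e P n) => //.
- exact: vanishes_Psi0.
- by move=> Q; exact: strict_divides.
- by move=> e' G he'; exact: strict_vanishes he'.
- exact: strict_order hf he.
Qed.

Lemma divisor_exc i e P : mhomog bl_block e P -> Psi P != 0 ->
  mult i (Psi P) = (e (Some i) + divisor_of bl_block X P (exc i))%N.
Proof.
move=> he P0; have [n hn ->] := theta_has_ord i he P0; congr (_ + _)%N.
rewrite /divisor_of asboolT; last exact: prime_exc.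
have O := @ord_valuation F bl_coord (option 'I_4) bl_block X (exc i)
  {poly mpolyT F (('I_2 + 'I_4)%type : finType)} 'X (theta i) e P n (prime_X _).
have O1 := O (fun Q => @theta_vanishes F A dl i Q).
have O2 := O1 (fun Q => @exc_divides F A dl i Q).
have O3 := O2 (fun e' G he' => @exc_vanishes F A dl i e' G he').
have O4 := O3 (@exc_order F A dl i e n P he).
exact: (esym (O4 hn)).
Qed.

End DivisorsOfPolynomials.

(** * Pairing divisors with curves *)

Section Pairing.
Variables (F : fieldType) (T : finType) (c : set (T -> F) -> int).
Local Notation sets := (set (T -> F)).

Definition finsupp (S : idomainType) (D : sets -> S) := finite_set [set V | D V <> 0].

(** Finiteness of the support has to be carried along, because [pairing] is a
    sum over all prime divisors. *)
Definition paired (S : idomainType) (D : sets -> S) (x : S) :=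
  finsupp D /\ pairing c D = x.

Lemma pairing_on (S : idomainType) (B : set sets) (D : sets -> S) :
  (forall V, D V <> 0 -> B V) -> pairing c D = \sum_(V \in B) D V * (c V)%:~R.
Proof.
move=> H; apply/esym/fsbig_widen => // V [_ nB] /=.
have -> : D V = 0 by apply: contrapT => /H.
by rewrite mul0r.
Qed.

Lemma pairedD (S : idomainType) (D D' : sets -> S) x x' :
  paired D x -> paired D' x' -> paired (fun V => D V + D' V) (x + x').
Proof.
move=> [fD <-] [fD' <-].
have fB : finite_set ([set V | D V <> 0] `|` [set V | D' V <> 0]) by rewrite finite_setU.
split.
  apply: sub_finite_set fB => V /= h; apply: contrapT => /not_orP[/contrapT h1 /contrapT h2].
  by apply: h; rewrite h1 h2 addr0.
rewrite !(pairing_on (B := [set V | D V <> 0] `|` [set V | D' V <> 0])).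
- by rewrite -fsbig_split //; apply: eq_fsbigr => V _; rewrite mulrDl.
- by move=> V h; right.
- by move=> V h; left.
- move=> V /= h; apply: contrapT => /not_orP[/contrapT h1 /contrapT h2].
  by apply: h; rewrite h1 h2 addr0.
Qed.

Lemma pairedZ (S : idomainType) a (D : sets -> S) x :
  paired D x -> paired (fun V => a * D V) (a * x).
Proof.
move=> [fD <-]; split.
  by apply: sub_finite_set fD => V /= h h'; apply: h; rewrite h' mulr0.
by rewrite /pairing mulr_fsumr; apply: eq_fsbigr => V _; rewrite mulrA.
Qed.

Lemma paired0 (S : idomainType) : paired (fun=> 0 : S) 0.
Proof.
split; first by apply: sub_finite_set (finite_set0 _) => V.
by rewrite /pairing fsbig1 // => V _; rewrite mul0r.
Qed.

Lemma eq_paired (S : idomainType) (D D' : sets -> S) x x' :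
  D =1 D' -> x = x' -> paired D x -> paired D' x'.
Proof. by move=> /funext -> ->. Qed.

Lemma paired_sum (S : idomainType) (I : Type) (r : seq I) (D : I -> sets -> S) x :
  (forall i, paired (D i) (x i)) ->
  paired (fun V => \sum_(i <- r) D i V) (\sum_(i <- r) x i).
Proof.
move=> H; elim: r => [|i r IH].
  by apply: eq_paired (paired0 S) => [V|]; rewrite big_nil.
by apply: eq_paired (pairedD (H i) IH) => [V|]; rewrite big_cons.
Qed.

Lemma paired_single (S : idomainType) W (x : S) (D : sets -> S) :
  D W = x -> (forall V, V <> W -> D V = 0) -> paired D (x * (c W)%:~R).
Proof.
move=> <- H; have sub V : D V <> 0 -> V = W by move=> h; apply: contrapT => /H.
split; first by apply: sub_finite_set (finite_set1 W) => V /sub.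
by rewrite (pairing_on sub) fsbig_set1.
Qed.

Lemma paired_intr (S : idomainType) (D : sets -> int) x :
  paired D x -> paired (fun V => (D V)%:~R : S) x%:~R.
Proof.
move=> [fD <-]; split.
  by apply: sub_finite_set fD => V /= h h'; apply: h; rewrite h'.
rewrite !(pairing_on (B := [set V | D V <> 0])) //; last first.
  by move=> V /= h h'; apply: h; rewrite h'.
rewrite !fsbig_finite // rmorph_sum; apply: eq_bigr => V _.
by rewrite rmorphM /= intz.
Qed.

End Pairing.

(** * The class of a divisor *)

Section ClassFunctional.
Variables (F : numClosedFieldType) (A : 'I_4 -> 'M[F]_(4, 2)).
Hypothesis dl : forall i j, i != j -> (row_mx (A i) (A j) : 'M_4) \in unitmx.
Variables (h : int) (eps : 'I_4 -> int).

Local Notation Mx := (mpolyT F 'I_4).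
Local Notation X := (blowup A).
Local Notation Psi := (Psi A).
Local Notation exc := (exc A).
Local Notation strict := (strict A).
Local Notation mult := (mult A).
Local Notation sets := (set (bl_coord -> F)).

(** The value on the strict transform of [f = 0] of the functional with
    values [h] on planes and [eps i] on the exceptional divisors. *)
Definition kap (f : Mx) : int :=
  (msize f).-1%:Z * h - \sum_i (mult i f)%:Z * eps i.

Lemma form_degree d (f : Mx) : f != 0 -> isform d f -> (msize f).-1 = d.
Proof. by move=> f0 hf; rewrite (form_msize f0 hf). Qed.

Lemma kapM f g : f != 0 -> g != 0 -> kap (f * g) = kap f + kap g.
Proof.
move=> f0 g0.
have E : \sum_i (mult i (f * g))%:Z * eps i =
    \sum_i (mult i f)%:Z * eps i + \sum_i (mult i g)%:Z * eps i.
  by rewrite -big_split; apply: eq_bigr => i _; rewrite (multM A i f0 g0) PoszD mulrDl.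
have Em : (msize (f * g)).-1%:Z = (msize f).-1%:Z + (msize g).-1%:Z.
  have Hf : (0 < msize f)%N by rewrite lt0n msize_poly_eq0.
  have Hg : (0 < msize g)%N by rewrite lt0n msize_poly_eq0.
  rewrite (msizeM f0 g0); move: (msize f) (msize g) Hf Hg => m n Hm Hn.
  by rewrite -PoszD; congr Posz; lia.
have linear (m n a b : int) : (m + n) * h - (a + b) = (m * h - a) + (n * h - b) by ring.
exact: (etrans (congr2 (fun x y => x * h - y) Em E) (linear _ _ _ _)).
Qed.

Lemma kap_unit u : u \is a GRing.unit -> kap u = 0.
Proof.
move=> uu; rewrite /kap big1 => [|i _]; last by rewrite mult_unit // mul0r.
have : mpoly_unit u by []; case/andP => /eqP -> _.
by rewrite msizeC; case: eqP; rewrite /= mul0r subr0.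
Qed.

Lemma kap_assoc f g : prime_elt f -> prime_elt g -> divides f g -> kap f = kap g.
Proof.
move=> Pf Pg /(prime_assoc Pf Pg)[u uu ->].
have u0 : u != 0 by apply: contraTneq uu => ->; rewrite unitr0.
by rewrite (kapM u0 (pi_neq0 Pf)) (kap_unit uu) add0r.
Qed.

(** The degree and the multiplicities do not depend on the choice of the form
    that defines a given strict transform. *)
Definition cl (V : sets) : int := \sum_i (`[< V = exc i >] : nat)%:Z * eps i +
  (if pselect (exists f, prime_form f /\ V = strict f) is left ex
   then kap (projT1 (cid ex)) else 0).

Lemma cl_exc i : cl (exc i) = eps i.
Proof.
rewrite /cl (bigD1 i) //= asboolT // mul1r big1 => [|j ji]; last first.
  rewrite asboolF ?mul0r // => /(exc_inj dl) E; by rewrite E eqxx in ji.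
case: pselect => [ex|_]; last by rewrite !addr0.
by have [f [Pf /(exc_neq_strict dl Pf)]] := ex.
Qed.

Lemma cl_strict f : prime_form f -> cl (strict f) = kap f.
Proof.
move=> Pf; rewrite /cl big1 => [|i _]; last first.
  by rewrite asboolF ?mul0r // => /esym/(exc_neq_strict dl Pf).
rewrite add0r; case: pselect => [ex|[]]; last by exists f.
case: cid => g [Pg E] /=; have [Pg1 _] := Pg; have [Pf1 _] := Pf.
apply: kap_assoc => //; apply: (strict_sub_divides dl Pg Pf).
by rewrite E.
Qed.

(** The part of the divisor of a form that consists of strict transforms; it
    is additive in the form. *)
Definition surface_part (g : Mx) (V : sets) : nat :=
  if `[< exists i, V = exc i >] then 0%N else divisor_of bl_block X (pullx g) V.

Lemma surface_part_strict f g d n : prime_form f -> isform d g -> has_ord f n g ->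
  surface_part g (strict f) = n.
Proof.
move=> Pf hg hn; rewrite /surface_part asboolF; last first.
  by move=> [i /esym/(exc_neq_strict dl Pf)].
by apply: (divisor_strict dl Pf (mhomog_pullx hg)); rewrite Psi_pullx.
Qed.

Lemma surface_part_out g V : ~ (exists2 f, prime_form f & V = strict f) ->
  surface_part g V = 0%N.
Proof.
move=> nV; rewrite /surface_part; case: asboolP => // nE.
rewrite /divisor_of; case: asboolP => // /(prime_divisorP dl)[[i VE]|//].
by case: nE; exists i.
Qed.

Lemma surface_part_paired d g : g != 0 -> isform d g ->
  paired cl (fun V => (surface_part g V)%:Z) (kap g).
Proof.
move=> g0 hg; have [u [s [uu Ps gE]]] := @ufd_mpoly F #|'I_4| g g0.
have u0 : u != 0 by apply: contraTneq uu => ->; rewrite unitr0.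
elim: s d g g0 hg Ps gE => [|p s IH] d g g0 hg Ps gE.
  have ug : g \is a GRing.unit by rewrite gE big_nil mulr1.
  rewrite kap_unit //; apply: eq_paired (paired0 cl _) => // V.
  have [[f Pf ->]|nV] := pselect (exists2 f, prime_form f & V = strict f); last first.
    by rewrite surface_part_out.
  have [Pf1 _] := Pf; rewrite (surface_part_strict (n := 0) Pf hg) //.
  by apply: (has_ord0 Pf1) => /(prime_nunit Pf1); rewrite ug.
have Pp := Ps p (mem_head _ _); have p0 := pi_neq0 Pp.
pose g' := u * \prod_(q <- s) q; have gE' : g = p * g' by rewrite gE big_cons mulrCA.
have g'0 : g' != 0 by apply: contraNneq g0 => z; rewrite gE' z mulr0.
have [dp hp] : exists d, isform d p by move: g0 hg; rewrite gE'; exact: whom_factor.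
have [d' hg'] : exists d, isform d g'.
  by move: g0 hg; rewrite gE' mulrC; exact: whom_factor.
have Ppf : prime_form p by split=> //; exists dp.
have Ps' q : q \in s -> prime_elt q by move=> qs; apply: Ps; rewrite inE qs orbT.
rewrite gE' (kapM p0 g'0) -(cl_strict Ppf).
have e1 : (`[< strict p = strict p >] : nat)%:Z = 1 by rewrite asboolT.
have e2 V : V <> strict p -> (`[< V = strict p >] : nat)%:Z = 0 by move=> nV; rewrite asboolF.
have := pairedD (@paired_single _ _ cl int (strict p) 1
  (fun V => (`[< V = strict p >] : nat)%:Z) e1 e2) (IH d' g' g'0 hg' Ps' erefl).
rewrite mul1r intz => H; apply: eq_paired H => //.
move=> V; rewrite -PoszD; congr Posz.
have [[f Pf ->]|nV] := pselect (exists2 f, prime_form f & V = strict f); last first.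
  rewrite !surface_part_out // asboolF // => VE; apply: nV; by exists p.
have [Pf1 _] := Pf; have [n hn] := prime_has_ord Pf1 g'0.
rewrite (surface_part_strict Pf hg' hn).
have hp1 : has_ord f (`[< strict f = strict p >] : nat) p.
  case: asboolP => [E|nE].
    have [|v vv ->] := prime_assoc Pf1 Pp; first by apply: (strict_sub_divides dl) => //; rewrite E.
    apply/(has_ordP Pf1); exists v; first by rewrite expr1.
    by move/(prime_nunit Pf1); rewrite vv.
  apply: (has_ord0 Pf1) => fp; apply: nE; apply: strict_assoc => //.
  exact: prime_divides_assoc.
have hpg : isform d (p * g') by rewrite -gE'.
exact: (esym (surface_part_strict Pf hpg (has_ordM Pf1 hp1 hn))).
Qed.

(** The contribution of the strict transforms is [kap (Psi P)], by unique
    factorization; that of the exceptional divisors corrects the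
    multiplicities of [Psi P] to the degrees of [P] in the fibre coordinates. *)
Theorem divisor_paired e P : mhomog bl_block e P -> Psi P != 0 ->
  paired cl (fun V => (divisor_of bl_block X P V)%:Z)
    ((\sum_j e j)%N%:Z * h - \sum_i (e (Some i))%:Z * eps i).
Proof.
move=> he P0; have hf : isform (\sum_j e j) (Psi P) by exact: homog_Psi.
pose dE i := divisor_of bl_block X P (exc i).
have H1 := surface_part_paired P0 hf.
have H2 : paired cl (fun V => \sum_i (if `[< V = exc i >] then dE i else 0%N)%:Z)
    (\sum_i (dE i)%:Z * eps i).
  apply: paired_sum => i; rewrite -(cl_exc i).
  have -> : (dE i)%:Z * cl (exc i) = (dE i)%:Z * (cl (exc i))%:~R by rewrite intz.
  by apply: paired_single => [|V nV]; [rewrite asboolT|rewrite asboolF].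
apply: eq_paired (pairedD H1 H2) => [V|]; last first.
  rewrite /kap (form_degree P0 hf) -addrA; congr (_ + _).
  rewrite -!sumrN -big_split /=; apply: eq_bigr => i _.
  by rewrite (divisor_exc dl i he P0) PoszD -/(dE i); ring.
have [[i ->]|nE] := pselect (exists i, V = exc i).
  rewrite /surface_part asboolT; last by exists i.
  rewrite add0r (bigD1 i) //= asboolT // big1 ?addr0 // => j ji.
  rewrite asboolF // => /(exc_inj dl) E; by rewrite E eqxx in ji.
rewrite big1 ?addr0 => [|i _]; last by rewrite asboolF // => E; apply: nE; exists i.
have [[f Pf ->]|nV] := pselect (exists2 f, prime_form f & V = strict f).
  have [Pf1 _] := Pf; have [n hn] := prime_has_ord Pf1 P0.
  by rewrite (surface_part_strict Pf hf hn) (divisor_strict dl Pf he hn).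
rewrite surface_part_out // /divisor_of; case: asboolP => // /(prime_divisorP dl)[|//].
by move=> /nE.
Qed.

End ClassFunctional.

(** * Lines in products of projective spaces *)

Section Lines.
Variables (F : numClosedFieldType) (T K : finType) (b : T -> K).
Variables (phi : T -> {poly F}) (lin : pred K) (L M : K -> mpolyT F T) (k0 : K).

Definition delta (k j : K) : nat := k == j.
(** Restriction of polynomials to the parametrised curve [phi].  The blocks
    satisfying [lin] move along a line; [L k] and [M k] are coordinates on the
    [k]-th block that restrict to [1] and to the parameter. *)
Definition rho : mpolyT F T -> {poly F} := ev polyC phi.
HB.instance Definition _ := GRing.RMorphism.on rho.

Hypotheses (L_hom : forall k, mhomog b (delta k) (L k)).
Hypotheses (M_hom : forall k, mhomog b (delta k) (M k)).
Hypotheses (rhoL : forall k, rho (L k) = 1).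
Hypotheses (rhoM : forall k, lin k -> rho (M k) = 'X).
Hypotheses (phi_size : forall u, (size (phi u) <= (lin (b u)).+1)%N).
Hypotheses (lin_k0 : lin k0).

Definition lpt (t : F) (u : T) : F := (phi u).[t].
Definition line_curve : set (T -> F) := zclosure b (range lpt).

Lemma rho_eval P t : (rho P).[t] = peval P (lpt t).
Proof.
rewrite pevalE -[LHS]/(horner_eval t (ev polyC phi P)) ev_hom.
by apply: eq_ev => // c /=; rewrite /horner_eval hornerC.
Qed.

Lemma rho_var u : rho (var F u) = phi u. Proof. exact: ev_var. Qed.
Lemma rho_cst c : rho (pcst T c) = c%:P. Proof. exact: ev_cst. Qed.

Lemma rho0P P : rho P = 0 <-> vanishes_on P (range lpt).
Proof.
split=> [E p [t _ <-]|H]; first by rewrite -rho_eval E horner0.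
apply/eqP; apply: contraT => /poly_nonroot[t].
by rewrite rho_eval H ?eqxx //; exists t.
Qed.

Lemma block_zero e P (q : T -> F) k : mhomog b e P -> (0 < e k)%N ->
  (forall u, b u = k -> q u = 0) -> peval P q = 0.
Proof.
move=> he ek H; have E : q = fun u => (b u != k)%:R * q u.
  by apply/funext => u; case: eqP => [/H ->|]; rewrite ?mulr0 ?mul1r.
rewrite E (peval_scale _ (fun j => (j != k)%:R) he) (bigD1 k) //= eqxx expr0n.
by case: (e k) ek => //= n _; rewrite !mul0r.
Qed.

Lemma lpt_mproj : range lpt `<=` mproj b.
Proof.
move=> _ [t _ <-] k; apply: contrapT => H.
have H' u : b u = k -> lpt t u = 0.
  move=> bu; apply/eqP; apply: contrapT => /negP h; apply: H; by exists u.
have : peval (L k) (lpt t) = 0.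
  by apply: (block_zero (@L_hom k) _ H'); rewrite /delta eqxx.
by rewrite -rho_eval rhoL hornerC => /eqP; rewrite oner_eq0.
Qed.

Lemma line_mproj : line_curve `<=` mproj b.
Proof. exact: zclosure_mproj lpt_mproj. Qed.

Lemma line_vanishes e P : mhomog b e P -> rho P = 0 -> vanishing_ideal line_curve P.
Proof. by move=> he /rho0P; exact: (vanishes_zclosure lpt_mproj he). Qed.

Lemma line_rho0 P : vanishing_ideal line_curve P -> rho P = 0.
Proof. by move=> H; apply/rho0P => p rp; apply: H; exact: sub_zclosure. Qed.

(** Equations that hold along the parametrisation hold on the closure. *)
Lemma line_relation e P Q q : mhomog b e P -> mhomog b e Q -> rho P = rho Q ->
  line_curve q -> peval P q = peval Q q.
Proof.
move=> hP hQ E Cq; apply/eqP; rewrite -subr_eq0 -pevalB; apply/eqP.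
by apply: (line_vanishes (mhomogB hP hQ)) Cq; rewrite rmorphB /= E subrr.
Qed.

Lemma line_subvariety : subvariety b line_curve.
Proof.
apply: subvariety_zclosure; first exact: lpt_mproj.
  by exists (lpt 0); exists 0.
move=> e e' P Q hP hQ /rho0P; rewrite rmorphM => /eqP.
by rewrite mulf_eq0 => /orP[]/eqP/rho0P; tauto.
Qed.

(** ** Restriction of forms to the line *)

Definition line_degree (e : K -> nat) : nat := (\sum_(k | lin k) e k)%N.

Lemma rho_size e P : mhomog b e P -> (size (rho P) <= (line_degree e).+1)%N.
Proof.
move=> he; rewrite /rho /ev /mmap.
have size_add (p q : {poly F}) n : (size p <= n)%N -> (size q <= n)%N -> (size (p + q)%R <= n)%N.
  by move=> hp hq; apply: leq_trans (size_polyD _ _) _; rewrite geq_max hp.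
rewrite big_seq; elim/big_ind: _ => [|p q|m mP]; first by rewrite size_poly0.
  exact: size_add.
rewrite mul_polyC; apply: leq_trans (size_scale_leq _ _) _.
have -> : line_degree e = (\sum_k lin (b (enum_val k)) * m k)%N.
  rewrite (partition_big (fun k => b (enum_val k)) predT) //= /line_degree big_mkcond.
  apply: eq_bigr => j _; rewrite -(he m mP j); case lj: (lin j).
    by apply: eq_bigr => k /eqP ->; rewrite lj mul1n.
  by rewrite big1 // => k /eqP ->; rewrite lj.
rewrite /mmap1; elim/big_ind2: _ => [|n p n' p' h h'|k _]; first by rewrite size_poly1.
  apply: leq_trans (size_polyMleq _ _) _; lia.
rewrite mulnC; elim: (m k) => [|n IH]; first by rewrite expr0 size_poly1.
rewrite exprS; apply: leq_trans (size_polyMleq _ _) _.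
have := phi_size (enum_val k); move: IH; rewrite mulSn.
by move: (size (phi _)) (size (phi _ ^+ _)%R) => x y; lia.
Qed.

Lemma rho_monomial e j : (j <= line_degree e)%N ->
  exists2 P, mhomog b e P & rho P = 'X^j.
Proof.
move=> hj; have [a [ae al sa]] : exists a : K -> nat,
    [/\ forall k, (a k <= e k)%N, forall k, ~~ lin k -> a k = 0%N & (\sum_k a k = j)%N].
  elim: j hj => [|j IH] hj; first by exists (fun=> 0%N); rewrite big1.
  have [a [ae al sa]] := IH (ltnW hj).
  have [k lk lt] : exists2 k, lin k & (a k < e k)%N.
    apply: contrapT => /forall2NP H; move: hj; rewrite ltnNge => /negP; apply.
    rewrite -sa /line_degree big_mkcond; apply: leq_sum => k _.
    case: ifP => // lk; have [|/negP] := H k; first by rewrite lk.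
    by rewrite -leqNgt.
  exists (fun i => (a i + (i == k))%N); split=> [i|i nl|].
  - by have [->|_] := eqVneq i k; rewrite ?addn1 // addn0.
  - by rewrite al //; case: eqP nl => // ->; rewrite lk.
  - rewrite big_split /= sa (bigD1 k) //= eqxx big1 ?addn0 ?addn1 //.
    by move=> i /negbTE ->.
exists (\prod_k (L k ^+ (e k - a k) * M k ^+ a k)).
  apply: eq_mhomog _ (mhomog_prod (fun k _ =>
    mhomogM (mhomogX (n := (e k - a k)%N) (@L_hom k)) (mhomogX (n := a k) (@M_hom k)))) => k.
  rewrite (bigD1 k) //= /delta eqxx !muln1 subnK // big1 ?addn0 // => i /negbTE ->.
  by rewrite !muln0.
rewrite rmorph_prod -sa expr_sum; apply: eq_bigr => k _.
rewrite rmorphM !rmorphXn /= rhoL expr1n mul1r.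
by case lk: (lin k); [rewrite rhoM | rewrite al ?lk].
Qed.

Lemma rho_onto e (p : {poly F}) : (size p <= (line_degree e).+1)%N ->
  exists2 P, mhomog b e P & rho P = p.
Proof.
move=> sp; have /choice[P hP] : forall j : 'I_(line_degree e).+1,
    exists P, mhomog b e P /\ rho P = 'X^j.
  by move=> j; have [|P] := @rho_monomial e j; [rewrite -ltnS|exists P].
exists (\sum_(j < (line_degree e).+1) pcst T p`_j * P j).
  by apply: mhomog_sum => j _; apply: mhomogZ; case: (hP j).
rewrite rmorph_sum -[RHS](coefK p) poly_def.
rewrite (big_ord_widen _ (fun i => p`_i *: 'X^i) sp) [RHS]big_mkcond /=.
apply: eq_bigr => j _; rewrite rmorphM /= rho_cst; have [_ ->] := hP j.
by rewrite mul_polyC; case: ltnP => // le; rewrite nth_default ?scale0r.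
Qed.

(** If the ideal of [V] restricts to the multiples of [g], at least in large
    degrees, then the coordinate ring of the intersection is the space of
    polynomials modulo [g]. *)
Lemma line_intersection V (g : {poly F}) n : size g = n.+1 ->
  (forall P, vanishing_ideal V P -> g %| rho P) ->
  (exists N0, forall k, (N0 <= k)%N -> forall q,
     (size (g * q)%R <= (line_degree (fun=> k)).+1)%N ->
     exists P, [/\ mhomog b (fun=> k) P, vanishing_ideal V P & rho P = g * q]) ->
  intersection_length b V line_curve n.
Proof.
move=> sg Hdvd [N0 HN]; have g0 : g != 0 by rewrite -size_poly_gt0 sg.
exists (maxn N0 n) => k; rewrite geq_max => /andP[Nk nk].
have dk : (k <= line_degree (fun=> k))%N by rewrite /line_degree (bigD1 k0) //= leq_addr.
have /choice[B hB] : forall i : 'I_n, exists P, mhomog b (fun=> k) P /\ rho P = 'X^i.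
  move=> i; have [|P] := @rho_monomial (fun=> k) i; last by exists P.
  by apply: leq_trans (ltnW (ltn_ord i)) (leq_trans nk dk).
(* The coordinates of [P] in the basis [B] of powers of the parameter are the
   coefficients of the remainder modulo [g]. *)
exists B; first by move=> i; case: (hB i).
move=> P hP; pose p := rho P.
have rB (c : 'rV[F]_n) : rho (\sum_(i < n) c ord0 i *: B i) = \sum_(i < n) c ord0 i *: 'X^i.
  rewrite rmorph_sum; apply: eq_bigr => i _.
  by rewrite -mul_mpolyC rmorphM /= -/(pcst T _) rho_cst mul_polyC; case: (hB i) => _ ->.
have sr : (size (p %% g)%R <= n)%N by rewrite -ltnS -sg ltn_modp.
pose c0 : 'rV[F]_n := \row_i (p %% g)`_i.
have c0E : \sum_(i < n) c0 ord0 i *: 'X^i = p %% g.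
  rewrite -[RHS](coefK (p %% g)) poly_def (big_ord_widen _ (fun i => (p %% g)`_i *: 'X^i) sr) [RHS]big_mkcond /=.
  apply: eq_bigr => i _; rewrite mxE; case: ltnP => // le.
  by rewrite nth_default ?scale0r.
have hBc : mhomog b (fun=> k) (\sum_(i < n) c0 ord0 i *: B i).
  by apply: mhomog_sum => i _; rewrite -mul_mpolyC; apply: mhomogZ; case: (hB i).
exists c0; split.
  have sz : (size (g * (p %/ g)%R)%R <= (line_degree (fun=> k)).+1)%N.
    have -> : g * (p %/ g) = p - p %% g by rewrite {2}(divp_eq p g) addrK mulrC.
    apply: leq_trans (size_polyD _ _) _; rewrite size_polyN geq_max rho_size //=.
    by apply: leq_trans sr (leq_trans nk (leq_trans dk _)).
  have [Q1 [hQ1 VQ1 rQ1]] := HN k Nk _ sz.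
  exists Q1, (P - \sum_(i < n) c0 ord0 i *: B i - Q1); split=> //; last by rewrite [RHS]addrC subrK.
  apply: (line_vanishes (mhomogB (mhomogB hP hBc) hQ1)).
  rewrite !rmorphB /= rB c0E rQ1 -/p {1}(divp_eq p g); ring.
move=> c [Q1 [Q2 [VQ1 /line_rho0 CQ2 E]]].
have := congr1 rho E; rewrite rmorphB rmorphD /= rB CQ2 addr0 -/p => E'.
have /dvdpP[s sE] := Hdvd _ VQ1; rewrite sE in E'.
have sc : (size (\sum_(i < n) c ord0 i *: 'X^i)%R < size g)%N.
  rewrite sg ltnS; elim/big_ind: _ => [|x y hx hy|i _]; first by rewrite size_poly0.
    by apply: leq_trans (size_polyD _ _) _; rewrite geq_max hx.
  by apply: leq_trans (size_scale_leq _ _) _; rewrite size_polyXn.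
have pE : p %% g = \sum_(i < n) c ord0 i *: 'X^i.
  have -> : p = s * g + \sum_(i < n) c ord0 i *: 'X^i by rewrite -E' subrK.
  by rewrite modpD modp_mull add0r modp_small.
apply/rowP => i; rewrite mxE pE coef_sum (bigD1 i) //= coefZ coefXn eqxx mulr1.
rewrite big1 ?addr0 // => j ji; rewrite coefZ coefXn; case: eqP; rewrite ?mulr0 // => ij.
by move: ji; rewrite (_ : j = i) ?eqxx //; exact/val_inj.
Qed.

(** ** The line is a curve *)

Lemma block_coordinates q u : line_curve q ->
  q u = (phi u)`_0 * peval (L (b u)) q + (phi u)`_1 * peval (M (b u)) q.
Proof.
move=> Cq; rewrite -(peval_cst (phi u)`_0 q) -(peval_cst (phi u)`_1 q) -!pevalM -pevalD.
rewrite -[LHS]peval_var; apply: (@line_relation (delta (b u))) => //.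
- exact: eq_mhomog _ (@mhomog_var F _ _ b u).
- by apply: mhomogD; apply: mhomogZ.
rewrite rho_var rmorphD !rmorphM /= !rho_cst rhoL mulr1.
have := phi_size u; case lu: (lin (b u)) => su.
  rewrite rhoM //; apply/polyP => i; rewrite coefD coefC coefCM coefX.
  case: i => [|[|i]] /=; rewrite ?mulr0 ?mulr1 ?addr0 ?add0r //.
  by rewrite nth_default // (leq_trans su).
by rewrite [(phi u)`_1]nth_default // mul0r addr0; exact: size1_polyC.
Qed.

Lemma nonlin_coordinate u : ~~ lin (b u) -> (phi u)`_1 = 0.
Proof. by move=> nl; rewrite nth_default //; have := phi_size u; rewrite (negbTE nl). Qed.

Lemma cross_relation k q : lin k -> line_curve q ->
  peval (L k) q * peval (M k0) q = peval (M k) q * peval (L k0) q.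
Proof.
move=> lk Cq; rewrite -!pevalM.
apply: (line_relation (mhomogM (@L_hom k) (@M_hom k0)) (mhomogM (@M_hom k) (@L_hom k0))) => //.
by rewrite !rmorphM /= !rhoL !rhoM // mul1r mulr1.
Qed.

Lemma LM_neq0 k q : line_curve q -> peval (L k) q = 0 ->
  lin k /\ peval (M k) q != 0.
Proof.
move=> Cq Lk; have [u bu qu] := line_mproj Cq k.
have := block_coordinates u Cq; rewrite bu Lk mulr0 add0r => E.
split; last by apply: contra_neq qu => Mk; rewrite E Mk mulr0.
apply: contraT => nl; case/eqP: qu; rewrite E nonlin_coordinate ?mul0r //.
by rewrite bu.
Qed.

Lemma L_neq0 k q : line_curve q -> peval (L k0) q != 0 -> peval (L k) q != 0.
Proof.
move=> Cq L0; apply/eqP => Lk; have [lk Mk] := LM_neq0 Cq Lk.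
have := cross_relation lk Cq; rewrite Lk mul0r => /esym/eqP.
by rewrite mulf_eq0 (negbTE L0) (negbTE Mk).
Qed.

(** Homogenised with [M k0] and [L k0], the restriction of [P] agrees with [P] on
    the whole curve, up to powers of the coordinates [L k]. *)
Lemma zero_on_line e P q : mhomog b e P -> line_curve q -> peval P q = 0 ->
  peval (L k0) q != 0 -> root (rho P) (peval (M k0) q / peval (L k0) q).
Proof.
move=> he Cq Pq L0; set p := rho P; set N := size p.
pose R := (\prod_k L k ^+ e k) * \sum_(j < N) pcst T p`_j * (M k0 ^+ j * L k0 ^+ (N - j)).
have E : peval (P * L k0 ^+ N) q = peval R q.
  have hN j : (j <= N)%N -> mhomog b (fun k => N * delta k0 k)%N (M k0 ^+ j * L k0 ^+ (N - j)).
    move=> jN; apply: eq_mhomog _ (mhomogM (mhomogX (n := j) (@M_hom k0))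
      (mhomogX (n := (N - j)%N) (@L_hom k0))) => k.
    by rewrite -mulnDl subnKC.
  apply: (@line_relation (fun k => e k + N * delta k0 k)%N) => //.
  - by apply: mhomogM => //; exact: mhomogX.
  - apply: mhomogM; last by apply: mhomog_sum => j _; apply: mhomogZ; apply: hN; exact: ltnW.
    apply: eq_mhomog _ (mhomog_prod (fun k _ => mhomogX (n := e k) (@L_hom k))) => k.
    rewrite (bigD1 k) //= /delta eqxx muln1 big1 ?addn0 // => i /negbTE ->.
    by rewrite muln0.
  rewrite !rmorphM rmorphXn /= rhoL expr1n mulr1 rmorph_prod big1 ?mul1r; last first.
    by move=> k _; rewrite rmorphXn /= rhoL expr1n.
  rewrite rmorph_sum -[LHS](coefK p) poly_def; apply: eq_bigr => j _.
  rewrite !rmorphM !rmorphXn /= rho_cst rhoL rhoM // expr1n mulr1 mul_polyC //.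
move: E; rewrite pevalM Pq mul0r /R pevalM peval_prod peval_sum => /esym/eqP.
rewrite mulf_eq0 => /orP[/eqP E|/eqP E].
  case/eqP: (oner_neq0 F); exfalso; move: E; apply/eqP/prodf_neq0 => k _.
  by rewrite pevalX expf_neq0 // L_neq0.
apply/eqP; apply: (mulIf (expf_neq0 N L0)); rewrite mul0r -E horner_coef mulr_suml.
apply: eq_bigr => j _; rewrite !pevalM peval_cst !pevalX -mulrA; congr (_ * _).
rewrite expr_div_n -mulrA; congr (_ * _).
have -> : peval (L k0) q ^+ N = peval (L k0) q ^+ j * peval (L k0) q ^+ (N - j).
  by rewrite -exprD subnKC // ltnW.
by rewrite mulrA mulVf ?mul1r // expf_neq0.
Qed.

(** The restriction of [P] to the curve is a product of linear factors, and one
    of them, or the equation [L k0] of the point at infinity, vanishes on [W]. *)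
Lemma one_point W e P : subvariety b W -> W `<=` line_curve -> mhomog b e P ->
  vanishing_ideal W P -> rho P != 0 ->
  exists z : T -> F, forall q, W q ->
    exists2 l : K -> F, (forall k, l k != 0) & q = fun u => l (b u) * z u.
Proof.
move=> sW WC he WP p0; have [rs pE] := closed_field_poly_normal (rho P).
pose f (o : option F) := if o is Some r then M k0 - pcst T r * L k0 else L k0.
have hf o : exists e', mhomog b e' (f o).
  exists (delta k0); case: o => [r|] //=; by apply: mhomogB => //; exact: mhomogZ.
have [||o _ Ho] := @subvariety_prime_prod _ _ _ b W _ (None :: map Some rs) f sW.
- by move=> o _; exact: hf.
- move=> q Wq; rewrite big_cons big_map /= pevalM.
  have [->|L0] := eqVneq (peval (L k0) q) 0; first by rewrite mul0r.
  have := zero_on_line he (WC q Wq) (WP q Wq) L0.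
  rewrite pE rootZ ?lead_coef_eq0 // root_prod_XsubC => rin.
  rewrite peval_prod (big_rem _ rin) /= pevalB pevalM peval_cst divfK // subrr.
  by rewrite mul0r mulr0.
have bc := block_coordinates.
case: o Ho => [r|] Ho.
  exists (lpt r) => q Wq; have Cq := WC q Wq; have := Ho q Wq.
  rewrite /= pevalB pevalM peval_cst => /eqP; rewrite subr_eq0 => /eqP E0.
  have L0 : peval (L k0) q != 0.
    by apply/eqP => L0; have [_] := LM_neq0 Cq L0; rewrite E0 L0 mulr0 eqxx.
  exists (fun k => peval (L k) q) => [k|]; first exact: L_neq0.
  apply/funext => u; rewrite (bc q u Cq) /lpt.
  have -> : (phi u).[r] = (phi u)`_0 + (phi u)`_1 * r.
    rewrite (@horner_coef_wide _ 2) ?big_ord_recl ?big_ord0 /= ?expr0 ?expr1 ?mulr1 ?addr0 //.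
    by apply: leq_trans (phi_size u) _; case: (lin _).
  case lu: (lin (b u)); last by rewrite nonlin_coordinate ?lu // !mul0r !addr0 mulrC.
  have -> : peval (M (b u)) q = r * peval (L (b u)) q.
    apply: (mulIf L0); rewrite -(cross_relation lu Cq) E0; ring.
  ring.
exists (fun u => if lin (b u) then (phi u)`_1 else (phi u)`_0) => q Wq; have Cq := WC q Wq.
have /= L0 := Ho q Wq; have [_ M0] := LM_neq0 Cq L0.
have Lk k : lin k -> peval (L k) q = 0.
  move=> lk; have := cross_relation lk Cq; rewrite L0 mulr0 => /eqP.
  by rewrite mulf_eq0 (negbTE M0) orbF => /eqP.
exists (fun k => if lin k then peval (M k) q else peval (L k) q) => [k|].
  case lk: (lin k); first by have [] := LM_neq0 Cq (Lk k lk).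
  by apply/eqP => /(LM_neq0 Cq)[]; rewrite lk.
apply/funext => u; rewrite (bc q u Cq); case lu: (lin (b u)).
  by rewrite Lk // mulr0 add0r mulrC.
by rewrite nonlin_coordinate ?lu // mul0r addr0 mulrC.
Qed.

(** A smaller subvariety is contained in the zero locus of a form that does not
    vanish on the curve, hence is a point. *)
Theorem line_is_curve X : line_curve `<=` X -> curve b X line_curve.
Proof.
move=> CX; split=> //; first exact: line_subvariety.
  have sub1 : [set lpt 0] `<=` range lpt by move=> _ ->; exists 0.
  have m1 : [set lpt 0] `<=` mproj b by move=> p /sub1; exact: lpt_mproj.
  exists (zclosure b [set lpt 0]).
    apply: subvariety_zclosure => //; first by exists (lpt 0).
    move=> e e' P Q _ _ /(_ _ erefl); rewrite pevalM => /eqP.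
    by rewrite mulf_eq0 => /orP[]/eqP h; [left|right]; move=> _ ->.
  split; first by move=> p h Z cZ Z1; apply: h => // q /sub1; exact: Z1.
  move=> H; have C1 : line_curve (lpt 1) by apply: sub_zclosure; exists 1.
  have : peval (M k0) (lpt 1) = 0.
    apply: (vanishes_zclosure m1 (@M_hom k0)) (H _ C1) => _ ->.
    by rewrite -rho_eval rhoM // hornerX.
  by rewrite -rho_eval rhoM // hornerX => /eqP; rewrite oner_eq0.
move=> W1 W2 sW1 sW2 [W12 n12] [W2C n2C].
have [cW1 [q1 W1q1] _] := sW1; have [cW2 _ _] := sW2.
have [p /not_implyP[Cp nWp]] : exists p, ~ (line_curve p -> W2 p).
  by apply: contrapT => /forallNP H; apply: n2C => p; exact: contrapT (H p).
have [e [P [he PW Pp]]] := zclosed_separate cW2 (line_mproj Cp) nWp.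
have rP : rho P != 0.
  by apply: contraNneq Pp => rP; rewrite (line_vanishes he rP).
have [z hz] := one_point sW2 W2C he PW rP.
apply: n12 => q /hz[l l0 ->]; have [l1 l10 E1] := hz q1 (W12 _ W1q1).
have := zclosed_scale (l := fun k => l k / l1 k) cW1 _ W1q1; rewrite E1 => H.
have -> : (fun u => l (b u) * z u) = fun u => l (b u) / l1 (b u) * (l1 (b u) * z u).
  by apply/funext => u; rewrite mulrA divfK.
by apply: H => k; rewrite mulf_neq0 // invr_eq0.
Qed.

End Lines.

(** ** Pencils *)

Lemma poly_eq_nonzero (F : numClosedFieldType) (p q : {poly F}) :
  (forall s, s != 0 -> p.[s] = q.[s]) -> p = q.
Proof.
move=> H; apply/eqP; rewrite -subr_eq0; apply: contraT => pq0.
have [|s] := @poly_nonroot F ('X * (p - q)); first by rewrite mulf_neq0 ?polyX_eq0.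
rewrite hornerM hornerX mulf_eq0 negb_or => /andP[s0].
by rewrite hornerD hornerN H // subrr eqxx.
Qed.

(** Passing from the parameter to its inverse reverses the coefficients. *)
Lemma reversed_poly (F : numClosedFieldType) (p r : {poly F}) d :
  (size p <= d.+1)%N -> (forall s, s != 0 -> r.[s] = s ^+ d * p.[s^-1]) ->
  r = \sum_(i < d.+1) p`_i *: 'X^(d - i).
Proof.
move=> sp H; apply: poly_eq_nonzero => s s0.
rewrite H // (horner_coef_wide _ sp) horner_sum mulr_sumr.
apply: eq_bigr => i _; rewrite hornerZ hornerXn mulrCA; congr (_ * _).
have id : (i <= d)%N by rewrite -ltnS.
rewrite -{1}(subnK id) exprD -mulrA exprVn mulfV ?mulr1 // expf_neq0 //.
Qed.

Lemma reversed_coef (F : numClosedFieldType) (p r : {poly F}) d :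
  (size p <= d.+1)%N -> (forall s, s != 0 -> r.[s] = s ^+ d * p.[s^-1]) ->
  r.[0] = p`_d.
Proof.
move=> sp /(reversed_poly sp) ->.
rewrite horner_sum big_ord_recr /= big1 ?add0r => [|i _].
  by rewrite subnn expr0 hornerZ hornerC mulr1.
by rewrite hornerZ hornerXn expr0n subn_eq0 leqNgt ltn_ord mulr0.
Qed.

Section Pencil.
Variables (F : numClosedFieldType) (T K : finType) (b : T -> K) (lin : pred K).

Definition pphi (v w : T -> F) (u : T) : {poly F} :=
  (v u)%:P + (if lin (b u) then w u else 0)%:P * 'X.

Definition pform (l : T -> F) (k : K) : mpolyT F T :=
  \sum_(u | b u == k) pcst T (l u) * var F u.

(** Coordinates on the blocks of the pencil, with values [1] and ['X]. *)
Record pencil_coord (v w l mu : T -> F) (k0 : K) : Prop := PencilCoord {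
  _ : lin k0;
  _ : forall k, \sum_(u | b u == k) l u * v u = 1;
  _ : forall k, lin k -> \sum_(u | b u == k) l u * w u = 0;
  _ : forall k, lin k -> \sum_(u | b u == k) mu u * v u = 0;
  _ : forall k, lin k -> \sum_(u | b u == k) mu u * w u = 1 }.

Definition pencil (v w : T -> F) := line_curve b (pphi v w).

Lemma pform_hom l k : mhomog b (delta k) (pform l k).
Proof.
apply: mhomog_sum => u /eqP bu; apply: mhomogZ.
by apply: eq_mhomog _ (@mhomog_var F _ _ b u) => j; rewrite bu.
Qed.

Lemma rho_pform v w l k : rho (pphi v w) (pform l k) =
  (\sum_(u | b u == k) l u * v u)%:P +
  (if lin k then \sum_(u | b u == k) l u * w u else 0)%:P * 'X.
Proof.
rewrite rmorph_sum /= rmorph_sum; case lk: (lin k); last first.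
  rewrite mul0r addr0; apply: eq_bigr => u /eqP bu.
  by rewrite rmorphM /= rho_cst rho_var /pphi bu lk mul0r addr0 polyCM.
rewrite rmorph_sum mulr_suml -big_split; apply: eq_bigr => u /eqP bu /=.
by rewrite rmorphM /= rho_cst rho_var /pphi bu lk mulrDr !polyCM mulrA.
Qed.

Section Coord.
Variables (v w l mu : T -> F) (k0 : K).
Hypothesis co : pencil_coord v w l mu k0.

Lemma coord_k0 : lin k0. Proof. by case: co. Qed.

Lemma coord_L k : rho (pphi v w) (pform l k) = 1.
Proof.
case: co => _ h1 h2 _ _; rewrite rho_pform h1; case: ifP => [/h2 ->|_];
  by rewrite mul0r addr0.
Qed.

Lemma coord_M k : lin k -> rho (pphi v w) (pform mu k) = 'X.
Proof. by case: co => _ _ _ h3 h4 lk; rewrite rho_pform lk h3 // h4 // add0r mul1r. Qed.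

Lemma pphi_size u : (size (pphi v w u) <= (lin (b u)).+1)%N.
Proof.
rewrite /pphi; case: ifP => _ /=; last first.
  by rewrite mul0r addr0 size_polyC; case: (_ != 0).
apply: leq_trans (size_polyD _ _) _; rewrite geq_max size_polyC; apply/andP; split.
  by case: (_ != 0).
by rewrite mul_polyC; apply: leq_trans (size_scale_leq _ _) _; rewrite size_polyX.
Qed.

Definition pencil_curve X := @line_is_curve F T K b _ lin (pform l) (pform mu) k0
  (@pform_hom l) (@pform_hom mu) coord_L coord_M pphi_size coord_k0 X.

Definition pencil_intersection V g n := @line_intersection F T K b _ lin (pform l) (pform mu) k0
  (@pform_hom l) (@pform_hom mu) coord_L coord_M pphi_size coord_k0 V g n.

Definition pencil_onto e p := @rho_onto F T K b _ lin (pform l) (pform mu)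
  (@pform_hom l) (@pform_hom mu) coord_L coord_M e p.

Definition pencil_mproj := @lpt_mproj F T K b _ (pform l) (@pform_hom l) coord_L.

Definition pencil_size e P := @rho_size F T K b _ lin k0 pphi_size coord_k0 e P.

(** The point at infinity. *)
Definition pinf (u : T) : F := if lin (b u) then w u else v u.

Lemma pinf_mproj : mproj b pinf.
Proof.
move=> k; apply: contrapT => H.
have H' u : b u = k -> pinf u = 0.
  by move=> bu; apply/eqP; apply: contrapT => /negP h; apply: H; exists u.
case: co => _ h1 _ _ h4; have : \sum_(u | b u == k) (if lin k then mu u else l u) * pinf u = 1.
  case lk: (lin k); [rewrite -(h4 k lk)|rewrite -(h1 k)]; apply: eq_bigr => u /eqP bu;
    by rewrite /pinf bu lk.
rewrite big1 => [|u /eqP /H' ->]; last by rewrite mulr0.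
by move/eqP; rewrite eq_sym oner_eq0.
Qed.

(** The parametrisation seen from the point at infinity. *)
Definition prev (u : T) : {poly F} := if lin (b u) then (w u)%:P + (v u)%:P * 'X else (v u)%:P.

Lemma prev_eval e P s : mhomog b e P -> s != 0 ->
  (rho prev P).[s] = s ^+ line_degree lin e * (rho (pphi v w) P).[s^-1].
Proof.
move=> he s0; rewrite !rho_eval.
have -> : lpt prev s = fun u => (if lin (b u) then s else 1) * lpt (pphi v w) s^-1 u.
  apply/funext => u; rewrite /lpt /prev /pphi; case: (lin (b u)); rewrite !hornerE /=.
    by rewrite mulrDr [s * (_ * _)]mulrCA mulfV // mulr1 addrC [v u * s]mulrC.
  by rewrite ?mul0r ?mulr0 ?addr0 ?mul1r.
rewrite (peval_scale _ (fun k => if lin k then s else 1) he); congr (_ * _).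
rewrite /line_degree expr_sum [RHS]big_mkcond; apply: eq_bigr => k _.
by case: ifP; rewrite ?expr1n.
Qed.

Lemma prev_pinf P : (rho prev P).[0] = peval P pinf.
Proof.
rewrite rho_eval; congr (peval P _); apply/funext => u; rewrite /lpt /prev /pinf.
by case: ifP; rewrite !hornerE // mulr0 addr0.
Qed.

(** The value at infinity is the coefficient of highest degree. *)
Lemma top_coef e P : mhomog b e P -> peval P pinf != 0 ->
  size (rho (pphi v w) P) = (line_degree lin e).+1.
Proof.
move=> he nz; have sz := pencil_size he.
apply/eqP; rewrite eqn_leq sz /=; apply: contraNT nz; rewrite -leqNgt => le.
rewrite -prev_pinf (reversed_coef sz) => [|s]; last exact: prev_eval.
by rewrite nth_default.
Qed.

Lemma pencil_pinf : pencil v w pinf.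
Proof.
rewrite /pencil /line_curve (zclosureP pencil_mproj); split; first exact: pinf_mproj.
move=> e P he /rho0P R0; rewrite -prev_pinf.
suff -> : rho prev P = 0 by rewrite horner0.
apply: poly_eq_nonzero => s s0; rewrite (prev_eval he s0) R0 !horner0 mulr0 //.
Qed.

Lemma zclosed_pencil : zclosed b (pencil v w).
Proof. exact: zclosed_zclosure pencil_mproj. Qed.

Lemma pencil_point (al be : F) (q : T -> F) : (al, be) != (0, 0) ->
  (forall u, q u = if lin (b u) then al * v u + be * w u else v u) -> pencil v w q.
Proof.
move=> ab hq; have [al0|al0] := eqVneq al 0.
  have be0 : be != 0 by apply: contraNneq ab => be0; rewrite al0 be0.
  have := zclosed_scale (l := fun k => if lin k then be else 1) zclosed_pencil _ pencil_pinf.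
  set z := fun t => _; have -> : z = q; last first.
    by apply=> k; case: ifP => _ //; exact: oner_neq0.
  apply/funext => u; rewrite /z hq /pinf; case: ifP => _; rewrite ?mul1r //.
  by rewrite al0 mul0r add0r.
have Cp : pencil v w (lpt (pphi v w) (be / al)) by apply: sub_zclosure; exists (be / al).
have := zclosed_scale (l := fun k => if lin k then al else 1) zclosed_pencil _ Cp.
set z := fun t => _; have -> : z = q; last first.
  by apply=> k; case: ifP => _ //; exact: oner_neq0.
apply/funext => u; rewrite /z hq /lpt /pphi; case: ifP => _; rewrite !hornerE.
  by rewrite /=; field.
by rewrite ?mulr0 ?mul0r ?addr0 ?mul1r.
Qed.

End Coord.

Lemma pencil_change_sub v w v' w' l mu k0 (a c d e : F) : pencil_coord v w l mu k0 ->
  a * e - c * d != 0 ->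
  (forall u, lin (b u) -> v' u = a * v u + c * w u) ->
  (forall u, lin (b u) -> w' u = d * v u + e * w u) ->
  (forall u, ~~ lin (b u) -> v' u = v u) -> pencil v' w' `<=` pencil v w.
Proof.
move=> co det hv hw hn; apply: zclosure_sub; first exact: zclosed_pencil co.
move=> _ [t _ <-]; apply: (pencil_point co (al := a + t * d) (be := c + t * e)).
  apply: contra det; rewrite xpair_eqE => /andP[/eqP h1 /eqP h2].
  have -> : a = - (t * d) by apply/eqP; rewrite -addr_eq0 h1.
  have -> : c = - (t * e) by apply/eqP; rewrite -addr_eq0 h2.
  by apply/eqP; ring.
move=> u; rewrite /lpt /pphi; case lu: (lin (b u)); rewrite !hornerE.
  by rewrite hv // hw //; ring.
by rewrite hn ?lu // ?mulr0 ?mul0r ?addr0.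
Qed.

End Pencil.

(** ** Homogeneous components *)

Section Components.
Variables (F : numClosedFieldType) (T K : finType) (b : T -> K) (k : K).
Local Notation w := (fun u : T => (b u == k) : nat).

Definition component n (P : mpolyT F T) := (grading w P)`_n.

Lemma component_whom n P : whom w n (component n P).
Proof.
move=> m; rewrite mcoeff_msupp /component grading_coef => h.
by apply/eqP; apply: contraNT h => /negbTE ->.
Qed.

Lemma component_sum P : P = \sum_(n < size (grading w P)) component n P.
Proof.
apply/mpolyP => m; rewrite raddf_sum /=.
have [lt|le] := ltnP (wdeg w m) (size (grading w P)).
  rewrite (bigD1 (Ordinal lt)) //= grading_coef eqxx mulr1n big1 ?addr0 // => n.
  by rewrite -val_eqE /= grading_coef eq_sym => /negbTE ->.
rewrite big1 => [|n _]; last first.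
  by rewrite grading_coef; case: eqP => // E; have := ltn_ord n; rewrite -E ltnNge le.
have := grading_coef w P (wdeg w m) m.
by rewrite eqxx mulr1n nth_default // mcoeff0.
Qed.

(** Closed sets are stable under rescaling of the block [k]. *)
Lemma component_vanishes V n P : zclosed b V -> vanishing_ideal V P ->
  vanishing_ideal V (component n P).
Proof.
move=> cV VP p Vp; have E : map_poly (ev idfun p) (grading w P) = 0.
  apply: poly_eq_nonzero => s s0; rewrite horner0.
  have := VP _ (zclosed_scale (l := fun j => if j == k then s else 1) cV _ Vp).
  rewrite pevalE => <-; last by move=> j; case: ifP => // _; exact: oner_neq0.
  rewrite -[LHS]/((horner_eval s \o map_poly (ev idfun p)) _) /grading.
  apply: (etrans (ev_hom (horner_eval s \o map_poly (ev idfun p)) _ _ P)).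
  apply: eq_ev => [c|u] /=.
    by rewrite map_polyC /horner_eval hornerC /= ev_cst.
  rewrite rmorphM /= map_polyC map_polyXn /horner_eval !hornerE /= ev_var mulrC.
  by case: eqP; rewrite ?expr1 ?expr0.
rewrite pevalE /component -(coef_map (ev idfun p)) /=.
by rewrite E coef0.
Qed.

End Components.

(** * Two kinds of test curves *)

Lemma sum_block_base (S : nmodType) (G : bl_coord -> S) :
  \sum_(u : bl_coord | bl_block u == None) G u = \sum_j G (inl j).
Proof.
by rewrite big_sumType /= [X in _ + X]big_pred0 ?addr0 // => -[i a].
Qed.

Lemma sum_block_fiber (S : nmodType) (G : bl_coord -> S) i :
  \sum_(u : bl_coord | bl_block u == Some i) G u = \sum_a G (inr (i, a)).
Proof.
rewrite big_sumType /= [X in X + _]big_pred0 ?add0r //.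
rewrite (reindex_onto (pair i) snd) /= => [|[k a] /= /eqP[->]] //.
by apply: eq_bigl => a; rewrite !eqxx.
Qed.

(** Used to move a point outside a given surface to infinity, so that the
    restriction of the equation of the surface has full degree. *)
Lemma pencil_swap (F : numClosedFieldType) (T K : finType) (b : T -> K)
    (lin : pred K) (v w v' w' l mu l' mu' : T -> F) (k0 : K) (t : F) :
  pencil_coord b lin v w l mu k0 -> pencil_coord b lin v' w' l' mu' k0 ->
  (forall u, lin (b u) -> v' u = w u /\ w' u = v u + t * w u) ->
  (forall u, ~~ lin (b u) -> v' u = v u) -> pencil b lin v' w' = pencil b lin v w.
Proof.
move=> co co' hl hn; apply/seteqP; split.
  apply: (pencil_change_sub (a := 0) (c := 1) (d := 1) (e := t) co) => //.
  - by rewrite mul0r mul1r sub0r oppr_eq0 oner_eq0.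
  - by move=> u /hl[-> _]; rewrite mul0r add0r mul1r.
  - by move=> u /hl[_ ->]; rewrite mul1r.
apply: (pencil_change_sub (a := - t) (c := 1) (d := 1) (e := 0) co').
- by rewrite mulr0 mul1r sub0r oppr_eq0 oner_eq0.
- by move=> u /hl[-> ->]; ring.
- by move=> u /hl[-> ->]; ring.
- by move=> u /hn.
Qed.

Lemma ord2_or (c : 'I_2) : c = ord0 \/ c = ord_max.
Proof. by case: c => -[|[|//]] h; [left|right]; exact: val_inj. Qed.

(** The change of basis that sends the point of parameter [t] to infinity. *)
Definition swapm (F : fieldType) (t : F) : 'M[F]_2 :=
  \matrix_(c, d) (if c == ord0 then (d != ord0)%:R else if d == ord0 then 1 else t).

Lemma swapm_unit (F : fieldType) (t : F) : swapm t \in unitmx.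
Proof.
pose G' : 'M[F]_2 := \matrix_(c, d) (if c == ord0 then (if d == ord0 then - t else 1) else
  (d == ord0)%:R).
suff E : swapm t *m G' = 1%:M by have [] := mulmx1_unit E.
apply/matrixP => c d; rewrite !mxE !big_ord_recl big_ord0 !mxE /=.
case: (ord2_or c) => ->; case: (ord2_or d) => -> /=; ring.
Qed.

Lemma row2_sum (F : fieldType) n (G : 'M[F]_2) (N : 'M[F]_(2, n)) c :
  row c (G *m N) = G c ord0 *: row ord0 N + G c ord_max *: row ord_max N.
Proof.
have o1 : lift ord0 ord0 = ord_max :> 'I_2 by exact: val_inj.
by apply/rowP => j; rewrite !mxE !big_ord_recl big_ord0 o1 addr0.
Qed.

Lemma row_swap0 (F : fieldType) n (t : F) (N : 'M[F]_(2, n)) :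
  row ord0 (swapm t *m N) = row ord_max N.
Proof. by rewrite row2_sum !mxE /= scale0r add0r scale1r. Qed.

Lemma row_swap1 (F : fieldType) n (t : F) (N : 'M[F]_(2, n)) :
  row ord_max (swapm t *m N) = row ord0 N + t *: row ord_max N.
Proof. by rewrite row2_sum !mxE /= scale1r. Qed.

Section TestCurves.
Variables (F : numClosedFieldType) (A : 'I_4 -> 'M[F]_(4, 2)).
Hypothesis dl : forall i j, i != j -> (row_mx (A i) (A j) : 'M_4) \in unitmx.

Local Notation X := (blowup A).
Local Notation Psi := (Psi A).
Local Notation lb := (lb A).
Local Notation exc := (exc A).
Local Notation strict := (strict A).

(** Both divisors have the degree given by their common multidegree. *)
Lemma cl_principal h eps e P Q : mhomog bl_block e P -> mhomog bl_block e Q ->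
  ~ vanishing_ideal X P -> ~ vanishing_ideal X Q ->
  pairing (cl A h eps) (fun V => (divisor_of bl_block X P V)%:Z -
                                 (divisor_of bl_block X Q V)%:Z) = 0.
Proof.
have nz R : mhomog bl_block e R -> ~ vanishing_ideal X R -> Psi R != 0.
  by move=> hR nR; apply: contra_notN nR => /eqP; exact: (Psi0_vanishes hR).
move=> hP hQ /(nz _ hP) P0 /(nz _ hQ) Q0.
have HP := divisor_paired dl h eps hP P0; have HQ := divisor_paired dl h eps hQ Q0.
have [_ E] := pairedD HP (pairedZ (-1) HQ).
transitivity (pairing (cl A h eps) (fun V => (divisor_of bl_block X P V)%:Z +
                                 -1 * (divisor_of bl_block X Q V)%:Z)).
  by congr pairing; apply/funext => V; rewrite mulN1r.
by rewrite E mulN1r subrr.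
Qed.

(** ** Lines of the projective space that miss the four lines *)

Section GeneralLine.

Definition lineV (N : 'M[F]_(2, 4)) := gpt A idfun (row ord0 N).
Definition lineW (N : 'M[F]_(2, 4)) := gpt A idfun (row ord_max N).
Definition lineD (N : 'M[F]_(2, 4)) (d : 'I_2) (u : bl_coord) : F :=
  match u with
  | inl j => (A ord0 *m invmx (N *m A ord0)) j d
  | inr (i, a) => invmx (N *m A i) a d
  end.
(** The lift to the blow-up of the line spanned by the rows of [N]. *)
Definition lineC N := pencil bl_block xpredT (lineV N) (lineW N).
Definition off_lines (N : 'M[F]_(2, 4)) := forall i, N *m A i \in unitmx.

Lemma line_dual N (c d : 'I_2) k : off_lines N ->
  \sum_(u : bl_coord | bl_block u == k) lineD N d u * gpt A idfun (row c N) u = (c == d)%:R.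
Proof.
move=> HN; rewrite gpt_idE; case: k => [i|].
  rewrite sum_block_fiber /=.
  transitivity ((row c N *m A i *m invmx (N *m A i)) ord0 d).
    by rewrite [RHS]mxE; apply: eq_bigr => a _; rewrite mulrC.
  by rewrite -!row_mul (mulmxV (HN i)) !mxE.
rewrite sum_block_base /=.
transitivity ((row c N *m (A ord0 *m invmx (N *m A ord0))) ord0 d).
  by rewrite [RHS]mxE; apply: eq_bigr => a _; rewrite mulrC.
by rewrite mulmxA -!row_mul (mulmxV (HN ord0)) !mxE.
Qed.

Lemma line_coord N : off_lines N ->
  pencil_coord bl_block xpredT (lineV N) (lineW N) (lineD N ord0) (lineD N ord_max) None.
Proof. by move=> HN; split=> // k *; rewrite line_dual. Qed.

Definition xline (N : 'M[F]_(2, 4)) : 'rV[{poly F}]_4 :=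
  map_mx polyC (row ord0 N) + 'X *: map_mx polyC (row ord_max N).

Lemma rho_line N P :
  rho (pphi bl_block xpredT (lineV N) (lineW N)) P = evx polyC (xline N) (Psi P).
Proof.
rewrite evx_Psi; apply: eq_ev => // u; rewrite /pphi /lineV /lineW !gpt_idE /gpt /xline.
case: u => [j|[i a]] /=; first by rewrite !mxE mulrC.
by rewrite mulmxDl -scalemxAl -!map_mxM !mxE mulrC.
Qed.

Lemma line_point N t : lpt (pphi bl_block xpredT (lineV N) (lineW N)) t =
  gpt A idfun (row ord0 N + t *: row ord_max N).
Proof.
apply/funext => u; rewrite /lpt /pphi /lineV /lineW !gpt_idE hornerD hornerC hornerM hornerC hornerX.
case: u => [j|[i a]] /=; first by rewrite !mxE mulrC.
by rewrite mulmxDl -scalemxAl !mxE mulrC.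
Qed.

Lemma line_point_off N t i : off_lines N -> (row ord0 N + t *: row ord_max N) *m A i != 0.
Proof.
move=> HN; have -> : row ord0 N + t *: row ord_max N = (\row_c (if c == ord0 then 1 else t)) *m N.
  apply/rowP => j; rewrite !mxE !big_ord_recl big_ord0 !mxE /= mul1r addr0.
  by congr (_ + _ * N _ _); exact: val_inj.
rewrite -mulmxA; apply/eqP => /(congr1 (mulmxr (invmx (N *m A i)))) /=.
rewrite mulmxK // mul0mx => /rowP/(_ ord0); rewrite !mxE eqxx => /eqP.
by rewrite oner_eq0.
Qed.

Lemma lineC_subX N : off_lines N -> lineC N `<=` X.
Proof.
move=> HN; apply: zclosure_sub; first exact: zclosed_blowup.
move=> _ [t _ <-]; rewrite line_point; apply: sub_zclosure; apply: gpt_graph => i.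
exact: line_point_off.
Qed.

Lemma lineC_curve N : off_lines N -> curve bl_block X (lineC N).
Proof. by move=> HN; exact: (pencil_curve (line_coord HN)) (lineC_subX HN). Qed.

Lemma off_lines_swap N t : off_lines N -> off_lines (swapm t *m N).
Proof. by move=> HN i; rewrite -mulmxA unitmx_mul swapm_unit HN. Qed.

Lemma gpt_linear (x y : 'rV[F]_4) t u :
  gpt A idfun (x + t *: y) u = gpt A idfun x u + t * gpt A idfun y u.
Proof.
rewrite !gpt_idE; case: u => [j|[i a]] /=; first by rewrite !mxE.
by rewrite mulmxDl -scalemxAl !mxE.
Qed.

Lemma lineC_swap N t : off_lines N -> lineC (swapm t *m N) = lineC N.
Proof.
move=> HN; apply: (pencil_swap (t := t) (line_coord HN) (line_coord (off_lines_swap t HN))) => // u _.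
by rewrite /lineV /lineW row_swap0 row_swap1 gpt_linear.
Qed.

Lemma rho_line_lb N i (d : 'I_2) : off_lines N ->
  rho (pphi bl_block xpredT (lineV N) (lineW N))
    (\sum_a pcst bl_coord (invmx (N *m A i) a d) * lb i a) =
  (ord0 == d)%:R%:P + (ord_max == d)%:R%:P * 'X.
Proof.
move=> HN; rewrite rmorph_sum.
have E c : \sum_a invmx (N *m A i) a d * (row c N *m A i) ord0 a = (c == d)%:R.
  transitivity ((row c N *m A i *m invmx (N *m A i)) ord0 d).
    by rewrite [RHS]mxE; apply: eq_bigr => a _; rewrite mulrC.
  by rewrite -!row_mul (mulmxV (HN i)) !mxE.
rewrite -!E !rmorph_sum mulr_suml -big_split; apply: eq_bigr => a _ /=.
rewrite rmorphM /= rho_cst rho_line Psi_lb evx_lform /xline mulmxDl -scalemxAl -!map_mxM.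
by rewrite !polyCM !mxE; ring.
Qed.

(** The ideal of an exceptional divisor contains forms whose restrictions to
    a line missing the centre are [1] and ['X]. *)
Lemma line_exc N i : off_lines N ->
  intersection_length bl_block (exc i) (lineC N) 0.
Proof.
move=> HN; have co := line_coord HN.
apply: (pencil_intersection co (g := 1)) => [|P _|]; [by rewrite size_poly1|exact: dvd1p|].
pose U d := \sum_a pcst bl_coord (invmx (N *m A i) a d) * lb i a.
have hU d : mhomog bl_block (deg0 1) (U d).
  by apply: mhomog_sum => a _; apply: mhomogZ; exact: mhomog_lb.
have vU d : vanishing_ideal (exc i) (U d).
  move=> p Ep; rewrite peval_sum big1 // => a _.
  by rewrite pevalM (@lb_exc _ A i a p Ep) mulr0.
exists 1%N => k k1 q; rewrite mul1r => sq.
pose e (j : option 'I_4) := (k - deg0 1 j)%N.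
have ek : (fun j => (deg0 1 j + e j)%N) =1 (fun=> k).
  by rewrite /e => -[j|] /=; lia.
have De : line_degree xpredT (fun _ : option 'I_4 => k) = (line_degree xpredT e).+1.
  rewrite /line_degree !big_option /e /=; have -> : (\sum_(l < 4) (k - 0) = \sum_(l < 4) k)%N by
    apply: eq_bigr => l _; rewrite subn0.
  by move: (\sum_(i < 4) k)%N => S; lia.
have [c cE] : divides 'X (q - (q`_0)%:P).
  by apply/divides_X; rewrite coefB coefC subrr.
have qE : q = (q`_0)%:P + 'X * c by rewrite mulrC -cE addrC subrK.
have sc : (size c <= (line_degree xpredT e).+1)%N.
  have [->|c0] := eqVneq c 0; first by rewrite size_poly0.
  have : (size (c * 'X)%R <= (line_degree xpredT e).+2)%N.
    rewrite -cE; apply: leq_trans (size_polyD _ _) _; rewrite size_polyN geq_max -De sq /=.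
    by rewrite size_polyC; case: (_ != 0).
  by rewrite size_mulX.
have [|P0 hP0 rP0] := pencil_onto co (e := e) (p := (q`_0)%:P).
  by rewrite size_polyC; case: (_ != 0).
have [P1 hP1 rP1] := pencil_onto co sc.
exists (U ord0 * P0 + U ord_max * P1); split.
- by apply: mhomogD; apply: (eq_mhomog ek); apply: mhomogM.
- by move=> p Ep; rewrite pevalD !pevalM !vU // !mul0r addr0.
rewrite rmorphD !rmorphM /= !rho_line_lb // rP0 rP1 !eqxx /=.
by rewrite polyC0 polyC1 mul0r addr0 add0r !mul1r.
Qed.

Lemma line_strict N f d : off_lines N -> prime_elt f -> isform d f ->
  ~ lineC N `<=` strict f -> intersection_length bl_block (strict f) (lineC N) d.
Proof.
move=> HN Pf hf nC; have [t ft] : exists t, evf (row ord0 N + t *: row ord_max N) f != 0.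
  apply: contrapT => /forallNP H; apply: nC; apply: zclosure_sub.
    exact: zclosed_zclosure (@surf_graph_mproj _ _ f).
  move=> _ [t _ <-]; rewrite line_point; apply: sub_zclosure; split.
    by apply: gpt_graph => i; exact: line_point_off.
  by rewrite gpt_idE base_ptE; apply: contrapT => /eqP; exact: H.
(* The point of parameter [t], which is not on the surface, becomes the point at
   infinity. *)
rewrite -(lineC_swap t HN); have HN' := off_lines_swap t HN; have co := line_coord HN'.
set N' := swapm t *m N in HN' co *.
pose g := rho (pphi bl_block xpredT (lineV N') (lineW N')) (pullx f).
have dE : line_degree xpredT (deg0 d) = d.
  by rewrite /line_degree big_option /= big1 // addn0.
apply: (pencil_intersection co (g := g)).
- rewrite /g (top_coef co (mhomog_pullx hf)) ?dE //.
  by rewrite peval_pullx /pinf /lineW /= gpt_idE base_ptE row_swap1.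
- move=> P /(strict_divides dl Pf)[h hE]; rewrite /g !rho_line Psi_pullx hE rmorphM.
  exact: dvdp_mull.
exists d => k dk q sq; pose e (j : option 'I_4) := (k - deg0 d j)%N.
have ek : (fun j => (deg0 d j + e j)%N) =1 (fun=> k).
  by rewrite /e => -[j|] /=; lia.
have De : line_degree xpredT (fun _ : option 'I_4 => k) = (d + line_degree xpredT e)%N.
  rewrite /line_degree !big_option /e /=; have -> : (\sum_(l < 4) (k - 0) = \sum_(l < 4) k)%N by
    apply: eq_bigr => l _; rewrite subn0.
  by move: (\sum_(i < 4) k)%N => S; lia.
have [q0|q0] := eqVneq q 0.
  exists 0; split; [exact: mhomog0|by move=> p _; rewrite /peval meval0|].
  by rewrite q0 mulr0 rmorph0.
have sg : size g = d.+1.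
  rewrite /g (top_coef co (mhomog_pullx hf)) ?dE //.
  by rewrite peval_pullx /pinf /lineW /= gpt_idE base_ptE row_swap1.
have g0 : g != 0 by rewrite -size_poly_gt0 sg.
have [|P hP rP] := pencil_onto co (e := e) (p := q).
  move: sq; rewrite size_mul // sg De.
  by move: (size q) (line_degree xpredT e) => m l; rewrite addSn /= -addnS leq_add2l.
exists (pullx f * P); split.
- by apply: (eq_mhomog ek); apply: mhomogM => //; exact: mhomog_pullx.
- by move=> p Vp; rewrite pevalM (strict_ideal Pf hf Vp) mul0r.
- by rewrite rmorphM /= rP.
Qed.

Theorem line_numbers N : off_lines N ->
  intersection_numbers bl_block X (lineC N) (cl A 1 (fun=> 0)).
Proof.
move=> HN; split; last by move=> e P Q; exact: cl_principal.
move=> V /(prime_divisorP dl)[[i ->]|[f Pf ->]] nC.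
  by exists 0%N; [exact: line_exc|rewrite cl_exc].
have [Pf1 [d hf]] := Pf; exists d; first exact: line_strict.
rewrite cl_strict // /kap (form_degree (pi_neq0 Pf1) hf) mulr1 big1 ?subr0 //.
by move=> i _; rewrite mulr0.
Qed.

End GeneralLine.
End TestCurves.

(** ** Fibres of the exceptional divisors *)

Lemma dual_vector (F : fieldType) n (x : 'rV[F]_n) : x != 0 ->
  exists l : 'I_n -> F, \sum_j l j * x ord0 j = 1.
Proof.
move=> /rv_neq0[j xj]; exists (fun k => if k == j then (x ord0 j)^-1 else 0).
rewrite (bigD1 j) //= eqxx mulVf // big1 ?addr0 // => k /negbTE ->.
by rewrite mul0r.
Qed.

(** The powers of [pi] are compared: if fewer of them are on the right, then
    [pi] divides [T]; otherwise the surplus divides [q]. *)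
Lemma prime_cancel (D : idomainType) (pi t T q : D) m n : prime_elt pi ->
  ~ divides pi t -> q * (pi ^+ m * t) = pi ^+ n * T -> divides t T \/ divides pi T.
Proof.
move=> Pp nt H; have p0 k : pi ^+ k != 0 by rewrite expf_neq0 // pi_neq0.
have [lt|le] := ltnP n m.
  right; exists (pi ^+ (m - n).-1 * (q * t)); apply: (mulfI (p0 n)); rewrite -H.
  have -> : pi ^+ m = pi ^+ n * pi ^+ (m - n).-1 * pi.
    by rewrite -exprD -exprSr; congr (_ ^+ _); lia.
  by ring.
left; have H1 : t * q = pi ^+ (n - m) * T.
  by apply: (mulfI (p0 m)); rewrite [RHS]mulrA -exprD subnKC // -H; ring.
have [|c cE] := @dividesX_cancel _ _ Pp (n - m) t q nt.
  by exists T; rewrite H1 mulrC.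
by exists c; apply: (mulfI (p0 (n - m)%N)); rewrite -H1 cE; ring.
Qed.

Section Fibers.
Variables (F : numClosedFieldType) (A : 'I_4 -> 'M[F]_(4, 2)).
Hypothesis dl : forall i j, i != j -> (row_mx (A i) (A j) : 'M_4) \in unitmx.
Variables (i : 'I_4) (u0 : 'rV[F]_2).
Hypothesis u0_neq0 : u0 != 0.

Local Notation Mx := (mpolyT F 'I_4).
Local Notation Mbl := (mpolyT F bl_coord).
Local Notation X := (blowup A).
Local Notation Psi := (Psi A).
Local Notation theta := (theta A).
Local Notation lb := (lb A).
Local Notation exc := (exc A).
Local Notation strict := (strict A).
Local Notation mult := (mult A).
Local Notation ker := (ker A).
Local Notation sec := (sec A).

Let flin (k : option 'I_4) := k == Some i.
Let x0 : 'rV[F]_4 := u0 *m ker i.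

Definition fibV (B : 'M[F]_2) : bl_coord -> F :=
  pt x0 (fun k => if k == i then row ord0 B else x0 *m A k).
Definition fibW (B : 'M[F]_2) : bl_coord -> F :=
  pt 0 (fun k => if k == i then row ord_max B else 0).
(** The fibre over the point [x0] of the [i]-th line: the base point and the
    other projections are fixed, and the coordinate on the [i]-th projective
    line runs through the span of the rows of [B]. *)
Definition fibC B := pencil bl_block flin (fibV B) (fibW B).

Lemma fib_coord B : B \in unitmx ->
  exists l mu, pencil_coord bl_block flin (fibV B) (fibW B) l mu (Some i).
Proof.
move=> uB; have [lx hx] := dual_vector (ker_neq0 dl i u0_neq0).
have /choice[lk hk] : forall k, exists l : 'I_2 -> F, k != i ->
    \sum_a l a * (x0 *m A k) ord0 a = 1.
  move=> k; have [->|ki] := eqVneq k i; first by exists (fun=> 0).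
  by have [l hl] := dual_vector (ker_other dl ki u0_neq0); exists l.
have dual c d : \sum_a invmx B a d * row c B ord0 a = (c == d)%:R.
  transitivity ((row c B *m invmx B) ord0 d).
    by rewrite [RHS]mxE; apply: eq_bigr => a _; rewrite mulrC.
  by rewrite -row_mul (mulmxV uB) !mxE.
exists (fun u => match u with inl j => lx j | inr (k, a) =>
  if k == i then invmx B a ord0 else lk k a end).
exists (fun u => match u with inl j => 0 | inr (k, a) => invmx B a ord_max end).
split; first exact: eqxx.
- case=> [k|]; last by rewrite sum_block_base.
  rewrite sum_block_fiber /=; case: (eqVneq k i) => ki; last exact: hk.
  by rewrite dual.
- by move=> k /eqP ->; rewrite sum_block_fiber /= eqxx dual.
- by move=> k /eqP ->; rewrite sum_block_fiber /= eqxx dual.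
- by move=> k /eqP ->; rewrite sum_block_fiber /= eqxx dual.
Qed.

Lemma fib_point B t : lpt (pphi bl_block flin (fibV B) (fibW B)) t =
  ept A i u0 ((row ord0 B + t *: row ord_max B) *m sec i).
Proof.
apply/funext => u; rewrite /lpt /pphi hornerD hornerC hornerM hornerC hornerX /ept /tpt.
rewrite xpt_id scale0r addr0 -/x0 /fibV /fibW.
case: u => [j|[k a]] /=; first by rewrite /flin /= mul0r addr0.
rewrite /flin !map_mx_idfun; case: (eqVneq k i) => [->|ki].
  by rewrite !eqxx -mulmxA sec_lines // mulmx1 !mxE mulrC.
have -> : (Some k == Some i) = false by apply: contraNF ki => /eqP[->].
by rewrite mul0r addr0.
Qed.

Lemma fib_subexc B : B \in unitmx -> fibC B `<=` exc i.
Proof.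
move=> uB; apply: zclosure_sub; first exact: zclosed_exc.
move=> _ [t _ <-]; rewrite fib_point; apply: ept_exc => //.
rewrite -mulmxA sec_lines // mulmx1.
have -> : row ord0 B + t *: row ord_max B = row ord_max (swapm t *m B) by rewrite row_swap1.
apply/eqP => E; have : row ord_max 1%:M = 0 :> 'rV[F]_2.
  have uS : swapm t *m B \in unitmx by rewrite unitmx_mul swapm_unit.
  by rewrite -(mulmxV uS) row_mul E mul0mx.
by move/rowP/(_ ord_max); rewrite !mxE eqxx => /eqP; rewrite oner_eq0.
Qed.

Lemma fibC_curve B : B \in unitmx -> curve bl_block X (fibC B).
Proof.
move=> uB; have [l [mu co]] := fib_coord uB.
by apply: (pencil_curve co) => p /(fib_subexc uB)[].
Qed.

Lemma fibC_swap B t : B \in unitmx -> fibC (swapm t *m B) = fibC B.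
Proof.
move=> uB; have uS : swapm t *m B \in unitmx by rewrite unitmx_mul swapm_unit.
have [l [mu co]] := fib_coord uB; have [l' [mu' co']] := fib_coord uS.
apply: (pencil_swap (t := t) co co') => -[j|[k a]] //=; rewrite /flin /fibV /fibW /=.
  by move=> /eqP[->]; rewrite !eqxx row_swap0 row_swap1 !mxE.
by case: (eqVneq k i) => [->|//]; rewrite eqxx.
Qed.

Definition yfib (B : 'M[F]_2) : 'rV[{poly F}]_2 :=
  map_mx polyC (row ord0 B) + 'X *: map_mx polyC (row ord_max B).

(** The fibre is the limit of the family defining the valuation, so that
    restriction to it factors through [theta i]. *)
Lemma rho_fib B P : rho (pphi bl_block flin (fibV B) (fibW B)) P =
  evD polyC (map_mx polyC u0) (yfib B *m map_mx polyC (sec i)) 0 (theta i P).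
Proof.
rewrite evD_theta; apply: eq_ev => // u; rewrite /pphi /fibV /fibW /tpt /xpt scale0r addr0.
rewrite -map_mxM -/x0; case: u => [j|[k a]] /=; rewrite /flin.
  by rewrite polyC0 mul0r addr0 [RHS]mxE.
case: (eqVneq k i) => [->|ki].
  rewrite !eqxx -mulmxA -map_mxM (sec_lines dl) map_mx1 mulmx1 /yfib !mxE.
  by congr (_ + _); exact: mulrC.
have -> : (Some k == Some i) = false by apply: contraNF ki => /eqP[->].
by rewrite polyC0 mul0r addr0 -map_mxM !mxE.
Qed.

Section StrictTransform.
Variables (f : Mx) (d : nat).
Hypotheses (Pf : prime_elt f) (hf : isform d f).
Variable Pt : Mbl.
Hypotheses (hPt : mhomog bl_block (fun j => deg0 (d - mult i f) j + deg1 (mult i f) i j)%N Pt)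
  (PtE : Psi Pt = f).

(** The lift [Pt] takes the full multiplicity of [f] into account. *)
Lemma theta_Pt : has_ord 'X 0 (theta i Pt).
Proof.
have P0 : Psi Pt != 0 by rewrite PtE; exact: pi_neq0.
have [n hn] := theta_has_ord dl i hPt P0.
rewrite PtE /deg1 /= eqxx add0n => E; have n0 : n = 0%N by lia.
by move: hn; rewrite n0.
Qed.

(** On the strict transform [f] divides [Psi P]; at the limit this becomes
    divisibility by the restriction of [Pt]. *)
Lemma fib_component_dvd B n P : whom (fun t => (bl_block t == Some i) : nat) n P ->
  divides f (Psi P) ->
  rho (pphi bl_block flin (fibV B) (fibW B)) Pt %|
  rho (pphi bl_block flin (fibV B) (fibW B)) P.
Proof.
move=> hP [q qE]; rewrite !rho_fib; set E := evD _ _ _ _.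
have := Phi_Psi_weight dl hP; rewrite qE rmorphM /= -{1}PtE (Phi_Psi dl i hPt) /deg1 /= eqxx add0n.
have [_ nX] := theta_Pt; rewrite expr1 in nX.
move=> H; have [[c ->]|[c ->]] := prime_cancel (@prime_X _) nX H.
  by rewrite /E rmorphM dvdp_mull.
by rewrite /E rmorphM /= evDX mulr0 dvdp0.
Qed.

Lemma fib_strict_dvd B P : vanishing_ideal (strict f) P ->
  rho (pphi bl_block flin (fibV B) (fibW B)) Pt %|
  rho (pphi bl_block flin (fibV B) (fibW B)) P.
Proof.
move=> VP; have [cV _ _] := strict_subvariety dl Pf.
rewrite (component_sum bl_block (Some i) P) rmorph_sum.
elim/big_ind: _ => [|p q|n _]; [exact: dvdp0|exact: dvdp_add|].
apply: fib_component_dvd; first exact: component_whom.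
by apply: (strict_divides dl Pf); exact: component_vanishes.
Qed.

Lemma fib_strict B : B \in unitmx -> ~ fibC B `<=` strict f ->
  intersection_length bl_block (strict f) (fibC B) (mult i f).
Proof.
move=> uB nC; have [l [mu co]] := fib_coord uB.
have [t ft] : exists t, (rho (pphi bl_block flin (fibV B) (fibW B)) Pt).[t] != 0.
  apply: poly_nonroot; apply/eqP => R0; apply: nC; apply: zclosure_sub.
    exact: zclosed_zclosure (@surf_graph_mproj _ _ f).
  move=> p rp; apply: contrapT => nVp.
  have [cV _ _] := strict_subvariety dl Pf.
  have [e [R [hR VR Rp]]] := zclosed_separate cV (pencil_mproj co rp) nVp.
  have := fib_strict_dvd B VR; rewrite R0 dvd0p => /eqP/rho0P/(_ p rp) R0'.
  by rewrite R0' eqxx in Rp.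
have uS : swapm t *m B \in unitmx by rewrite unitmx_mul swapm_unit.
(* The point of parameter [t], which is not on the surface, becomes the point at
   infinity. *)
rewrite -(fibC_swap t uB); have [l' [mu' co']] := fib_coord uS.
set B' := swapm t *m B in uS co' *; set m := mult i f.
pose g := rho (pphi bl_block flin (fibV B') (fibW B')) Pt.
have sg : size g = m.+1.
  rewrite /g (top_coef co' hPt); last first.
    move: ft; rewrite rho_eval; congr (peval Pt _ != 0); apply/funext => u.
    rewrite /lpt /pphi hornerD hornerC hornerM hornerC hornerX /pinf /fibV /fibW.
    case: u => [j|[k a]] /=; first by rewrite /flin /= mul0r addr0.
    rewrite /flin; case: (eqVneq k i) => [->|ki].
      by rewrite !eqxx /B' row_swap1 !mxE mulrC.
    have -> : (Some k == Some i) = false by apply: contraNF ki => /eqP[->].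
    by rewrite mul0r addr0.
  by rewrite /line_degree /flin big_pred1_eq /deg1 /= eqxx.
apply: (pencil_intersection co' sg) => [P|]; first exact: fib_strict_dvd.
exists (d + m)%N => k dk q sq.
pose e (j : option 'I_4) := (k - (deg0 (d - m) j + deg1 m i j))%N.
have ek : (fun j => (deg0 (d - m) j + deg1 m i j + e j)%N) =1 (fun=> k).
  rewrite /e => j; rewrite subnKC //; case: j => [j|]; rewrite /deg1 /=; last by lia.
  by case: eqP => _; lia.
have De : line_degree flin (fun _ : option 'I_4 => k) = (m + line_degree flin e)%N.
  by rewrite /line_degree /flin !big_pred1_eq /e /deg1 /= eqxx add0n subnKC //; lia.
have [q0|q0] := eqVneq q 0.
  exists 0; split; [exact: mhomog0|by move=> p _; rewrite /peval meval0|].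
  by rewrite q0 mulr0 rmorph0.
have g0 : g != 0 by rewrite -size_poly_gt0 sg.
have [|P hP rP] := pencil_onto co' (e := e) (p := q).
  move: sq; rewrite size_mul // sg De.
  by move: (size q) (line_degree flin e) => a c; rewrite addSn /= -addnS leq_add2l.
exists (Pt * P); split.
- by apply: (eq_mhomog ek); apply: mhomogM.
- move=> p Vp; rewrite pevalM (strict_vanishes hPt _ Vp) ?mul0r // PtE.
  exact: divides_refl.
- by rewrite rmorphM /= rP.
Qed.

End StrictTransform.

Lemma fib_exc B j : B \in unitmx -> j != i ->
  intersection_length bl_block (exc j) (fibC B) 0.
Proof.
move=> uB ji; have [l [mu co]] := fib_coord uB.
apply: (pencil_intersection co (g := 1)) => [|P _|]; [by rewrite size_poly1|exact: dvd1p|].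
have /rv_neq0[a xa] := ker_other dl ji u0_neq0.
pose c := (u0 *m ker i *m A j) ord0 a.
have rlb : rho (pphi bl_block flin (fibV B) (fibW B)) (pcst bl_coord c^-1 * lb j a) = 1.
  rewrite rmorphM /= rho_cst -pullx_lform.
  have -> : rho (pphi bl_block flin (fibV B) (fibW B)) (pullx (lform A j a)) = c%:P.
    apply: poly_eq_nonzero => s _; rewrite rho_eval peval_pullx evf_lform hornerC fib_point.
    by rewrite /ept /tpt base_ptE xpt_id scale0r addr0.
  by rewrite -polyCM mulVf.
exists 1%N => k k1 q; rewrite mul1r => sq.
pose e (j : option 'I_4) := (k - deg0 1 j)%N.
have ek : (fun j => (deg0 1 j + e j)%N) =1 (fun=> k) by rewrite /e => -[j'|] /=; lia.
have De : line_degree flin (fun _ : option 'I_4 => k) = line_degree flin e.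
  by rewrite /line_degree /flin !big_pred1_eq /e /= subn0.
have [|P hP rP] := pencil_onto co (e := e) (p := q); first by rewrite -De.
exists (pcst bl_coord c^-1 * lb j a * P); split.
- by apply: (eq_mhomog ek); apply: mhomogM => //; apply: mhomogZ; exact: mhomog_lb.
- by move=> p Ep; rewrite !pevalM (@lb_exc _ A j a p Ep) mulr0 mul0r.
- by rewrite rmorphM /= rlb rP mul1r.
Qed.

Theorem fib_numbers B : B \in unitmx ->
  intersection_numbers bl_block X (fibC B) (cl A 0 (fun j => - (j == i)%:Z)).
Proof.
move=> uB; split; last by move=> e P Q; exact: cl_principal.
move=> V /(prime_divisorP dl)[[j ->]|[f Pf ->]] nC.
  have ji : j != i by apply: contra_notN nC => /eqP ->; exact: fib_subexc.
  by exists 0%N; [exact: fib_exc|rewrite cl_exc // (negbTE ji) oppr0].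
have [Pf1 [d hf]] := Pf; have [hm _] := multP A i (pi_neq0 Pf1).
have [Pt [hPt PtE]] := polarization dl hf hm.
exists (mult i f); first exact: fib_strict hPt PtE _ uB nC.
rewrite cl_strict // /kap mulr0 sub0r (bigD1 i) //= eqxx big1 => [|j /negbTE ->].
  by rewrite addr0 mulrN1 opprK.
by rewrite oppr0 mulr0.
Qed.

End Fibers.

(** * Inequalities for the class of a surface *)

(** The zero of [q] at the origin is a zero of [p] at infinity. *)
Lemma reversed_size (F : numClosedFieldType) (p q : {poly F}) d m : p != 0 ->
  (size q <= d.+1)%N -> 'X^m %| q -> (forall s, s != 0 -> p.[s] = s ^+ d * q.[s^-1]) ->
  (size p + m <= d.+1)%N.
Proof.
move=> p0 sq /dvdpP[c qE] H.
have c0 : c != 0.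
  apply: contra_neq p0 => c0; apply: poly_eq_nonzero => s s0.
  by rewrite H // qE c0 mul0r !horner0 mulr0.
have Xm : 'X^m != 0 :> {poly F} by rewrite expf_neq0 // polyX_eq0.
move: sq; rewrite qE size_mul // size_polyXn => sq.
have c1 : (0 < size c)%N by rewrite size_poly_gt0.
have [md sc] : (m <= d)%N /\ (size c <= (d - m).+1)%N.
  by move: (size c) c1 sq => n; lia.
have -> : p = \sum_(i < (d - m).+1) c`_i *: 'X^(d - m - i).
  apply: reversed_poly sc _ => s s0; rewrite H // qE hornerM hornerXn.
  by rewrite -{1}(subnK md) exprD exprVn; field; rewrite ?expf_neq0 ?s0.
have : (size (\sum_(i < (d - m).+1) c`_i *: 'X^(d - m - i))%R <= (d - m).+1)%N.
  apply: leq_trans (size_sum _ _ _) _; apply/bigmax_leqP => i _.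
  by apply: leq_trans (size_scale_leq _ _) _; rewrite size_polyXn ltnS leq_subr.
by move=> h; apply: leq_trans (leq_add h (leqnn m)) _; rewrite addSn subnK.
Qed.

(** The roots [0] and [1] are distinct. *)
Lemma two_roots_size (F : fieldType) (p : {poly F}) m n : p != 0 ->
  'X^m %| p -> ('X - 1%:P) ^+ n %| p -> (m + n < size p)%N.
Proof.
move=> p0 hm hn; have cop : coprimep ('X^m : {poly F}) (('X - 1%:P) ^+ n).
  apply: coprimep_expl; apply: coprimep_expr.
  by rewrite -[X in coprimep X _]subr0 -polyC0 coprimep_XsubC2 // subr0 oner_neq0.
have : 'X^m * ('X - 1%:P) ^+ n %| p by rewrite (Gauss_dvdp _ cop) hm hn.
move/(dvdp_leq p0); have Xm : 'X^m != 0 :> {poly F} by rewrite expf_neq0 // polyX_eq0.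
have Yn : ('X - 1%:P) ^+ n != 0 :> {poly F} by rewrite expf_neq0 // polyXsubC_eq0.
rewrite (size_mul Xm Yn) size_polyXn size_exp_XsubC.
by rewrite addSn addnS.
Qed.

Section Inequalities.
Variables (F : numClosedFieldType) (A : 'I_4 -> 'M[F]_(4, 2)).
Hypothesis dl : forall i j, i != j -> (row_mx (A i) (A j) : 'M_4) \in unitmx.

Local Notation Mx := (mpolyT F 'I_4).
Local Notation Phi := (Phi A).
Local Notation mult := (mult A).
Local Notation dual := (dual A).

Definition seg (z w : 'rV[F]_4) : Mx -> {poly F} :=
  evx polyC (map_mx polyC z + 'X *: map_mx polyC w).
HB.instance Definition _ z w := GRing.RMorphism.on (seg z w).

Lemma seg_eval z w f t : (seg z w f).[t] = evf (z + t *: w) f.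
Proof.
rewrite evfE /evx -[LHS]/(horner_eval t (ev polyC _ f)) ev_hom.
apply: eq_ev => [c|j] /=; first by rewrite /horner_eval hornerC.
by rewrite !mxE /horner_eval !hornerE.
Qed.

Lemma seg_size z w d f : isform d f -> (size (seg z w f) <= d.+1)%N.
Proof.
move=> hf; have hm : mhomog (fun _ : 'I_4 => tt) (fun=> d) f.
  by apply/mhomogE => -[]; exact: hf.
have := @rho_size F _ _ (fun _ : 'I_4 => tt)
  ((map_mx polyC z + 'X *: map_mx polyC w) ord0) xpredT tt _ isT _ _ hm.
rewrite /line_degree sum_nat_const card_unit mul1n; apply=> j.
rewrite !mxE /= addrC; apply: leq_trans (size_polyD _ _) _.
rewrite mulrC mul_polyC geq_max size_polyC; case: (_ != 0); rewrite ?andbT ?leq_b1 ?size_scale_leq //.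
  by apply: leq_trans (size_scale_leq _ _) _; rewrite size_polyX.
by apply: leq_trans (size_scale_leq _ _) _; rewrite size_polyX.
Qed.

Lemma seg_swap z w d f s : isform d f -> s != 0 ->
  (seg w z f).[s] = s ^+ d * (seg z w f).[s^-1].
Proof.
move=> hf s0; rewrite !seg_eval !evfE /evx.
rewrite -(ev_scale_weight (w := fun=> 1%N) _ _ _ hf); apply: eq_ev => // j.
by rewrite !mxE expr1; field.
Qed.

(** The points [z + s *: w] form a specialisation of the family defining
    [Phi i]. *)
Lemma order_dvd i (z w : 'rV[F]_4) s f : f != 0 -> z *m A i = 0 ->
  s ^+ mult i f %| evx polyC (map_mx polyC z + s *: map_mx polyC w) f.
Proof.
move=> f0 zi; have [[c cE] _] := multP A i f0.
have -> : evx polyC (map_mx polyC z + s *: map_mx polyC w) f =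
    evD polyC (map_mx polyC (z *m A (mate i))) (map_mx polyC w) s (Phi i f).
  by rewrite evD_Phi /xpt -map_mxM -(on_line dl zi).
by rewrite cE rmorphM rmorphXn /= evDX dvdp_mull.
Qed.

(** The points [z] and [w], at which [f] vanishes to order [mult i f] and
    [mult j f], are the origin and the point at infinity of the line joining
    them. *)
Lemma secant_orders i j d f (z w : 'rV[F]_4) : isform d f ->
  z *m A i = 0 -> w *m A j = 0 -> seg z w f != 0 ->
  'X^(mult i f) %| seg z w f /\ (size (seg z w f) + mult j f <= d.+1)%N.
Proof.
move=> hf zi wj nz; have f0 : f != 0 by apply: contra_neq nz => ->; exact: rmorph0.
split; first exact: order_dvd.
apply: (reversed_size nz (q := seg w z f)); first exact: seg_size.
  exact: order_dvd.
by move=> s s0; exact: seg_swap.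
Qed.

(** The line joining [z] and [w] meets the [k]-th line at the parameter [1]. *)
Lemma transversal_bound i j k d f (z w : 'rV[F]_4) : isform d f ->
  z *m A i = 0 -> w *m A j = 0 -> (z + w) *m A k = 0 -> seg z w f != 0 ->
  (mult i f + mult j f + mult k f <= d)%N.
Proof.
move=> hf zi wj zwk nz; have [h1 h2] := secant_orders hf zi wj nz.
have f0 : f != 0 by apply: contra_neq nz => ->; exact: rmorph0.
have h3 : ('X - 1%:P) ^+ mult k f %| seg z w f.
  have E : map_mx polyC (z + w) + ('X - 1%:P) *: map_mx polyC w =
      map_mx polyC z + 'X *: map_mx polyC w.
    by apply/rowP => a; rewrite !mxE rmorphD /= polyC1; ring.
  by have := order_dvd w ('X - 1%:P) f0 zwk; rewrite E.
have := two_roots_size nz h1 h3; move: (size _) (mult i f) (mult j f) (mult k f) h2.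
by move=> n mi mj mk; lia.
Qed.

Lemma chord_bound i j d f (z w : 'rV[F]_4) : isform d f ->
  z *m A i = 0 -> w *m A j = 0 -> seg z w f != 0 -> (mult i f + mult j f <= d)%N.
Proof.
move=> hf zi wj nz; have [/(dvdp_leq nz) h1 h2] := secant_orders hf zi wj nz.
by move: h1 h2; rewrite size_polyXn; move: (size _) => n; lia.
Qed.

(** ** Projections to the lines *)

Lemma dual_lines i j : i != j -> dual i j *m A i = 1%:M /\ dual i j *m A j = 0.
Proof. by case/(frame_blocks dl). Qed.

Lemma dual_sum i j : i != j -> A i *m dual i j + A j *m dual j i = 1%:M.
Proof.
move=> ij; have [d1 d2] := dual_lines ij.
have [e1 e2] : dual j i *m A j = 1%:M /\ dual j i *m A i = 0.
  by apply: dual_lines; rewrite eq_sym.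
have E1 : (A i *m dual i j + A j *m dual j i) *m row_mx (A i) (A j) = row_mx (A i) (A j).
  by rewrite mul_mx_row !mulmxDl -!mulmxA d1 d2 e1 e2 !mulmx0 !mulmx1 addr0 add0r.
have E2 : (A i *m dual i j + A j *m dual j i) *m (row_mx (A i) (A j) : 'M_4) =
  (row_mx (A i) (A j) : 'M_4) by exact: E1.
by rewrite -(mulmxK (dl ij) (_ + _)) E2 mulmxV // dl.
Qed.

Lemma split_point i j (x : 'rV[F]_4) : i != j ->
  exists z w, [/\ z *m A i = 0, w *m A j = 0, x = z + w, z = x *m A j *m dual j i &
                  w = x *m A i *m dual i j].
Proof.
move=> ij; have [_ d2] := dual_lines ij.
have [_ e2] : dual j i *m A j = 1%:M /\ dual j i *m A i = 0.
  by apply: dual_lines; rewrite eq_sym.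
exists (x *m A j *m dual j i), (x *m A i *m dual i j); split=> //.
- by rewrite -mulmxA e2 mulmx0.
- by rewrite -mulmxA d2 mulmx0.
- by rewrite addrC -!mulmxA -mulmxDr dual_sum // mulmx1.
Qed.

Lemma pair_bound i j d f : i != j -> f != 0 -> isform d f ->
  (mult i f + mult j f <= d)%N.
Proof.
move=> ij f0 hf; have [x fx] := evf_nonroot f0.
have [z [w [zi wj xE _ _]]] := split_point x ij.
apply: (chord_bound hf zi wj); apply: contraNneq fx => s0.
by rewrite xE -[w]scale1r -seg_eval s0 horner0.
Qed.

(** ** The quadric through three lines *)

Definition minor2 (u v : 'rV[F]_2) := u ord0 ord0 * v ord0 ord_max - u ord0 ord_max * v ord0 ord0.

Lemma minor2_eq0 (u v : 'rV[F]_2) : minor2 u v = 0 ->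
  exists a b, (a, b) != (0, 0) /\ a *: u + b *: v = 0.
Proof.
move/eqP; rewrite subr_eq0 => /eqP H; have [u0|u0] := eqVneq u 0.
  by exists 1, 0; rewrite u0 scaler0 scale0r addr0 xpair_eqE oner_eq0.
have [|t tE] := @proportional2 _ u v u0.
  by move=> a a'; case: (ord2_or a) (ord2_or a') => -> [] -> //; rewrite mulrC.
by exists (- t), 1; rewrite tE scale1r scaleNr addNr xpair_eqE oner_eq0 andbF.
Qed.

Lemma minor2_dep (u v : 'rV[F]_2) : u + v = 0 -> minor2 u v = 0.
Proof. by move/eqP; rewrite addr_eq0 => /eqP ->; rewrite /minor2 !mxE; ring. Qed.

Lemma minor2_0l v : minor2 0 v = 0. Proof. by rewrite /minor2 !mxE; ring. Qed.
Lemma minor2_0r u : minor2 u 0 = 0. Proof. by rewrite /minor2 !mxE; ring. Qed.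

Lemma whomB (w : 'I_4 -> nat) d (f g : Mx) : whom w d f -> whom w d g -> whom w d (f - g).
Proof.
move=> hf hg; have -> : f - g = f + pcst 'I_4 (-1) * g.
  by rewrite rmorphN rmorph1 mulN1r.
by apply: (@whomD _ _ _ d _ _ hf); apply: (@whomM _ _ _ 0 d) hg; exact: whom_cst.
Qed.

(** A point is on the quadric when its projections to the [i]-th and to the
    [j]-th line span a line that meets the [k]-th one. *)
Definition quad i j k : Mx :=
  let form N := lform (fun=> N) ord0 in
  form (A j *m dual j i *m A k) ord0 * form (A i *m dual i j *m A k) ord_max -
  form (A j *m dual j i *m A k) ord_max * form (A i *m dual i j *m A k) ord0.

Lemma quad_form i j k : isform 2 (quad i j k).
Proof.
have h N1 N2 a b : isform 2 (lform (F := F) (fun=> N1) ord0 a * lform (fun=> N2) ord0 b).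
  by apply: (@whomM _ _ _ 1 1); exact: lform_isform.
exact: (whomB (h _ _ _ _) (h _ _ _ _)).
Qed.

Lemma evf_quad i j k x : evf x (quad i j k) =
  minor2 (x *m A j *m dual j i *m A k) (x *m A i *m dual i j *m A k).
Proof.
rewrite /minor2 -!mulmxA (mulmxA (A j)) (mulmxA (A i)) -!(evf_lform (fun=> _) _ ord0).
by rewrite !evfE rmorphB !rmorphM.
Qed.

Section Triple.
Variables i j k : 'I_4.
Hypotheses (ij : i != j) (ik : i != k) (jk : j != k).

Lemma quad_line_i x : x *m A i = 0 -> evf x (quad i j k) = 0.
Proof. by move=> xi; rewrite evf_quad xi !mul0mx minor2_0r. Qed.

Lemma quad_line_j x : x *m A j = 0 -> evf x (quad i j k) = 0.
Proof. by move=> xi; rewrite evf_quad xi !mul0mx minor2_0l. Qed.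

Lemma quad_line_k x : x *m A k = 0 -> evf x (quad i j k) = 0.
Proof.
move=> xk; rewrite evf_quad; apply: minor2_dep; rewrite -mulmxDl.
by rewrite -!mulmxA -mulmxDr addrC dual_sum // mulmx1.
Qed.

Lemma quad_secant x : x *m A i != 0 -> x *m A j != 0 -> evf x (quad i j k) = 0 ->
  exists z w t, [/\ z *m A i = 0, w *m A j = 0, (z + w) *m A k = 0 & x = z + t *: w].
Proof.
move=> xi xj; rewrite evf_quad => /minor2_eq0[a [b [ab abE]]].
have [z [w [zi wj xE zE wE]]] := split_point x ij.
rewrite -zE -wE in abE.
have a0 : a != 0.
  apply: contraNneq xi => a0; move: ab abE; rewrite a0 xpair_eqE eqxx /= => b0.
  rewrite scale0r add0r => /eqP; rewrite scaler_eq0 (negbTE b0) /= => /eqP wk.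
  by rewrite xE (disjoint_eq0 dl jk wj wk) addr0 zi.
have b0 : b != 0.
  apply: contraNneq xj => b0; move: abE; rewrite b0 scale0r addr0 => /eqP.
  rewrite scaler_eq0 (negbTE a0) /= => /eqP zk.
  by rewrite xE (disjoint_eq0 dl ik zi zk) add0r wj.
exists z, ((b / a) *: w), (a / b); split=> //.
- by rewrite -scalemxAl wj scaler0.
- have -> : (z + (b / a) *: w) *m A k = a^-1 *: (a *: (z *m A k) + b *: (w *m A k)).
    by rewrite scalerDr !scalerA mulVf // scale1r mulmxDl -scalemxAl mulrC.
  by rewrite abE scaler0.
- by rewrite scalerA mulrA mulfVK // divff // scale1r.
Qed.

(** A point of the quadric outside the lines is on a line that meets all three;
    if [f] does not vanish on that line, [transversal_bound] applies. *)
Lemma quad_dichotomy d f : isform d f ->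
  (mult i f + mult j f + mult k f <= d)%N \/
  (forall x, (forall l, x *m A l != 0) -> evf x (quad i j k) = 0 -> evf x f = 0).
Proof.
move=> hf; have [|nb] := pselect ((mult i f + mult j f + mult k f <= d)%N); first by left.
right=> x gx /(quad_secant (gx i) (gx j))[z [w [t [zi wj zwk ->]]]].
apply: contrapT => nz; apply: nb; apply: (transversal_bound hf zi wj zwk).
by apply: contra_notN nz => /eqP s0; rewrite -seg_eval s0 horner0.
Qed.

Lemma mult_ge1 l f : f != 0 -> (forall x, x *m A l = 0 -> evf x f = 0) -> (0 < mult l f)%N.
Proof.
move=> f0 H; have [_] := multP A l f0; rewrite lt0n; apply: contra_notN => /eqP ->.
rewrite expr1; apply/divides_X/eqP; apply: contraT => /coef0_nonroot[u [w]].
rewrite -evD0 evD_Phi xpt_id scale0r addr0 -evfE H ?eqxx //.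
by rewrite -mulmxA (ker_lines dl) mulmx0.
Qed.

Lemma mult_eq0 l f x : x *m A l = 0 -> evf x f != 0 -> mult l f = 0%N.
Proof.
move=> xl fx; have f0 : f != 0 by apply: contraNneq fx => ->; rewrite evfE rmorph0.
apply/eqP; rewrite -leqn0 leqNgt; apply/negP => m0; case/eqP: fx.
have := order_dvd 0 'X f0 xl; rewrite map_mx0 scaler0 addr0.
have -> : evx polyC (map_mx polyC x) f = (evf x f)%:P.
  rewrite evfE /evx -[RHS]/(polyC (ev idfun (x ord0) f)) ev_hom.
  by apply: eq_ev => // c; rewrite mxE.
move/(dvdp_trans (dvdp_exp2l _ m0)); rewrite expr1 => /dvdpP[c cE].
by have := congr1 (horner^~ 0) cE; rewrite /= hornerC hornerM hornerX mulr0.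
Qed.

(** All the prime factors of the quadric divide [f], so they are associated
    to [f]. *)
Lemma quad_multiples f : prime_form f ->
  (forall x, (forall l, x *m A l != 0) -> evf x (quad i j k) = 0 -> evf x f = 0) ->
  quad i j k != 0 /\ exists r : nat, forall h eps,
    kap A h eps (quad i j k) = r%:Z * kap A h eps f.
Proof.
move=> [Pf _] H; have Q0 : quad i j k != 0.
  apply/eqP => Q0; have [x [fx gx]] := generic_good dl (pi_neq0 Pf).
  by case/eqP: fx; apply: H => //; rewrite Q0 evfE rmorph0.
split=> //; have [u [s [uu Ps E]]] := @ufd_mpoly F #|'I_4| _ Q0; exists (size s) => h eps.
have u0 : u != 0 by apply: contraTneq uu => ->; rewrite unitr0.
have assoc g : g \in s -> divides g f.
  move=> gs; apply: (surface_divides dl (Ps _ gs)) => x gx gx0; apply: H => //.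
  by rewrite E (big_rem g) //= !evfM gx0 mul0r mulr0.
have step (t : seq Mx) : {subset t <= s} -> kap A h eps (u * \prod_(p <- t) p) = (size t)%:Z * kap A h eps f.
  elim: t => [|g t IH] ts; first by rewrite big_nil mulr1 (kap_unit A h eps uu) mul0r.
  have gs : g \in s by apply: ts; rewrite mem_head.
  have t0 : u * \prod_(p <- t) p != 0.
    rewrite mulf_neq0 //; rewrite prodf_seq_neq0; apply/allP => p pt /=.
    by apply: pi_neq0; apply: Ps; apply: ts; rewrite inE pt orbT.
  rewrite big_cons mulrCA (kapM A h eps (pi_neq0 (Ps _ gs)) t0) IH; last first.
    by move=> p pt; apply: ts; rewrite inE pt orbT.
  rewrite (kap_assoc A h eps (Ps _ gs) Pf (assoc _ gs)) /=.
  by move: (size t) (kap A h eps f) => n c; rewrite -addn1 PoszD mulrDl mul1r addrC.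
by rewrite {1}E; apply: step.
Qed.

End Triple.
End Inequalities.

(** * The class of an effective divisor *)

Lemma mem_four (i j k l : 'I_4) : uniq [:: i; j; k; l] -> forall a, a \in [:: i; j; k; l].
Proof.
move=> u a; have [|| _ ->] := @uniq_min_size _ _ (enum 'I_4) u.
- by move=> b; rewrite mem_enum.
- by rewrite size_enum_ord.
by rewrite mem_enum.
Qed.

Lemma sum_four (S : nmodType) (x : 'I_4 -> S) i j k l : uniq [:: i; j; k; l] ->
  \sum_a x a = x i + x j + x k + x l.
Proof.
move=> u; have -> : \sum_a x a = \sum_(a <- [:: i; j; k; l]) x a.
  apply: perm_big; apply: uniq_perm => // [|a]; first exact: index_enum_uniq.
  by rewrite mem_index_enum (mem_four u).
by rewrite !big_cons big_nil addr0 !addrA.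
Qed.

Lemma others (i : 'I_4) : exists j k l, uniq [:: i; j; k; l].
Proof.
by case: i => -[|[|[|[|//]]]] hi;
   [exists 1, (inord 2), (inord 3)|exists 0, (inord 2), (inord 3)|exists 0, 1, (inord 3)|
    exists 0, 1, (inord 2)]; rewrite /= !inE -!val_eqE /= ?inordK.
Qed.

Lemma last_line (i j k : 'I_4) : i != j -> i != k -> j != k ->
  exists l, uniq [:: i; j; k; l].
Proof.
move=> ij ik jk; have [l hl] : exists l, l \notin [:: i; j; k].
  apply: contrapT => /forallNP H; have : (size (enum 'I_4) <= size [:: i; j; k])%N.
    by apply: uniq_leq_size (enum_uniq _) _ => a _; apply: contrapT => /negP; exact: H.
  by rewrite size_enum_ord.
exists l; move: hl; rewrite /= !inE !negb_or => /and3P[a b c].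
by rewrite ij ik jk ![_ == l]eq_sym a b c.
Qed.

Section Classes.
Variables (F : numClosedFieldType) (A : 'I_4 -> 'M[F]_(4, 2)).
Hypothesis dl : forall i j, i != j -> (row_mx (A i) (A j) : 'M_4) \in unitmx.
Hypothesis no_transversal_quadric : forall i j k l, uniq [:: i; j; k; l] ->
  exists2 x : 'rV[F]_4, x *m A l = 0 & evf x (quad A i j k) != 0.

Local Notation X := (blowup A).
Local Notation mult := (mult A).
Local Notation quad := (quad A).
Local Notation cl := (cl A).
Local Notation kap := (kap A).
Local Notation ker := (ker A).

Lemma quad_neq0 i j k : i != j -> i != k -> j != k -> quad i j k != 0.
Proof.
move=> ij ik jk; have [l u] := last_line ij ik jk.
have [x _] := no_transversal_quadric u.
by apply: contraNneq => ->; rewrite evfE rmorph0.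
Qed.

Lemma quad_mult_ge1 i j k : i != j -> i != k -> j != k ->
  [/\ 0 < mult i (quad i j k), 0 < mult j (quad i j k) & 0 < mult k (quad i j k)]%N.
Proof.
move=> ij ik jk; have Q0 := quad_neq0 ij ik jk.
split; apply: (mult_ge1 dl Q0) => x xl.
- exact: quad_line_i.
- exact: quad_line_j.
- exact: (quad_line_k dl ij).
Qed.

Lemma quad_mult i j k l : uniq [:: i; j; k; l] ->
  [/\ mult i (quad i j k) = 1, mult j (quad i j k) = 1, mult k (quad i j k) = 1 &
      mult l (quad i j k) = 0]%N.
Proof.
move=> u; have := u; rewrite /= !inE !negb_or => /and4P[/and3P[ij ik _] /andP[jk _] _ _].
have Q0 := quad_neq0 ij ik jk; have hQ := @quad_form _ A i j k.
have [h1 h2 h3] := quad_mult_ge1 ij ik jk.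
have [x xl Qx] := no_transversal_quadric u.
have b1 := pair_bound dl ij Q0 hQ; have b2 := pair_bound dl ik Q0 hQ.
have b3 := pair_bound dl jk Q0 hQ; rewrite (mult_eq0 dl xl Qx).
by move: (mult i _) (mult j _) (mult k _) h1 h2 h3 b1 b2 b3 => a b c *; split; lia.
Qed.

Lemma kap_degree d f : f != 0 -> isform d f -> kap 1 (fun=> 0) f = d%:Z.
Proof.
move=> f0 hf; rewrite /kap (form_degree f0 hf) mulr1 big1 ?subr0 // => i _.
by rewrite mulr0.
Qed.

Lemma kap_mult l f : kap 0 (fun j => - (j == l)%:Z) f = (mult l f)%:Z.
Proof.
rewrite /kap mulr0 sub0r (bigD1 l) //= eqxx big1 => [|j /negbTE ->].
  by rewrite addr0 mulrN1 opprK.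
by rewrite oppr0 mulr0.
Qed.

(** In the exceptional case the quadric through three lines is, up to a unit,
    the [r]-th power of [f], so that [r] times the class of [f] is
    [(2; 1, 1, 1, 0)]. *)
Lemma surface_inequalities d f : prime_form f -> isform d f ->
  [/\ forall i j, i != j -> (mult i f + mult j f <= d)%N,
      forall i, (\sum_k mult k f + mult i f <= 2 * d)%N &
      (2 * (\sum_k mult k f) <= 3 * d)%N].
Proof.
move=> Pf hf; have f0 := pi_neq0 Pf.1.
have pairs i j : i != j -> (mult i f + mult j f <= d)%N.
  by move=> ij; exact: pair_bound.
have sumE i j k l : uniq [:: i; j; k; l] ->
    (\sum_a mult a f = mult i f + mult j f + mult k f + mult l f)%N by exact: sum_four.
have [[i [j [k [ij ik jk H]]]]|triples] := pselect (exists i j k, [/\ i != j, i != k, j != k &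
    forall x, (forall l, x *m A l != 0) -> evf x (quad i j k) = 0 -> evf x f = 0]).
  have [Q0 [r rE]] := quad_multiples dl Pf H.
  have [l u] := last_line ij ik jk; have [mi mj mk ml] := quad_mult u.
  have := rE 1 (fun=> 0); rewrite !(kap_degree (d := 2) Q0 (@quad_form _ _ _ _ _)).
  rewrite (kap_degree f0 hf) => rd.
  have rm a : r%:Z * (mult a f)%:Z = (mult a (quad i j k))%:Z.
    have := rE 0 (fun j => - (j == a)%:Z); rewrite (kap_mult a f) => <-.
    exact: kap_mult.
  have := rm i; have := rm j; have := rm k; have := rm l; rewrite mi mj mk ml (sumE _ _ _ _ u).
  move=> rml rmk rmj rmi; split=> [//|a|].
    have := mem_four u a; rewrite !inE => /or4P[]/eqP ->; move: (mult i f) (mult j f) (mult k f) (mult l f) rd rml rmk rmj rmi; clear; nia.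
  by move: (mult i f) (mult j f) (mult k f) (mult l f) rd rml rmk rmj rmi; clear; nia.
have tri i j k : i != j -> i != k -> j != k -> (mult i f + mult j f + mult k f <= d)%N.
  move=> ij ik jk; have [//|H] := quad_dichotomy dl ij ik jk hf.
  by case: triples; exists i, j, k.
split=> [//|i|].
  have [j [k [l u]]] := others i; rewrite (sumE _ _ _ _ u).
  have := u; rewrite /= !inE !negb_or => /and4P[/and3P[ij ik il] /andP[jk jl] kl _].
  by have := tri _ _ _ ij ik jk; have := pairs _ _ il; lia.
have [j [k [l u]]] := others ord0; rewrite (sumE _ _ _ _ u).
have := u; rewrite /= !inE !negb_or => /and4P[/and3P[ij ik il] /andP[jk jl] kl _].
have := tri _ _ _ ij ik jk; have := tri _ _ _ ij il jl; have := tri _ _ _ ik il kl.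
by have := tri _ _ _ jk jl kl; lia.
Qed.

(** ** Nonnegative functionals *)

Definition nonneg_on_primes h eps :=
  forall V, prime_divisor bl_block X V -> 0 <= cl h eps V.

(** On the exceptional divisors the functional takes the values [eps i]. *)
Lemma nonneg_crit (h : nat) (eps : 'I_4 -> nat) :
  (forall f d, prime_form f -> isform d f -> (\sum_i mult i f * eps i <= d * h)%N) ->
  nonneg_on_primes h%:Z (fun i => (eps i)%:Z).
Proof.
move=> H V /(prime_divisorP dl)[[i ->]|[f Pf ->]]; first by rewrite cl_exc.
have [Pf1 [d hf]] := Pf; rewrite cl_strict // /kap (form_degree (pi_neq0 Pf1) hf).
have := H f d Pf hf; rewrite subr_ge0 => le.
have -> : \sum_i (mult i f)%:Z * (eps i)%:Z = (\sum_i mult i f * eps i)%N%:Z.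
  by rewrite (big_morph Posz PoszD (erefl _)); apply: eq_bigr => i _; rewrite PoszM.
by rewrite -PoszM lez_nat.
Qed.

(** ** Test curves *)

(** These functionals are intersection numbers with curves, and by [cl_linear]
    they span the space of the functionals [cl h eps]. *)
Definition test (k : option 'I_4) : set (bl_coord -> F) -> int :=
  if k is Some i then cl 0 (fun j => - (j == i)%:Z) else cl 1 (fun=> 0).

Definition weight (h : int) (eps : 'I_4 -> int) (k : option 'I_4) : int :=
  if k is Some i then - eps i else h.

Lemma kap_linear h eps f : kap h eps f = h * kap 1 (fun=> 0) f -
  \sum_i eps i * kap 0 (fun j => - (j == i)%:Z) f.
Proof.
rewrite {1}/kap; congr (_ - _); last by apply: eq_bigr => i _; rewrite kap_mult mulrC.
by rewrite /kap big1 ?subr0 ?mulr1 1?mulrC // => i _; rewrite mulr0.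
Qed.

Lemma cl_linear h eps V : cl h eps V = \sum_k weight h eps k * test k V.
Proof.
rewrite big_option /= /cl; case: pselect => [ex|_]; last first.
  rewrite !addr0 [X in h * X]big1 ?mulr0 ?add0r => [|i _]; last by rewrite mulr0.
  apply: eq_bigr => i _; rewrite addr0 (bigD1 i) //= eqxx big1 => [|j /negbTE ->].
    by rewrite addr0 mulrN1 mulrNN mulrC.
  by rewrite oppr0 mulr0.
rewrite [X in h * (X + _)]big1 ?add0r => [|i _]; last by rewrite mulr0.
set f := projT1 _; rewrite (kap_linear h eps f) addrCA; congr (_ + _).
rewrite -sumrN -big_split; apply: eq_bigr => i _ /=.
rewrite (bigD1 i) //= eqxx big1 => [|j /negbTE ->]; last by rewrite oppr0 mulr0.
rewrite addr0 mulrN1; move: (kap _ _ f) => q; ring.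
Qed.

Lemma pairing_linear (S : idomainType) (I : Type) (r : seq I) (a : I -> int)
    (c_ : I -> set (bl_coord -> F) -> int) c (D : set (bl_coord -> F) -> S) :
  (forall V, c V = \sum_(k <- r) a k * c_ k V) -> finsupp D ->
  pairing c D = \sum_(k <- r) (a k)%:~R * pairing (c_ k) D.
Proof.
move=> cE fD; rewrite (pairing_on _ (B := [set V | D V <> 0])) // fsbig_finite //.
have E k : pairing (c_ k) D = \sum_(V <- finmap.enum_fset (fset_set [set V | D V <> 0])) D V * (c_ k V)%:~R.
  by rewrite (pairing_on _ (B := [set V | D V <> 0])) // fsbig_finite.
under [RHS]eq_bigr do rewrite E mulr_sumr.
rewrite exchange_big; apply: eq_bigr => V _ /=.
rewrite cE rmorph_sum mulr_sumr; apply: eq_bigr => k _ /=.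
by rewrite rmorphM /= mulrCA.
Qed.

(** The rows of [ker ord0 + t *: ker 1] span such a line unless [t] is a root of
    one of finitely many polynomials. *)
Lemma exists_off_lines : exists N, off_lines A N.
Proof.
have i01 : (1 : 'I_4) != ord0 by [].
pose M i : 'M[{poly F}]_2 :=
  map_mx polyC (ker ord0 *m A i) + 'X *: map_mx polyC (ker 1 *m A i).
have evM i t : (\det (M i)).[t] = \det ((ker ord0 + t *: ker 1) *m A i).
  rewrite -[LHS]/(horner_eval t _) -det_map_mx; congr (\det _); apply/matrixP => a b.
  rewrite mulmxDl -scalemxAl /M; move: (ker ord0 *m A i) (ker 1 *m A i) => U W.
  by rewrite !mxE /= /horner_eval !hornerE.
have M0 i : i != ord0 -> \det (M i) != 0.
  move=> i0; apply/eqP => /(congr1 (horner^~ 0)); rewrite /= evM scale0r addr0 horner0.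
  by have := ker_unit dl i0; rewrite unitmxE unitfE => /negbTE H /eqP; rewrite H.
have [|t] := @poly_nonroot F ('X * \prod_(i | i != ord0) \det (M i)).
  by rewrite mulf_neq0 ?polyX_eq0 //; apply/prodf_neq0.
rewrite hornerM hornerX mulf_eq0 negb_or horner_prod => /andP[t0 /prodf_neq0 H].
exists (ker ord0 + t *: ker 1) => i; rewrite unitmxE unitfE.
have [->|i0] := eqVneq i ord0; last by rewrite -evM H.
rewrite mulmxDl ker_lines // add0r -scalemxAl -unitfE -unitmxE unitmxZ ?unitfE //.
by apply: ker_unit; rewrite // eq_sym.
Qed.

Lemma test_curve k : exists C, curve bl_block X C /\ intersection_numbers bl_block X C (test k).
Proof.
case: k => [i|] /=.
  exists (fibC A i (delta_mx ord0 ord0) 1%:M).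
  have u0 : delta_mx ord0 ord0 != 0 :> 'rV[F]_2.
    by apply/rv_neq0; exists ord0; rewrite mxE !eqxx oner_neq0.
  by split; [apply: fibC_curve|apply: fib_numbers]; rewrite // unitmx1.
have [N HN] := exists_off_lines; exists (lineC A N).
by split; [exact: lineC_curve|exact: line_numbers].
Qed.

Lemma num_equiv_class (S : idomainType) (D D' : set (bl_coord -> F) -> S) h eps :
  finsupp D -> finsupp D' -> num_equiv bl_block X D D' ->
  pairing (cl h eps) D = pairing (cl h eps) D'.
Proof.
move=> fD fD' H; rewrite !(pairing_linear (cl_linear h eps)) //.
apply: eq_bigr => k _; congr (_ * _); have [C [cC nC]] := test_curve k.
exact: H cC nC.
Qed.

Lemma effective_nonneg (R : realType) h eps (E : set (bl_coord -> F) -> nat) :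
  nonneg_on_primes h eps -> effective_divisor bl_block X E ->
  exists2 x : R, paired (cl h eps) (fun V => (E V)%:R) x & 0 <= x.
Proof.
move=> nn [fE pE]; have sub V : (E V)%:R <> 0 :> R -> E V <> 0%N by move=> h1 h2; apply: h1; rewrite h2.
have fD : finsupp (fun V => (E V)%:R : R) by apply: sub_finite_set fE => V /sub.
exists (pairing (cl h eps) (fun V => (E V)%:R : R)) => //.
rewrite (pairing_on _ (B := [set V | E V <> 0%N])) // fsbig_finite //.
rewrite big_seq; apply: sumr_ge0 => V; rewrite in_fset_set // inE => /pE pV.
by rewrite mulr_ge0 // ?ler0n // ler0z nn.
Qed.

Lemma divisor_effective e P : mhomog bl_block e P -> Psi A P != 0 ->
  effective_divisor bl_block X (divisor_of bl_block X P).
Proof.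
move=> he P0; have [fD _] := divisor_paired dl 0 (fun=> 0) he P0; split.
  by apply: sub_finite_set fD => V /= h [].
by move=> V; rewrite /divisor_of; case: asboolP.
Qed.

End Classes.

(** * The effective cone *)

Lemma has_ordX (D : idomainType) (pi a : D) n e : prime_elt pi -> has_ord pi n a ->
  has_ord pi (e * n) (a ^+ e).
Proof.
move=> Pp hn; elim: e => [|e IH]; last by rewrite mulSn exprS; apply: has_ordM.
by apply: (has_ord0 Pp) => /(prime_nunit Pp); rewrite expr0 unitr1.
Qed.

Definition cone_inequalities (R : realFieldType) (d : R) (m : 'I_4 -> R) :=
  [/\ 0 <= d, forall i, m i <= d, forall i j, i != j -> m i + m j <= d,
      forall i, \sum_(k < 4) m k + m i <= 2 * d & 2 * (\sum_(k < 4) m k) <= 3 * d].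

Section Cone.
Variables (F : numClosedFieldType) (A : 'I_4 -> 'M[F]_(4, 2)).
Hypothesis dl : forall i j, i != j -> (row_mx (A i) (A j) : 'M_4) \in unitmx.
Hypothesis no_transversal_quadric : forall i j k l, uniq [:: i; j; k; l] ->
  exists2 x : 'rV[F]_4, x *m A l = 0 & evf x (quad A i j k) != 0.
Variables (h : 'rV[F]_4) (R : realType).
Hypothesis h_neq0 : h != 0.

Local Notation Mx := (mpolyT F 'I_4).
Local Notation X := (blowup A).
Local Notation mult := (mult A).
Local Notation quad := (quad A).
Local Notation cl := (cl A).
Local Notation exc := (exc A).
Local Notation Psi := (Psi A).
Local Notation dv := (divisor_of bl_block X).
Local Notation sets := (set (bl_coord -> F)).

Definition plane : Mx := \sum_j pcst 'I_4 (h ord0 j) * var F j.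

Lemma plane_form : isform 1 plane.
Proof.
rewrite /plane; elim/big_ind: _ => [|f g|j _]; first exact: whom0.
  exact: whomD.
by apply: (@whomM _ _ _ 0 1); [exact: whom_cst|exact: (@whom_var F 'I_4 (fun=> 1%N))].
Qed.

Lemma plane_neq0 : plane != 0.
Proof.
have /rv_neq0[j hj] := h_neq0; apply/eqP => /(congr1 (evf (delta_mx ord0 j))).
rewrite /evf peval_sum (bigD1 j) //= big1 => [|k /negbTE kj].
  rewrite pevalM peval_cst peval_var mxE !eqxx mulr1 addr0 -/(evf _ _) evfE rmorph0.
  by move/eqP; rewrite (negbTE hj).
by rewrite pevalM peval_var mxE kj andbF mulr0.
Qed.

Lemma plane_divisorE : plane_divisor A h = dv (pullx plane).
Proof.
rewrite /plane_divisor; congr divisor_of; rewrite rmorph_sum.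
apply: eq_bigr => j _; rewrite rmorphM /= /pullx /evx ev_cst ev_var mxE.
by rewrite /pcst /= mul_mpolyC.
Qed.

Lemma pull_neq0 f : f != 0 -> Psi (pullx f) != 0.
Proof. by rewrite Psi_pullx. Qed.

Definition planeZ (V : sets) : int := (plane_divisor A h V)%:Z.

Lemma plane_paired h' eps : paired (cl h' eps) planeZ h'.
Proof.
have := divisor_paired dl h' eps (mhomog_pullx plane_form) (pull_neq0 plane_neq0).
apply: eq_paired => [V|]; first by rewrite /planeZ plane_divisorE.
by rewrite big_option /= big1 // addn0 mul1r big1 ?subr0 // => i _; rewrite mul0r.
Qed.

Lemma finsupp_plane : finsupp planeZ.
Proof. by have [] := plane_paired 0 (fun=> 0). Qed.

Lemma planeZ_paired c : paired c planeZ (pairing c planeZ).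
Proof. by split; first exact: finsupp_plane. Qed.

Definition class (d : R) (m : 'I_4 -> R) (V : sets) : R :=
  d * (plane_divisor A h V)%:R - \sum_(i < 4) m i * (exceptional_divisor A i V)%:R.

Lemma class_paired c d m :
  paired c (class d m) (d * (pairing c planeZ)%:~R - \sum_i m i * (c (exc i))%:~R).
Proof.
have H1 := planeZ_paired c.
have := pairedZ d (paired_intr R H1) => {}H1.
have H2 i : paired c (fun V => (`[< V = exc i >] : nat)%:R : R) (c (exc i))%:~R.
  rewrite -[X in paired _ _ X]mul1r.
  by apply: paired_single => [|V nV]; [rewrite asboolT|rewrite asboolF].
have H3 := paired_sum (index_enum 'I_4) (fun i => pairedZ (m i) (H2 i)).
apply: eq_paired (pairedD H1 (pairedZ (-1) H3)) => [V|]; rewrite mulN1r //.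
Qed.

(** ** Necessity of the inequalities *)

(** Every effective divisor has a nonnegative value, and this value only
    depends on the class. *)
Lemma cone_functional d m (h' : nat) (eps : 'I_4 -> nat) :
  nonneg_on_primes A h'%:Z (fun i => (eps i)%:Z) ->
  in_effective_cone bl_block X (class d m) -> \sum_i m i * (eps i)%:R <= d * h'%:R.
Proof.
move=> nn [r [a [E [a0 eE nE]]]]; set c := cl h'%:Z (fun i => (eps i)%:Z).
have /choice[x xE] : forall k, exists x : R, paired c (fun V => (E k V)%:R) x /\ 0 <= x.
  by move=> k; have [x] := effective_nonneg R nn (eE k); exists x.
have HE := paired_sum (index_enum 'I_r) (fun k => pairedZ (a k) (xE k).1).
have HD := class_paired c d m.
have := num_equiv_class dl h'%:Z (fun i => (eps i)%:Z) HD.1 HE.1 nE.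
rewrite -/c HD.2 HE.2 (plane_paired _ _).2 => eq; rewrite -subr_ge0.
have -> : d * h'%:R - \sum_i m i * (eps i)%:R = \sum_k a k * x k.
  rewrite -eq pmulrn; congr (_ - _); apply: eq_bigr => i _.
  by rewrite /c cl_exc // pmulrn.
by apply: sumr_ge0 => k _; rewrite mulr_ge0 //; have [] := xE k.
Qed.

Lemma sum_delta (S : pzSemiRingType) (x : 'I_4 -> S) i : \sum_k x k * ((k == i) : nat)%:R = x i.
Proof.
rewrite (bigD1 i) //= eqxx mulr1 big1 ?addr0 // => j /negbTE ->.
by rewrite mulr0.
Qed.

Lemma sum_deltan (x : 'I_4 -> nat) i : (\sum_k x k * (k == i) = x i)%N.
Proof.
rewrite (bigD1 i) //= eqxx muln1 big1 ?addn0 // => j /negbTE ->.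
by rewrite muln0.
Qed.

Theorem cone_necessary d m :
  in_effective_cone bl_block X (class d m) -> cone_inequalities d m.
Proof.
move=> H; have bounds := surface_inequalities dl no_transversal_quadric.
split=> [|i|i j ij|i|].
- have := @cone_functional d m 1 (fun=> 0%N) _ H; rewrite mulr1 big1 => [|i _]; last by rewrite mulr0.
  apply; apply: nonneg_crit => // f e Pf hf; rewrite big1 // => i _; exact: muln0.
- have := @cone_functional d m 1 (fun k => (k == i) : nat) _ H; rewrite mulr1 sum_delta.
  apply; apply: nonneg_crit => // f e Pf hf; rewrite sum_deltan muln1.
  have [j [k [l u]]] := others i; have [pairs _ _] := bounds _ _ Pf hf.
  have ij : i != j by move: u; rewrite /= !inE !negb_or => /and4P[/and3P[]].
  by apply: leq_trans (pairs _ _ ij); rewrite leq_addr.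
- have := @cone_functional d m 1 (fun k => ((k == i) + (k == j))%N) _ H.
  have -> : \sum_k m k * ((k == i) + (k == j))%N%:R = m i + m j.
    rewrite -(sum_delta m i) -(sum_delta m j) -big_split; apply: eq_bigr => k _.
    by rewrite natrD mulrDr.
  rewrite mulr1; apply; apply: nonneg_crit => // f e Pf hf; rewrite muln1.
  have [pairs _ _] := bounds _ _ Pf hf; apply: leq_trans (pairs _ _ ij).
  rewrite -(sum_deltan (fun k => mult k f) i) -(sum_deltan (fun k => mult k f) j) -big_split /=.
  by rewrite leq_sum // => k _; rewrite mulnDr.
- have := @cone_functional d m 2 (fun k => (1 + (k == i))%N) _ H.
  have -> : \sum_k m k * (1 + (k == i))%N%:R = \sum_k m k + m i.
    rewrite -[X in _ + X](sum_delta m i) -big_split; apply: eq_bigr => k _.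
    by rewrite natrD mulrDr mulr1.
  rewrite [d * _]mulrC; apply; apply: nonneg_crit => // f e Pf hf; rewrite mulnC.
  have [_ H2 _] := bounds _ _ Pf hf; apply: leq_trans (H2 i).
  rewrite -[X in (_ <= _ + X)%N](sum_deltan (fun k => mult k f) i) -big_split /=.
  by rewrite leq_sum // => k _; rewrite mulnDr muln1.
have := @cone_functional d m 3 (fun=> 2%N) _ H.
rewrite -mulr_suml [_ * 2]mulrC [d * _]mulrC; apply; apply: nonneg_crit => // f e Pf hf.
by have [_ _ H3] := bounds _ _ Pf hf; rewrite -big_distrl /= mulnC [(e * 3)%N]mulnC.
Qed.

(** ** Classes of effective divisors *)

(** Classes of combinations of effective divisors, in terms of the values of
    every [c] that is compatible with linear equivalence. *)
Definition cone_class (d : R) (m : 'I_4 -> R) :=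
  exists (r : nat) (a : 'I_r -> R) (E : 'I_r -> sets -> nat),
    [/\ forall k, 0 <= a k, forall k, effective_divisor bl_block X (E k) &
        forall C c, intersection_numbers bl_block X C c ->
          paired c (fun V => \sum_(k < r) a k * (E k V)%:R)
            (d * (pairing c planeZ)%:~R - \sum_i m i * (c (exc i))%:~R)].

Lemma cone_class_sufficient d m : cone_class d m ->
  in_effective_cone bl_block X (class d m).
Proof.
move=> [r [a [E [a0 eE nE]]]]; exists r, a, E; split=> // C c _ nC.
by have [_ ->] := nE C c nC; have [_ ->] := class_paired c d m.
Qed.

Lemma eq_cone_class d d' m m' : d = d' -> m =1 m' -> cone_class d m -> cone_class d' m'.
Proof. by move=> -> /funext ->. Qed.

Lemma cone_class0 : cone_class 0 (fun=> 0).
Proof.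
exists 0%N, (fun=> 0), (fun=> fun=> 0%N); split=> [k|[]//|C c _]; first exact: lexx.
apply: eq_paired (paired0 c R) => [V|]; first by rewrite big_ord0.
by rewrite mul0r big1 ?subr0 // => i _; rewrite mul0r.
Qed.

Lemma cone_classZ t d m : 0 <= t -> cone_class d m -> cone_class (t * d) (fun i => t * m i).
Proof.
move=> t0 [r [a [E [a0 eE nE]]]]; exists r, (fun k => t * a k), E; split=> // [k|C c nC].
  exact: mulr_ge0.
apply: eq_paired (pairedZ t (nE C c nC)) => [V|].
  by rewrite mulr_sumr; apply: eq_bigr => k _; rewrite mulrA.
rewrite mulrBr mulrA mulr_sumr; congr (_ - _); apply: eq_bigr => i _; exact: mulrA.
Qed.

Lemma cone_classD d m d' m' : cone_class d m -> cone_class d' m' ->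
  cone_class (d + d') (fun i => m i + m' i).
Proof.
move=> [r [a [E [a0 eE nE]]]] [r' [a' [E' [a0' eE' nE']]]].
exists (r + r')%N, (fun k => match fintype.split k with inl k => a k | inr k => a' k end),
  (fun k => match fintype.split k with inl k => E k | inr k => E' k end).
split=> [k|k|C c nC]; try by case: (fintype.split k).
apply: eq_paired (pairedD (nE C c nC) (nE' C c nC)) => [V|].
  rewrite big_split_ord /=; congr (_ + _); apply: eq_bigr => k _.
    by rewrite (unsplitK (inl k)).
  by rewrite (unsplitK (inr k)).
rewrite mulrDl; set p := pairing _ _; set S := \sum_(i < 4) m i * _.
set S' := \sum_(i < 4) m' i * _; have -> : \sum_i (m i + m' i) * (c (exc i))%:~R = S + S'.
  by rewrite /S /S' -big_split; apply: eq_bigr => i _; rewrite mulrDl.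
by ring.
Qed.

Lemma cone_class_single (E : sets -> nat) (d : nat) (m : 'I_4 -> int) :
  effective_divisor bl_block X E ->
  (forall C c, intersection_numbers bl_block X C c ->
     paired c (fun V => (E V)%:Z) (d%:Z * pairing c planeZ - \sum_i m i * c (exc i))) ->
  cone_class d%:R (fun i => (m i)%:~R).
Proof.
move=> eE nE; exists 1%N, (fun=> 1), (fun=> E); split=> // C c /nE/(paired_intr R).
apply: eq_paired => [V|]; first by rewrite big_ord1 mul1r -pmulrn.
rewrite rmorphB rmorphM /= -pmulrn; congr (_ - _).
by rewrite rmorph_sum; apply: eq_bigr => i _; rewrite rmorphM.
Qed.

Lemma cone_class_exc i : cone_class 0 (fun k => - (k == i)%:R).
Proof.
have pE := prime_exc dl i.
apply: (@eq_cone_class 0%:R _ (fun k => (- (k == i)%:Z)%:~R)) => [//|k|].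
  by rewrite mulrNz.
apply: (@cone_class_single (fun V => `[< V = exc i >] : nat)) => [|C c _].
- split=> [|V]; last by case: asboolP => // ->.
  by apply: sub_finite_set (finite_set1 (exc i)) => V /=; case: asboolP.
- rewrite mul0r sub0r (bigD1 i) //= eqxx big1 => [|j /negbTE ->]; last by rewrite oppr0 mul0r.
  rewrite addr0 mulN1r opprK -[c _]mul1r -{1}[c _]intz.
  by apply: paired_single => [|V nV]; [rewrite asboolT|rewrite asboolF].
Qed.

Lemma multX i n f : f != 0 -> mult i (f ^+ n) = (n * mult i f)%N.
Proof.
move=> f0; elim: n => [|n IH]; first exact: mult_unit (unitr1 _).
by rewrite exprS (multM A i f0 (expf_neq0 n f0)) IH mulSn.
Qed.

Lemma divisorX e P n V : mhomog bl_block e P -> Psi P != 0 -> dv (P ^+ n) V = (n * dv P V)%N.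
Proof.
move=> he P0; have hX := mhomogX (n := n) he.
have PX0 : Psi (P ^+ n) != 0 by rewrite rmorphXn expf_neq0.
have [pV|npV] := pselect (prime_divisor bl_block X V); last first.
  by rewrite /divisor_of !asboolF ?muln0.
have [[i ->]|[f Pf ->]] := prime_divisorP dl pV.
  apply/eqP; rewrite -(eqn_add2l (n * e (Some i))) -(divisor_exc dl i hX PX0) -mulnDr.
  by rewrite -(divisor_exc dl i he P0) rmorphXn /= (multX i n P0).
have [Pf1 _] := Pf; have [k hk] := prime_has_ord Pf1 P0.
rewrite (divisor_strict dl Pf he hk); apply: (divisor_strict dl Pf hX).
by rewrite rmorphXn; exact: has_ordX.
Qed.

(** The divisor of [f] is linearly equivalent to [d] times the plane section. *)
Lemma form_pairing C c d f : f != 0 -> isform d f -> intersection_numbers bl_block X C c ->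
  paired c (fun V => (dv (pullx f) V)%:Z) (d%:Z * pairing c planeZ).
Proof.
move=> f0 hf [_ prin]; have hP := mhomog_pullx hf.
have hQ : mhomog bl_block (deg0 d) (pullx plane ^+ d).
  apply: eq_mhomog _ (mhomogX (n := d) (mhomog_pullx plane_form)) => -[j|] /=.
    exact: muln0.
  exact: muln1.
have nv P : Psi P != 0 -> ~ vanishing_ideal X P by move=> P0 /(vanishes_Psi0 dl)/eqP; rewrite (negbTE P0).
have pl0 := pull_neq0 plane_neq0.
have nvP := nv _ (pull_neq0 f0).
have nvQ : ~ vanishing_ideal X (pullx plane ^+ d).
  by apply: nv; rewrite rmorphXn expf_neq0.
have := prin _ _ _ hP hQ nvP nvQ => E0.
have fD : finsupp (fun V => (dv (pullx f) V)%:Z).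
  by have [] := divisor_paired dl 0 (fun=> 0) hP (pull_neq0 f0).
split=> //; have H1 : paired c (fun V => (dv (pullx f) V)%:Z) (pairing c (fun V => (dv (pullx f) V)%:Z)) by [].
have H2 := planeZ_paired c.
have [_ E1] := pairedD H1 (pairedZ (- d%:Z) H2); move: E1.
have -> : (fun V => (dv (pullx f) V)%:Z + - d%:Z * planeZ V) =
    (fun V => (dv (pullx f) V)%:Z - (dv (pullx plane ^+ d) V)%:Z).
  apply/funext => V; rewrite (divisorX d V (mhomog_pullx plane_form) pl0) PoszM.
  by rewrite /planeZ plane_divisorE mulNr.
by rewrite E0 mulNr => /esym/eqP; rewrite subr_eq0 => /eqP.
Qed.

(** Subtract from the pull-back of [f = 0] as many copies of the exceptional
    divisors as its multiplicities allow. *)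
Lemma cone_class_form d f (s : 'I_4 -> nat) : f != 0 -> isform d f ->
  (forall i, (s i <= mult i f)%N) -> cone_class d%:R (fun i => (s i)%:R).
Proof.
move=> f0 hf sm; have hP := mhomog_pullx hf; have P0 := pull_neq0 f0.
pose D V : nat := (\sum_i s i * (`[< V = exc i >] : nat))%N.
have Dexc i : D (exc i) = s i.
  rewrite /D (bigD1 i) //= asboolT // muln1 big1 ?addn0 // => j ji.
  by rewrite asboolF ?muln0 // => /(exc_inj dl) E; rewrite E eqxx in ji.
have D0 V : (forall i, V <> exc i) -> D V = 0%N.
  by move=> nV; rewrite /D big1 // => i _; rewrite asboolF ?muln0 //; exact: nV.
have le V : (D V <= dv (pullx f) V)%N.
  have [ex|nE] := pselect (exists i, V = exc i).
    case: ex => i ->; rewrite Dexc; have := divisor_exc dl i hP P0.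
    by rewrite Psi_pullx /= add0n => <-; exact: sm.
  by rewrite (D0 V) // => i E; case: nE; exists i.
have [fD pD] := divisor_effective dl hP P0.
apply: (@cone_class_single (fun V => dv (pullx f) V - D V)%N d (fun i => (s i)%:Z)) => [|C c nC].
- split=> [|V h1]; last by apply: pD => h2; apply: h1; rewrite h2.
  by apply: sub_finite_set fD => V /= h1 h2; apply: h1; rewrite h2.
- have H1 := form_pairing f0 hf nC.
  have H2 i : paired c (fun V => (`[< V = exc i >] : nat)%:Z) (c (exc i)).
    have -> : c (exc i) = 1 * (c (exc i))%:~R by rewrite mul1r intz.
    by apply: paired_single => [|V nV]; [rewrite asboolT|rewrite asboolF].
  have H3 := paired_sum (index_enum 'I_4) (fun i => pairedZ (s i)%:Z (H2 i)).
  apply: eq_paired (pairedD H1 (pairedZ (-1) H3)) => [V|]; rewrite mulN1r //.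
  rewrite -subzn ?le //; congr (_ - _).
  by rewrite /D (big_morph Posz PoszD (erefl _)); apply: eq_bigr => i _; rewrite PoszM.
Qed.

Lemma cone_class_plane i : cone_class 1 (fun k => (k == i)%:R).
Proof.
apply: (@cone_class_form 1 (lform A i ord0) (fun k => (k == i) : nat)).
- exact: lform_neq0.
- exact: lform_isform.
move=> k; case: eqVneq => // ->; apply: (mult_ge1 dl); first exact: lform_neq0.
by move=> x xi; rewrite evf_lform xi mxE.
Qed.

Lemma cone_class_quadric i j k : i != j -> i != k -> j != k ->
  cone_class 2 (fun a => (a \in [:: i; j; k])%:R).
Proof.
move=> ij ik jk; apply: (@cone_class_form 2 (quad i j k) (fun a => (a \in [:: i; j; k]) : nat)).
- exact: quad_neq0.
- exact: quad_form.
move=> a; have [h1 h2 h3] := quad_mult_ge1 dl no_transversal_quadric ij ik jk.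
have H : a \in [:: i; j; k] -> (0 < mult a (quad i j k))%N.
  by rewrite !inE => /or3P[]/eqP ->; [exact: h1|exact: h2|exact: h3].
by case: (a \in _) H => [H|_]; [exact: (H isT)|exact: leq0n].
Qed.

End Cone.

(** * Generators of the cone *)

Lemma four_values (T : Type) (i j k l : 'I_4) (a b c d : T) : uniq [:: i; j; k; l] ->
  exists q : 'I_4 -> T, [/\ q i = a, q j = b, q k = c & q l = d].
Proof.
rewrite /= !inE !negb_or => /and4P[/and3P[ij ik il] /andP[jk jl] kl _].
exists (fun v => if v == i then a else if v == j then b else if v == k then c else d).
by rewrite !eqxx (eq_sym j i) (eq_sym k i) (eq_sym l i) (eq_sym k j) (eq_sym l j) (eq_sym l k)
  !(negbTE ij) !(negbTE ik) !(negbTE il) !(negbTE jk) !(negbTE jl) !(negbTE kl).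
Qed.

Lemma all_four (P : 'I_4 -> Prop) i j k l : uniq [:: i; j; k; l] ->
  P i -> P j -> P k -> P l -> forall a, P a.
Proof.
by move=> u Pi Pj Pk Pl a; have := mem_four u a; rewrite !inE => /or4P[]/eqP ->.
Qed.

Section Generators.
Variable R : realFieldType.

(** The class with the negative multiplicities replaced by zero differs from the
    given one by exceptional divisors. *)
Lemma inequalities_pos d (m : 'I_4 -> R) : cone_inequalities d m ->
  cone_inequalities d (fun i => Num.max (m i) 0).
Proof.
move=> [d0 md pairs tri tot].
have mx a : Num.max (m a) 0 = m a /\ 0 <= m a \/ Num.max (m a) 0 = 0 /\ m a <= 0.
  by case: (lerP (m a) 0) => h; [right|left; split=> //; exact: ltW].
have facts i j k l : uniq [:: i; j; k; l] ->
    \sum_a Num.max (m a) 0 + Num.max (m i) 0 <= 2 * d /\ 2 * (\sum_a Num.max (m a) 0) <= 3 * d.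
  move=> u; have sE x := sum_four (S := R) x u.
  have := u; rewrite /= !inE !negb_or => /and4P[/and3P[ij ik il] /andP[jk jl] kl _].
  move: (tri i) tot; rewrite !sE.
  move: (pairs _ _ ij) (pairs _ _ ik) (pairs _ _ il) (pairs _ _ jk) (pairs _ _ jl) (pairs _ _ kl).
  move: (md i) (md j) (md k) (md l).
  by case: (mx i) => -[-> ?]; case: (mx j) => -[-> ?]; case: (mx k) => -[-> ?];
     case: (mx l) => -[-> ?] *; split; lra.
split=> // [i|i j ij|i|].
- by case: (mx i) => -[-> ?].
- by have := pairs _ _ ij; have := md i; have := md j; case: (mx i) (mx j) => -[-> ?] [] [-> ?]; lra.
- by have [j [k [l u]]] := others i; have [] := facts _ _ _ _ u.
- by have [j [k [l u]]] := others ord0; have [] := facts _ _ _ _ u.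
Qed.

(** The coefficient [q i] is that of the quadric through the lines other than
    the [i]-th, and [x i] that of a plane through the [i]-th line. *)
Lemma decompose_pos d (m : 'I_4 -> R) : cone_inequalities d m -> (forall i, 0 <= m i) ->
  exists q x : 'I_4 -> R, [/\ forall i, 0 <= q i, forall i, 0 <= x i,
    2 * \sum_i q i + \sum_i x i <= d & forall i, m i = \sum_k q k - q i + x i].
Proof.
move=> [d0 md pairs tri tot] m0; set S := \sum_i m i.
have [A|] := pselect (forall i, 3 * m i <= S).
  (* Quadrics suffice. *)
  have sq : \sum_i (S / 3 - m i) = S / 3.
    by rewrite sumrB sumr_const card_ord -/S -mulr_natl; field.
  exists (fun i => S / 3 - m i), (fun=> 0); rewrite sq big1 //.
  by split=> // [i||i]; [have := A i; lra|move: tot; rewrite -/S; lra|lra].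
move=> /existsNP[i /negP]; rewrite -ltNge /S => big.
have [j0 [k0 [l0 u0]]] := others i.
(* The [i]-th line carries more than its share, so every quadric contains it,
   and the surplus [x i] comes from planes. *)
have [tr|ntr] := pselect (m j0 <= m k0 + m l0 /\ m k0 <= m j0 + m l0 /\ m l0 <= m j0 + m k0).
  have [q [qi qj qk ql]] := four_values 0 ((m k0 + m l0 - m j0) / 2)
    ((m j0 + m l0 - m k0) / 2) ((m j0 + m k0 - m l0) / 2) u0.
  have [x [xi xj xk xl]] := four_values (m i - (m j0 + m k0 + m l0) / 2) 0 0 0 u0.
  have := tri i; move: big; rewrite (sum_four m u0) => big tri_i.
  exists q, x; rewrite (sum_four q u0) (sum_four x u0) qi qj qk ql xi xj xk xl.
  by split; [| |lra|]; apply: (all_four u0);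
    rewrite ?qi ?qj ?qk ?ql ?xi ?xj ?xk ?xl ?lexx //; lra.
have [j [k [l [u lt]]]] : exists j k l, uniq [:: i; j; k; l] /\ m k + m l < m j.
  have rot a b c : uniq [:: i; a; b; c] -> uniq [:: i; b; c; a].
    rewrite /= !inE !negb_or => /and4P[/and3P[-> -> ->] /andP[ab ac] -> _].
    by rewrite (eq_sym b a) (eq_sym c a) ab ac.
  have [lt|nj] := boolP (m k0 + m l0 < m j0); first by exists j0, k0, l0.
  have [lt|nk] := boolP (m l0 + m j0 < m k0).
    by exists k0, l0, j0; split=> //; apply: rot.
  have [lt|nl] := boolP (m j0 + m k0 < m l0).
    by exists l0, j0, k0; split=> //; exact: (rot _ _ _ (rot _ _ _ u0)).
  by case: ntr; move: nj nk nl; rewrite -!leNgt; lra.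
(* The [j]-th line also exceeds the two others: only the quadrics through the
   [i]-th and [j]-th lines occur, and planes make up for the rest. *)
have [q [qi qj qk ql]] := four_values 0 0 (m l) (m k) u.
have [x [xi xj xk xl]] := four_values (m i - m k - m l) (m j - m k - m l) 0 0 u.
have ij : i != j by move: u; rewrite /= !inE !negb_or => /and4P[/and3P[]].
move: big (m0 k) (m0 l) (pairs _ _ ij); rewrite (sum_four m u) => big k_ge0 l_ge0 pair.
exists q, x; rewrite (sum_four q u) (sum_four x u) qi qj qk ql xi xj xk xl.
by split; [| |lra|]; apply: (all_four u); rewrite ?qi ?qj ?qk ?ql ?xi ?xj ?xk ?xl ?lexx //; lra.
Qed.

Variable P : R -> ('I_4 -> R) -> Prop.
Hypothesis P_ext : forall d d' m m', d = d' -> m =1 m' -> P d m -> P d' m'.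
Hypothesis P_zero : P 0 (fun=> 0).
Hypothesis P_scale : forall t d m, 0 <= t -> P d m -> P (t * d) (fun i => t * m i).
Hypothesis P_add : forall d m d' m', P d m -> P d' m' -> P (d + d') (fun i => m i + m' i).
Hypothesis P_exc : forall i, P 0 (fun k => - (k == i)%:R).
Hypothesis P_plane : forall i, P 1 (fun k => (k == i)%:R).
Hypothesis P_quadric : forall i j k, i != j -> i != k -> j != k ->
  P 2 (fun a => (a \in [:: i; j; k])%:R).

Lemma P_omit i : P 2 (fun a => (a != i)%:R).
Proof.
have [j [k [l u]]] := others i.
have := u; rewrite /= !inE !negb_or => /and4P[/and3P[ij ik il] /andP[jk jl] kl _].
apply: P_ext (P_quadric jk jl kl) => // a; congr (_ : bool)%:R.
have := mem_four u a; rewrite !inE; case: eqVneq => [->|//] _.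
by rewrite (negbTE ij) (negbTE ik) (negbTE il).
Qed.

Lemma P_sum (d : 'I_4 -> R) (m : 'I_4 -> 'I_4 -> R) : (forall i, P (d i) (m i)) ->
  P (\sum_i d i) (fun a => \sum_i m i a).
Proof.
move=> H; elim: (index_enum _) => [|i r IH].
  by apply: P_ext P_zero => [|a]; rewrite big_nil.
by apply: P_ext (P_add (H i) IH) => [|a]; rewrite big_cons.
Qed.

Lemma sum_pick (x : 'I_4 -> R) a : \sum_i x i * (a == i)%:R = x a.
Proof.
rewrite (bigD1 a) //= eqxx mulr1 big1 ?addr0 // => j /negbTE ja.
by rewrite eq_sym ja mulr0.
Qed.

Theorem generated d m : cone_inequalities d m -> P d m.
Proof.
move=> /inequalities_pos H; set m' := fun i => Num.max (m i) 0 in H.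
have [|q [x [q0 x0 le mE]]] := decompose_pos H.
  by move=> i; rewrite /m' le_max lexx orbT.
set d' := 2 * _ + _ in le.
have H1 := P_sum (fun i => P_scale (q0 i) (P_omit i)).
have H2 := P_sum (fun i => P_scale (x0 i) (P_plane i)).
have P1 : P 1 (fun=> 0).
  apply: P_ext (P_add (P_plane ord0) (P_exc ord0)) => [|a]; first by rewrite addr0.
  by rewrite subrr.
have e0 i : 0 <= m' i - m i by rewrite subr_ge0 le_max lexx.
have H3 := P_sum (fun i => P_scale (e0 i) (P_exc i)).
have dd : 0 <= d - d' by rewrite subr_ge0.
apply: P_ext (P_add (P_add (P_add H1 H2) H3) (P_scale dd P1)) => [|a].
  rewrite -!mulr_suml !mulr1 mulr0 addr0 /d'; ring.
rewrite mulr0 addr0 sum_pick.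
have -> : \sum_i (m' i - m i) * - (a == i)%:R = - (m' a - m a).
  by rewrite -(sum_pick (fun i => m' i - m i)) -sumrN; apply: eq_bigr => i _; rewrite mulrN.
have -> : \sum_i q i * (a != i)%:R = \sum_i q i - q a.
  rewrite -(sum_pick q a) -sumrB; apply: eq_bigr => i _.
  by case: (a == i); rewrite /= ?mulr1 ?mulr0 ?subrr ?subr0.
by have := mE a; lra.
Qed.

End Generators.

(** * The condition on the lines *)

Lemma det3E (F : comNzRingType) (m : nat -> nat -> F) : \det (\matrix_(i < 3, j < 3) m i j) =
  m 0 0 * (m 1 1 * m 2 2 - m 1 2 * m 2 1) - m 0 1 * (m 1 0 * m 2 2 - m 1 2 * m 2 0)
  + m 0 2 * (m 1 0 * m 2 1 - m 1 1 * m 2 0).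
Proof.
rewrite (expand_det_row _ ord0) !big_ord_recl big_ord0 /cofactor.
rewrite !(expand_det_row _ ord0) !big_ord_recl !big_ord0 /cofactor !det_mx11 !mxE /=.
rewrite /bump /=; ring.
Qed.

(** Laplace expansion along the first two columns. *)
Lemma det4E (F : comNzRingType) (m : nat -> nat -> F) :
  \det (\matrix_(i < 4, j < 4) m i j) =
  (m 0 0 * m 1 1 - m 0 1 * m 1 0) * (m 2 2 * m 3 3 - m 2 3 * m 3 2) -
  (m 0 0 * m 2 1 - m 0 1 * m 2 0) * (m 1 2 * m 3 3 - m 1 3 * m 3 2) +
  (m 0 0 * m 3 1 - m 0 1 * m 3 0) * (m 1 2 * m 2 3 - m 1 3 * m 2 2) +
  (m 1 0 * m 2 1 - m 1 1 * m 2 0) * (m 0 2 * m 3 3 - m 0 3 * m 3 2) -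
  (m 1 0 * m 3 1 - m 1 1 * m 3 0) * (m 0 2 * m 2 3 - m 0 3 * m 2 2) +
  (m 2 0 * m 3 1 - m 2 1 * m 3 0) * (m 0 2 * m 1 3 - m 0 3 * m 1 2).
Proof.
rewrite (expand_det_row _ ord0) !big_ord_recl big_ord0 /cofactor !mxE /=.
have E (j : 'I_4) : \det (row' ord0 (col' j (\matrix_(i < 4, j0 < 4) m i j0))) =
    \det (\matrix_(i < 3, j0 < 3) m i.+1 (bump j j0)).
  by congr (\det _); apply/matrixP => a b; rewrite !mxE.
by rewrite !E !(det3E (fun a b => m a.+1 (bump _ b))) /bump /=; ring.
Qed.

Section Position.
Variables (F : numClosedFieldType).
Implicit Types (A : 'I_4 -> 'M[F]_(4, 2)) (p : pluecker_coord -> F).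

Definition pcoord i a b : pluecker_coord := (i, (inord a, inord b)).

(** The bilinear form on Pluecker coordinates that vanishes when two lines meet;
    see [meet_incidence]. *)
Definition incidence (S : pzRingType) (c : nat -> nat -> nat -> S) i j : S :=
  c i 0 1 * c j 2 3 - c i 0 2 * c j 1 3 + c i 0 3 * c j 1 2 +
  c i 1 2 * c j 0 3 - c i 1 3 * c j 0 2 + c i 2 3 * c j 0 1.

Definition incidence_form i j : mpolyT F pluecker_coord :=
  incidence (fun i a b => var F (pcoord (inord i) a b)) i j.

(** Over an algebraically closed field it vanishes if and only if the square
    roots of [a], [b] and [c], with suitable signs, add up to zero. *)
Definition discriminant (S : pzRingType) (a b c : S) : S :=
  a ^+ 2 + b ^+ 2 + c ^+ 2 - (a * b) *+ 2 - (b * c) *+ 2 - (c * a) *+ 2.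

Definition discriminant_form : mpolyT F pluecker_coord :=
  discriminant (incidence_form 0 1 * incidence_form 2 3)
    (incidence_form 0 2 * incidence_form 1 3) (incidence_form 0 3 * incidence_form 1 2).

Definition general_form : mpolyT F pluecker_coord :=
  discriminant_form * \prod_(u : 'I_4 * 'I_4 | u.1 != u.2) incidence_form u.1 u.2.

Lemma rmorph_incidence (S S' : pzRingType) (g : {rmorphism S -> S'}) c i j :
  g (incidence c i j) = incidence (fun i a b => g (c i a b)) i j.
Proof. by rewrite /incidence !(rmorphB, rmorphD) /= !rmorphM. Qed.

Lemma rmorph_discriminant (S S' : pzRingType) (g : {rmorphism S -> S'}) a b c :
  g (discriminant a b c) = discriminant (g a) (g b) (g c).
Proof. by rewrite /discriminant !expr2 !mulr2n !rmorphB /= !rmorphD /= !rmorphM. Qed.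

Definition meet A i j : F := \det (row_mx (A i) (A j) : 'M_4).

Lemma meet_incidence A i j : meet A (inord i) (inord j) =
  incidence (fun i a b => pluecker A (pcoord (inord i) a b)) i j.
Proof.
pose m a b := if (b < 2)%N then A (inord i) (inord a) (inord b)
              else A (inord j) (inord a) (inord (b - 2)).
have -> : meet A (inord i) (inord j) = \det (\matrix_(a < 4, b < 4) m a b).
  congr (\det _); apply/matrixP => a b; rewrite !mxE /m inord_val.
  case: splitP => c cE; rewrite cE.
    by rewrite ltn_ord; congr (A _ _ _); apply/val_inj; rewrite /= inordK.
  by rewrite ltnNge leq_addr /= addKn; congr (A _ _ _); apply/val_inj; rewrite /= inordK.
have o0 : inord 0 = ord0 :> 'I_2 by apply/val_inj; rewrite /= inordK.
have o1 : inord 1 = ord_max :> 'I_2 by apply/val_inj; rewrite /= inordK.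
by rewrite det4E /m /incidence /pluecker /pcoord /= subnn o0 o1.
Qed.

Lemma meet_sym A i j : meet A i j = meet A j i.
Proof.
by rewrite -(inord_val i) -(inord_val j) !meet_incidence /incidence; ring.
Qed.

Lemma discriminant_sym (g : nat -> nat -> F) (i j k l : 'I_4) :
  (forall a b, g a b = g b a) -> uniq [:: i; j; k; l] ->
  discriminant (g l j * g i k) (g l i * g j k) (g l k * g i j) =
  discriminant (g 0 1 * g 2 3) (g 0 2 * g 1 3) (g 0 3 * g 1 2).
Proof.
move=> gC; rewrite /= !inE -!val_eqE /=.
case: i j k l => [[|[|[|[|//]]]] ?] [[|[|[|[|//]]]] ?] [[|[|[|[|//]]]] ?] [[|[|[|[|//]]]] ?] //= _;
rewrite /discriminant ?(gC 1 0)%N ?(gC 2 0)%N ?(gC 3 0)%N ?(gC 2 1)%N ?(gC 3 1)%N ?(gC 3 2)%N; ring.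
Qed.

End Position.

(** ** The fourth line does not lie on the quadric *)

(** The hypothesis says that every vector is an eigenvector. *)
Lemma minor2_scalar (F : numClosedFieldType) (P : 'M[F]_2) :
  (forall v : 'rV[F]_2, minor2 v (v *m P) = 0) -> P = (P ord0 ord0)%:M.
Proof.
move=> H; have o1 : lift ord0 ord0 = ord_max :> 'I_2 by exact: val_inj.
have ev (a b : F) : a * (a * P ord0 ord_max + b * P ord_max ord_max) -
    b * (a * P ord0 ord0 + b * P ord_max ord0) = 0.
  have := H (\row_j (if j == ord0 then a else b)).
  by rewrite /minor2 !mxE !big_ord_recl !big_ord0 !o1 !mxE /= !addr0.
have e1 := ev 1 0; have e2 := ev 0 1; have e3 := ev 1 1.
have z1 : P ord0 ord_max = 0 by rewrite -e1; ring.
have z2 : P ord_max ord0 = 0 by apply/eqP; rewrite -oppr_eq0 -e2; apply/eqP; ring.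
have z3 : P ord_max ord_max = P ord0 ord0.
  by apply/eqP; rewrite -subr_eq0 -e3 z1 z2; apply/eqP; ring.
apply/matrixP => a b; rewrite !mxE.
by case: (ord2_or a) => ->; case: (ord2_or b) => -> /=; rewrite ?mulr1n ?mulr0n.
Qed.

Lemma minor2_proportional (F : numClosedFieldType) (M N : 'M[F]_2) : M \in unitmx ->
  (forall u : 'rV[F]_2, minor2 (u *m M) (u *m N) = 0) -> exists c, N = c *: M.
Proof.
move=> uM H; have P v : minor2 v (v *m (invmx M *m N)) = 0.
  by have := H (v *m invmx M); rewrite mulmxKV // -mulmxA.
exists ((invmx M *m N) ord0 ord0).
by rewrite -mul_mx_scalar -(minor2_scalar P) mulKVmx.
Qed.

Section Transversality.
Variables (F : numClosedFieldType) (A : 'I_4 -> 'M[F]_(4, 2)).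
Hypothesis dl : forall i j, i != j -> (row_mx (A i) (A j) : 'M_4) \in unitmx.
Local Notation meet := (meet A).
Local Notation ker := (ker A).
Local Notation dual := (dual A).

Lemma meet_neq0 i j : i != j -> meet i j != 0.
Proof. by move=> /dl; rewrite unitmxE unitfE. Qed.

Lemma det_col_row (U V : 'M[F]_(2, 4)) i a : U *m A i = 1%:M -> V *m A i = 0 ->
  \det (col_mx U V : 'M_4) * meet i a = \det (V *m A a).
Proof.
move=> Ui Vi; rewrite /meet -det_mulmx.
have -> : (col_mx U V : 'M_4) *m (row_mx (A i) (A a) : 'M_4) =
    (block_mx 1%:M (U *m A a) 0 (V *m A a) : 'M_(2 + 2)).
  by have := mul_col_row U V (A i) (A a); rewrite Ui Vi.
by apply: (etrans (det_ublock (1%:M : 'M[F]_2) (U *m A a) (V *m A a))); rewrite det1 mul1r.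
Qed.

Lemma det_ker l : exists2 k, k != 0 & forall a, \det (ker l *m A a) = k * meet l a.
Proof.
exists (\det (col_mx (sec A l) (ker l) : 'M_4)).
  have := det_col_row (mate l) (sec_lines dl l) (ker_lines dl l).
  rewrite ker_mate // det1 => E; apply/eqP => z; move/eqP: E.
  by rewrite z mul0r eq_sym oner_eq0.
by move=> a; rewrite det_col_row // ?sec_lines ?ker_lines.
Qed.

Lemma det_dual i j a : i != j -> \det (dual i j *m A a) * meet i j = meet j a.
Proof.
move=> ij; have ji : j != i by rewrite eq_sym.
have [d1 d2] := dual_lines dl ij; have [e1 e2] := dual_lines dl ji.
have H b := det_col_row b e1 d2; have := H i; rewrite d1 det1 => Hi.
rewrite -H [meet i j]meet_sym mulrAC Hi mul1r //.
Qed.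

(** If the line lies on the quadric, then for every point of it the images
    under [M] and [N] are proportional, whence [N = c *: M].  Comparing
    determinants, the three arguments of the discriminant are in the ratio
    [1 : c ^+ 2 : (1 + c) ^+ 2]. *)
Lemma line_not_in_quadric i j k l : uniq [:: i; j; k; l] ->
  discriminant (meet l j * meet i k) (meet l i * meet j k) (meet l k * meet i j) != 0 ->
  exists2 x : 'rV[F]_4, x *m A l = 0 & evf x (quad A i j k) != 0.
Proof.
move=> u disc; apply: contrapT => nex.
have := u; rewrite /= !inE !negb_or => /and4P[/and3P[ij ik il] /andP[jk jl] kl _].
have ji : j != i by rewrite eq_sym.
pose M := ker l *m A j *m (dual j i *m A k).
pose N := ker l *m A i *m (dual i j *m A k).
have [c cE] : exists c, N = c *: M.
  apply: minor2_proportional => [|v].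
    rewrite unitmx_mul; apply/andP; split; first exact: ker_unit.
    rewrite unitmxE unitfE; apply/eqP => z; have := det_dual k ji; rewrite z mul0r.
    by move/esym/eqP; rewrite (negbTE (meet_neq0 ik)).
  apply: contrapT => /eqP nz; apply: nex; exists (v *m ker l).
    by rewrite -mulmxA ker_lines // mulmx0.
  by move: nz; rewrite evf_quad /M /N !mulmxA.
have MN : M + N = ker l *m A k.
  by rewrite /M /N -!mulmxA -mulmxDr !mulmxA -!mulmxDl addrC dual_sum // mul1mx.
have [q q0 qE] := det_ker l.
have dM : \det M * meet i j = q * (meet l j * meet i k).
  by rewrite det_mulmx qE -(det_dual k ji) [meet j i]meet_sym; ring.
have dN : \det N * meet i j = q * (meet l i * meet j k).
  by rewrite det_mulmx qE -(det_dual k ij); ring.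
have dMN : \det (M + N) * meet i j = q * (meet l k * meet i j) by rewrite MN qE mulrA.
have sc t : \det (t *: M) = t ^+ 2 * \det M by rewrite detZ.
have E1 : meet l i * meet j k = c ^+ 2 * (meet l j * meet i k).
  by apply: (mulfI q0); rewrite -dN cE sc [RHS]mulrCA -dM mulrA.
have E2 : meet l k * meet i j = (1 + c) ^+ 2 * (meet l j * meet i k).
  apply: (mulfI q0); rewrite -dMN cE -{1}[M]scale1r -scalerDl sc.
  by rewrite [RHS]mulrCA -dM mulrA.
by case/eqP: disc; rewrite E1 E2 /discriminant; ring.
Qed.

End Transversality.

(** ** The open set of general lines *)

Section GeneralPosition.
Variables (F : numClosedFieldType).
Implicit Types (A : 'I_4 -> 'M[F]_(4, 2)).
Local Notation PC := pluecker_coord.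

Lemma peval_incidence (p : PC -> F) i j : peval (incidence_form F i j) p =
  incidence (fun i a b => p (pcoord (inord i) a b)) i j.
Proof.
rewrite pevalE /incidence_form (rmorph_incidence (ev idfun p)).
by rewrite /incidence /= !ev_var.
Qed.

Lemma general_formE A (i j : 'I_4) : peval (incidence_form F i j) (pluecker A) = meet A i j.
Proof. by rewrite peval_incidence -meet_incidence !inord_val. Qed.

Lemma general_disjoint A : peval (general_form F) (pluecker A) != 0 ->
  forall i j, i != j -> (row_mx (A i) (A j) : 'M_4) \in unitmx.
Proof.
rewrite pevalM mulf_eq0 negb_or peval_prod => /andP[_ /prodf_neq0 H] i j ij.
by have := H (i, j) ij; rewrite general_formE unitmxE unitfE.
Qed.

Lemma general_transversal A : peval (general_form F) (pluecker A) != 0 ->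
  forall i j k l, uniq [:: i; j; k; l] ->
  exists2 x : 'rV[F]_4, x *m A l = 0 & evf x (quad A i j k) != 0.
Proof.
move=> G; have dl := general_disjoint G; move: G.
rewrite pevalM mulf_eq0 negb_or => /andP[D _] i j k l u.
apply: (line_not_in_quadric dl u).
have := @discriminant_sym F (fun a b => meet A (inord a) (inord b)) i j k l
  (fun a b => meet_sym A _ _) u.
rewrite /= !inord_val => ->; move: D.
rewrite pevalE /discriminant_form (rmorph_discriminant (ev idfun (pluecker A))) !rmorphM /=.
by rewrite -!pevalE !peval_incidence -!meet_incidence.
Qed.

Lemma incidence_homog i j : mhomog pluecker_block
  (fun t => ((inord i == t :> 'I_4) + (inord j == t :> 'I_4))%N) (incidence_form F i j).
Proof.
have h a b c d : mhomog pluecker_block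
    (fun t => ((inord i == t :> 'I_4) + (inord j == t :> 'I_4))%N)
    (var F (pcoord (inord i) a b) * var F (pcoord (inord j) c d)).
  by apply: mhomogM; exact: (@mhomog_var F _ _ pluecker_block).
exact: (mhomogD (mhomogB (mhomogD (mhomogD (mhomogB (h _ _ _ _) (h _ _ _ _)) (h _ _ _ _))
  (h _ _ _ _)) (h _ _ _ _)) (h _ _ _ _)).
Qed.

Lemma general_homog : exists e, mhomog pluecker_block e (general_form F).
Proof.
have hD i j k l : uniq [:: inord i; inord j; inord k; inord l : 'I_4] ->
    mhomog pluecker_block (fun=> 1%N) (incidence_form F i j * incidence_form F k l).
  move=> u; apply: eq_mhomog _ (mhomogM (@incidence_homog i j) (@incidence_homog k l)) => t.
  have := sum_four (fun a : 'I_4 => (a == t) : nat) u; rewrite (bigD1 t) //= eqxx big1 => [|a /negbTE -> //].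
  by move=> E; rewrite addnA; exact: (esym E).
have u1 : uniq [:: inord 0; inord 1; inord 2; inord 3 : 'I_4].
  by rewrite /= !inE -!val_eqE /= !inordK.
have u2 : uniq [:: inord 0; inord 2; inord 1; inord 3 : 'I_4].
  by rewrite /= !inE -!val_eqE /= !inordK.
have u3 : uniq [:: inord 0; inord 3; inord 1; inord 2 : 'I_4].
  by rewrite /= !inE -!val_eqE /= !inordK.
have hm i j k l i' j' k' l' u u' := mhomogM (hD i j k l u) (hD i' j' k' l' u').
eexists; apply: mhomogM; last first.
  exact: (@mhomog_prod F _ _ pluecker_block _ (index_enum ('I_4 * 'I_4)%type)
    (fun u => u.1 != u.2) _ _ (fun u _ => @incidence_homog u.1 u.2)).
rewrite /discriminant_form /discriminant !expr2 !mulr2n.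
by apply: mhomogB; first (apply: mhomogB; first (apply: mhomogB; first (apply: mhomogD;
  first apply: mhomogD))); first [exact: hm | apply: mhomogD; exact: hm].
Qed.

End GeneralPosition.

(** ** Four lines in general position *)

Section Example.
Variable F : numClosedFieldType.

(** The lines [I; 0], [0; I], [I; I] and [I; diag(2, 3)] in blocks of size 2.
    The three arguments of the discriminant are 2, 1 and 6, and its value
    is 1. *)
Definition sample_entry (i r c : nat) : int :=
  match i with
  | 0 => (r == c)
  | 1 => (r == c + 2)%N
  | 2 => (r %% 2 == c)%N
  | _ => if (r < 2)%N then (r == c) : nat else if (r == c + 2)%N then r else 0%N
  end.

Definition sample (i : 'I_4) : 'M[F]_(4, 2) := \matrix_(r, c) (sample_entry i r c)%:~R.

Definition sample_minor i a b : int :=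
  sample_entry i a 0 * sample_entry i b 1 - sample_entry i a 1 * sample_entry i b 0.

Lemma sample_pluecker i a b : (i < 4)%N -> (a < 4)%N -> (b < 4)%N ->
  pluecker sample (pcoord (inord i) a b) = (sample_minor i a b)%:~R.
Proof. by move=> hi ha hb; rewrite /= !mxE !inordK // rmorphB !rmorphM. Qed.

Lemma sample_incidence i j : (i < 4)%N -> (j < 4)%N ->
  peval (incidence_form F i j) (pluecker sample) = (incidence sample_minor i j)%:~R.
Proof.
move=> hi hj; rewrite peval_incidence (rmorph_incidence (intmul 1 : {rmorphism int -> F})).
by rewrite /incidence !sample_pluecker.
Qed.

Lemma sample_general : peval (general_form F) (pluecker sample) != 0.
Proof.
rewrite pevalM mulf_neq0 //.
  rewrite pevalE /discriminant_form (rmorph_discriminant (ev idfun _)) !rmorphM /= -!pevalE.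
  rewrite !sample_incidence // -!rmorphM -(rmorph_discriminant (intmul 1 : {rmorphism int -> F})).
  by rewrite /= intr_eq0.
rewrite peval_prod; apply/prodf_neq0 => -[[i hi] [j hj]] /= ij.
rewrite sample_incidence // intr_eq0; move: ij; rewrite -val_eqE /=.
by case: i j hi hj => [|[|[|[|//]]]] [|[|[|[|//]]]].
Qed.

Lemma sample_mproj : mproj pluecker_block (pluecker sample).
Proof.
move=> [i hi]; have hI : Ordinal hi = inord i :> 'I_4 by apply/val_inj; rewrite /= inordK.
have [i1|i1] := eqVneq i 1%N.
  exists (pcoord (inord i) 2 3); first by rewrite hI.
  by rewrite sample_pluecker // intr_eq0 i1.
exists (pcoord (inord i) 0 1); first by rewrite hI.
by rewrite sample_pluecker // intr_eq0; case: i i1 hi {hI} => [|[|[|[|//]]]].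
Qed.

Lemma disjoint_rank (A : 'I_4 -> 'M[F]_(4, 2)) :
  (forall i j, i != j -> (row_mx (A i) (A j) : 'M_4) \in unitmx) -> four_lines A.
Proof.
move=> dl i; apply/eqP; rewrite eqn_leq rank_leq_col /=.
by rewrite -{1}(mxrank1 F 2) -(sec_lines dl i) mxrankM_maxr.
Qed.

End Example.

Theorem effective_cone_general (F : numClosedFieldType) (R : realType) :
  for_general_lines (fun A : 'I_4 -> 'M[F]_(4, 2) =>
    forall h : 'rV[F]_4, h != 0 -> forall (d : R) (m : 'I_4 -> R),
      in_effective_cone bl_block (blowup A) (class A h d m) <-> cone_inequalities d m).
Proof.
exists [set p | mproj pluecker_block p /\ peval (general_form F) p != 0]; split.
- exists [set p | mproj pluecker_block p /\ forall P, P = general_form F -> peval P p = 0].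
    by exists [set general_form F]; split=> // P ->; exact: general_homog.
  apply/seteqP; split=> p [mp gp]; split=> //.
    by move=> [_ H]; case/eqP: gp; exact: H.
  by apply: contra_notN gp => /eqP g0; split=> // P ->.
- exists (sample F); last by split; [exact: sample_mproj|exact: sample_general].
  by apply: disjoint_rank; apply: general_disjoint; exact: sample_general.
move=> A _ [_ G] h h0 d m; have dl := general_disjoint G.
have nt := general_transversal G; split; first exact: cone_necessary.
move=> ineq; apply: cone_class_sufficient => //.
apply: (generated (P := cone_class A h (R := R)) _ _ _ _ _ _ _ ineq).
- by move=> *; apply: eq_cone_class; eassumption.
- exact: cone_class0.
- by move=> *; apply: cone_classZ.
- by move=> *; apply: cone_classD.
- by move=> i; apply: cone_class_exc.
- by move=> i; apply: cone_class_plane.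
- by move=> i j k ij ik jk; apply: cone_class_quadric.
Qed.

Theorem theorem5p2 (R : realType) :
  for_general_lines (fun A : 'I_4 -> 'M[R[i]]_(4, 2) =>
    forall h : 'rV[R[i]]_4, h != 0 ->
    forall (d : R) (m : 'I_4 -> R),
      in_effective_cone bl_block (blowup A)
        (fun V => d * (plane_divisor A h V)%:R
                  - \sum_(i < 4) m i * (exceptional_divisor A i V)%:R)
      <->
      [/\ 0 <= d,
          forall i, m i <= d,
          forall i j, i != j -> m i + m j <= d,
          forall i, \sum_(k < 4) m k + m i <= 2 * d &
          2 * (\sum_(k < 4) m k) <= 3 * d]).
Proof. exact: effective_cone_general. Qed.
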